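(* Let $\mathrm{pen}:\mathbb{R}^n\to\mathbb{R}\cup\{+\infty\}$ be any convex function, let $g^0\in\mathbb{R}^n$ be a fixed vector, let $\epsilon=(\epsilon_1,\dots,\epsilon_n)^T$ have i.i.d. Gaussian entries with mean zero and variance $\sigma^2>0$, and let $Y=g^0+\epsilon$. Let $$\hat g := \arg\min_{g\in\mathbb{R}^n}\bigl\{\|Y-g\|_n^2+\mathrm{pen}(g)\bigr\},\qquad m_0:=\mathbb{E}\|\hat g-g^0\|_n .$$ Then for all $t>0$, $$\mathbb{P}\Bigl(\bigl|\,\|\hat g-g^0\|_n-m_0\,\bigr|\ \ge\ \sigma\sqrt{2t/n}\Bigr)\le \exp[-t].$$
   Context: For $v\in\mathbb{R}^n$, $\|v\|_n^2:=v^Tv/n=\|v\|_2^2/n$. The model is the normal sequence model $Y_i=g^0(X_i)+\epsilon_i$, $i=1,\dots,n$, with fixed design points $X_i$, where $g^0$ is identified with the vector $(g^0(X_1),\dots,g^0(X_n))^T\in\mathbb{R}^n$. Standing convention: minimizers (''argmin'') are assumed to exist and to be unique (in particular $\mathrm{pen}$ is such that $\hat g$ is well defined). *)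

(* Defs.v *)
From HB Require Import structures.
From mathcomp Require Import all_boot all_order all_algebra.
From mathcomp Require Import all_classical all_reals all_analysis.

Set Implicit Arguments.
Unset Strict Implicit.
Unset Printing Implicit Defensive.

Import Order.TTheory GRing.Theory Num.Theory.
Import numFieldNormedType.Exports.

Local Open Scope classical_set_scope.
Local Open Scope ring_scope.

(* [x / 0 = 0], so this is the intended norm only for [0 < n]. *)
Definition norm_n (R : realType) (n : nat) (v : 'cV[R]_n) : R :=
  Num.sqrt ((v^T *m v) 0 0 / n%:R).

(* Convexity for functions with values in [R `|` {+oo}]; the library's
   [convex_function] only covers real-valued functions. Since
   [0 * +oo = 0] in [\bar R], the endpoints [s = 0] and [s = 1] impose nothing. *)
Definition convex_ereal (R : realType) (E : lmodType R) (f : E -> \bar R)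
    : Prop :=
  (forall x, f x != -oo%E) /\
  forall (x y : E) (s : R), 0 <= s <= 1 ->
    (f (s *: x + (1 - s) *: y)%R <= s%:E * f x + (1 - s)%:E * f y)%E.

Definition is_minimizer (R : realType) (E : Type) (f : E -> \bar R) (x : E)
    : Prop :=
  forall y, (f x <= f y)%E.

Definition is_argmin (R : realType) (E : Type) (f : E -> \bar R) (x : E)
    : Prop :=
  unique (is_minimizer f) x.

(* Mutual independence: the product rule over every subfamily. *)
Definition independent_RVs (d : measure_display) (T : measurableType d)
    (R : realType) (P : probability T R) (I : finType)
    (X : I -> {RV P >-> R}) : Prop :=
  forall (J : {set I}) (A : I -> set R), (forall i, measurable (A i)) ->
    P (\bigcap_(i in [set i | i \in J]) (X i @^-1` A i)) =
    (\prod_(i in J) P (X i @^-1` A i))%E.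

(* The law of [X] is N(m, s^2); the library's [normal_prob] takes the mean and
   the standard deviation. *)
Definition has_normal_law (d : measure_display) (T : measurableType d)
    (R : realType) (P : probability T R) (X : {RV P >-> R}) (m s : R) : Prop :=
  forall A : set R, measurable A -> distribution P X A = normal_prob m s A.

(* Main.v *)
(** The proximal map [Y |-> ghat] is nonexpansive, so [|ghat - g0| / sigma] is a
    1-Lipschitz function of the standard Gaussian vector [eps / sigma], and
    the theorem is Gaussian concentration for the centred function [W]:
    [P(|W| >= u) <= exp(-u^2/2)].  Exponential moments would lose a factor 2
    in this two-sided form.  Instead, for Lipschitz [h],
    [E[W h(W)] <= E[|h'|(W)]] (a Gaussian covariance inequality).  Take
    [h(w) = (exp(c^2/2) - 1)/c], where [c] is [w] clipped to [[-u, u]].  Then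
    [|h'(w)| - w h(w) <= 1] for [|w| <= u], while for [|w| > u] the first term
    vanishes and [w h(w) >= exp(u^2/2) - 1].  Integrating,
    [0 <= 1 - exp(u^2/2) P(|W| > u)].

    The covariance inequality comes from [Q(r) = E[f(A) g(rA + sqrt(1-r^2) Z)]],
    where [g = h o f]: [Q(1)] is the left-hand side, [Q(0) = 0], and each
    increment of [Q] along a geometric sequence is bounded using the rotation
    invariance of the Gaussian measure.  This needs a second-order expansion of
    [f], which is obtained by Lasry-Lions regularization. *)

Require Import Defs.
From HB Require Import structures.
From mathcomp Require Import all_boot all_order all_algebra.
From mathcomp Require Import all_classical all_reals all_analysis.
From mathcomp Require Import measurable_realfun normal_distribution ring lra.

Set Implicit Arguments.
Unset Strict Implicit.
Unset Printing Implicit Defensive.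

Import Order.TTheory GRing.Theory Num.Theory.
Import numFieldNormedType.Exports.

Local Open Scope classical_set_scope.
Local Open Scope ring_scope.

(** The second-order expansion keeps the bounds free of the dimension. Estimated by the Lipschitz
    constant alone, an increment of [f] along a Gaussian direction [B] has second moment of order
    [E|B|^2 = n]; compared with a linear form [q.B], [|q| <= 1], it has second moment at most 1 up
    to higher-order terms, whatever [n] is.

    For [al^2 + be^2 = 1], the vectors [al A + be B] and [al A - be B] are standard with correlation
    [1 - 2 be^2]. By polarization, [2 (Q(r) - Q((1 - 2 be^2) r))] is therefore the mean of a product
    of two increments in the direction [B], bounded by [4 r be^2 E[|h'|(W)] + O(r be^3)]. The steps
    of the geometric sequence carry weights [2 be^2 r] that add up to at most 1, so the accumulated
    error is [O(be)] and vanishes with [be].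

    The function [w h(w)] is even and large in both tails, so a single test function covers both
    signs and no union bound is paid.

    Passing to the estimator, nonexpansiveness holds for any two sample points. The estimation error
    thus factors through [eps / sigma], and this factorization also makes it measurable. *)

(** * Gaussian measure and rotations *)

(* The library has this measure only as an anonymous instance on [pushforward];
   the name is the one generated by Hierarchy Builder. *)
Definition image_measure d d' (T1 : measurableType d) (T2 : measurableType d')
    (R : realType) (m : {measure set T1 -> \bar R}) (f : T1 -> T2)
    (mf : measurable_fun setT f) : {measure set T2 -> \bar R} :=
  measure_function_pushforward__canonical__measure_function_Measure m mf.

(** * Affine substitutions and densities on the line *)

Section affine.
Context {R : realType}.
Notation RR := (measurableTypeR R).
Notation mu := (@lebesgue_measure R).
Local Open Scope ereal_scope.

Lemma measurable_affine (a b : R) :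
  measurable_fun [set: RR] (fun x : RR => (a * x + b)%R : RR).
Proof. by apply: measurable_funD => //; exact: measurable_funM. Qed.

(** Both sides are measures in [A], so it is enough to compare them on the intervals []p, q]]. For
    [a < 0] the preimage is half-open on the other side, which does not change its length. *)
Lemma lebesgue_measure_affine (a b : R) (A : set RR) : a != 0%R -> measurable A ->
  mu A = (`|a|)%:E * mu ((fun x => a * x + b)%R @^-1` A).
Proof.
move=> a0 mA.
have a1 : (0 < `|a|)%R by rewrite normr_gt0.
pose nu := mscale (NngNum (ltW a1)) (image_measure mu (measurable_affine a b)).
apply: (@lebesgue_measure_unique R nu) => // _ [[p q]] _ <-.
rewrite -[RHS]/((`|a|)%:E * mu ((fun x => a * x + b)%R @^-1` [set` `]p, q]%R])).
rewrite lebesgue_measure_itv/= lte_fin.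
have [ap|an] := ltP 0%R a.
  rewrite [X in mu X](_ : _ =
      [set` `](p - b) / a, (q - b) / a]]%R); last first.
    by apply/funext => x; rewrite /= !in_itv/= ltr_pdivrMr// ler_pdivlMr// ltrBlDr lerBrDr mulrC.
  rewrite lebesgue_measure_itv/= lte_fin ltr_pM2r ?invr_gt0// ltrD2r gtr0_norm//.
  case: ifPn => pq; last by rewrite mule0.
  by rewrite -!EFinD -EFinM; congr EFin; field.
have {}an : (a < 0)%R by rewrite lt_neqAle a0.
rewrite [X in mu X](_ : _ =
      [set` `[(q - b) / a, (p - b) / a[]%R); last first.
  by apply/funext => x; rewrite /= !in_itv/= ltr_ndivlMr// ler_ndivrMr// ltrBlDr lerBrDr mulrC andbC.
rewrite lebesgue_measure_itv/= lte_fin ltr_nM2r ?invr_lt0// ltrD2r ltr0_norm//.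
case: ifPn => pq; last by rewrite mule0.
by rewrite -!EFinD -EFinM; congr EFin; field.
Qed.

Lemma ge0_integral_affine (a b : R) (f : RR -> \bar R) : a != 0%R ->
  measurable_fun [set: RR] f -> (forall x, 0 <= f x) ->
  \int[mu]_x f x = `|a|%:E * \int[mu]_x f (a * x + b)%R.
Proof.
move=> a0 mf f0.
have a1 : (0 < `|a|)%R by rewrite normr_gt0.
pose nu := mscale (NngNum (ltW a1)) (image_measure mu (measurable_affine a b)).
transitivity (\int[nu]_x f x).
  by apply: eq_measure_integral => //= A mA _; exact: lebesgue_measure_affine.
by rewrite /nu ge0_integral_mscale//= ge0_integral_pushforward//=; exact: measurable_affine.
Qed.

Lemma ge0_integral_normal_prob (m s : R) (f : RR -> \bar R) :
  measurable_fun [set: RR] f -> (forall x, 0 <= f x) ->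
  \int[normal_prob m s]_x f x = \int[mu]_x (f x * (normal_pdf m s x)%:E).
Proof.
move=> mf f0.
have d := @normal_prob_dominates R m s.
rewrite -(Radon_Nikodym_SigmaFinite.change_of_variables d)//.
have intf := Radon_Nikodym_SigmaFinite.f_integrable d.
have mp : measurable_fun [set: RR] (fun x : RR => (normal_pdf m s x)%:E).
  by apply/measurable_EFinP; exact: measurable_normal_pdf.
apply: ae_eq_integral => //.
- by apply: emeasurable_funM => //; exact: (measurable_int mu).
- exact: emeasurable_funM.
(* The Radon-Nikodym derivative and [normal_pdf] have the same integral over every measurable set,
   hence agree almost everywhere. *)
- apply: ae_eqe_mul2l; apply: integral_ae_eq => //.
  by move=> E _ mE; rewrite -Radon_Nikodym_SigmaFinite.f_integral.
Qed.

End affine.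

(** * The Gaussian law on the line: rotations and moments *)

Section gauss1.
Context {R : realType}.
Notation RR := (measurableTypeR R).
Notation mu := (@lebesgue_measure R).
Local Open Scope ereal_scope.

(** A rotation is a composition of two one-dimensional substitutions: [u = a x + b y] for fixed [x],
    after which the second coordinate reads [(a u - x) / b], and then [v = (a u - x) / b] for fixed
    [u]. The Jacobians [1/|b|] and [|b|] cancel; this is where [b != 0] enters. *)
Lemma ge0_integral_lebesgue_rotation (a b : R) (f : RR * RR -> \bar R) :
  (a ^+ 2 + b ^+ 2 = 1)%R -> b != 0%R ->
  measurable_fun [set: RR * RR] f -> (forall p, 0 <= f p) ->
  \int[mu]_x \int[mu]_y f (a * x + b * y, a * y - b * x)%R =
  \int[mu]_x \int[mu]_y f (x, y).
Proof.
move=> ab b0 mf f0.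
have nb0 : (0 < `|b|)%R by rewrite normr_gt0.
pose K (p : RR * RR) := f (p.2, ((a * p.2 - p.1) / b)%R).
have mK : measurable_fun [set: RR * RR] K.
  apply: measurableT_comp => //; apply: measurable_fun_pair => //.
  apply: measurable_funM => //; apply: measurable_funB => //.
  exact: measurable_funM.
have K0 p : 0 <= K p by exact: f0.
have E1 x : \int[mu]_y f (a * x + b * y, a * y - b * x)%R =
    (`|b|^-1)%:E * \int[mu]_u K (x, u).
  rewrite (@ge0_integral_affine R b (a * x)%R (fun u => K (x, u)))//; last first.
    by apply: measurableT_comp => //; apply: measurable_fun_pair.
  rewrite muleA -EFinM mulVf ?gt_eqF// mul1e; apply: eq_integral => y _.
  rewrite /K/=; congr (f (_, _)); first by rewrite addrC.
  apply: (mulIf b0); rewrite divfK//.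
  transitivity ((a * (b * y + a * x) - x) + x * (1 - (a ^+ 2 + b ^+ 2)))%R; first by ring.
  by rewrite ab subrr mulr0 addr0.
under eq_integral do rewrite E1.
rewrite ge0_integralZl//; last 2 first.
- exact: (measurable_fun_fubini_tonelli_F K mK K0).
- by move=> x _; exact: integral_ge0.
rewrite (fubini_tonelli (m1 := mu) (m2 := mu) K mK K0).
have E2 u : \int[mu]_x K (x, u) = `|b|%:E * \int[mu]_v f (u, v).
  rewrite (@ge0_integral_affine R (- b)^-1 (a * u / b)%R (fun v => f (u, v)))//; last 2 first.
  - by rewrite invr_eq0 oppr_eq0.
  - by apply: measurableT_comp => //; apply: measurable_fun_pair.
  rewrite muleA -EFinM normfV normrN divff ?gt_eqF// mul1e; apply: eq_integral => x _.
  by rewrite /K/=; congr (f (_, _)); field.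
under eq_integral do rewrite E2.
rewrite ge0_integralZl//; last 2 first.
- exact: (measurable_fun_fubini_tonelli_F (m2 := mu) f mf f0).
- by move=> x _; exact: integral_ge0.
by rewrite muleA -EFinM mulVf ?gt_eqF// mul1e.
Qed.

(* [normal_prob] is a measure on [measurableTypeR R]; the image under the
   identity moves it to the Borel structure of [R]. *)
Definition idR : {mfun RR >-> R} :=
  HB.pack (idfun : RR -> R) (isMeasurableFun.Build _ _ RR R idfun (@measurable_id _ RR setT)).

Definition gauss1 : probability R R := distribution (normal_prob 0 1) idR.

Lemma ge0_integral_gauss1 (f : R -> \bar R) : measurable_fun [set: R] f ->
  (forall x, 0 <= f x) ->
  \int[gauss1]_x f x = \int[mu]_x (f x * (normal_pdf 0 1 x)%:E).
Proof.
move=> mf f0; rewrite -ge0_integral_normal_prob// /gauss1 ge0_integral_distribution//.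
Qed.

Lemma normal_pdf01E (x : R) :
  normal_pdf 0 1 x = (normal_peak 1 * expR (- (x ^+ 2 / 2)))%R.
Proof. by rewrite normal_pdfE ?oner_eq0// /normal_fun subr0 expr1n mulNr. Qed.

Lemma ge0_integral_gauss1_rotation (a b : R) (f : R * R -> \bar R) :
  (a ^+ 2 + b ^+ 2 = 1)%R -> b != 0%R ->
  measurable_fun [set: R * R] f -> (forall p, 0 <= f p) ->
  \int[gauss1 \x gauss1]_p f (a * p.1 + b * p.2, a * p.2 - b * p.1)%R =
  \int[gauss1 \x gauss1]_p f p.
Proof.
move=> ab b0 mf f0.
have L (g : R * R -> \bar R) : measurable_fun [set: R * R] g -> (forall p, 0 <= g p) ->
    \int[gauss1 \x gauss1]_p g p =
    \int[mu]_x \int[mu]_y (g (x, y) * (normal_pdf 0 1 x * normal_pdf 0 1 y)%:E).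
  move=> mg g0; rewrite fubini_tonelli1// ge0_integral_gauss1//; last 2 first.
  - exact: measurable_fun_fubini_tonelli_F.
  - by move=> x; exact: integral_ge0.
  apply: eq_integral => x _.
  rewrite /fubini_F ge0_integral_gauss1//; last first.
    by apply: measurableT_comp => //; apply: measurable_fun_pair.
  rewrite muleC -ge0_integralZl//.
  - by apply: eq_integral => y _; rewrite EFinM muleCA.
  - apply: emeasurable_funM => //; first by apply: measurableT_comp => //; exact: measurable_fun_pair.
    by apply/measurable_EFinP; exact: measurable_normal_pdf.
  - by move=> y _; rewrite mule_ge0// lee_fin normal_pdf_ge0.
  - by rewrite lee_fin normal_pdf_ge0.
rewrite (L _ mf f0).
pose fr (p : R * R) := f (a * p.1 + b * p.2, a * p.2 - b * p.1)%R.
have mfr : measurable_fun [set: R * R] fr.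
  apply: (measurableT_comp mf); apply: measurable_fun_pair => //=.
    by apply: measurable_funD => //; exact: measurable_funM.
  by apply: measurable_funB => //; exact: measurable_funM.
have fr0 p : 0 <= fr p by exact: f0.
rewrite -/(fr _) (L fr mfr fr0).
pose g (p : RR * RR) := f p * (normal_pdf 0 1 p.1 * normal_pdf 0 1 p.2)%:E.
have mg : measurable_fun [set: RR * RR] g.
  apply: emeasurable_funM => //; apply/measurable_EFinP; apply: measurable_funM.
    by apply: measurableT_comp => //; exact: measurable_normal_pdf.
  by apply: measurableT_comp => //; exact: measurable_normal_pdf.
have g0 p : 0 <= g p by rewrite mule_ge0// lee_fin mulr_ge0// normal_pdf_ge0.
rewrite -(ge0_integral_lebesgue_rotation ab b0 mg g0).
apply: eq_integral => x _; apply: eq_integral => y _ /=; congr (_ * _%:E).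
rewrite !normal_pdf01E mulrACA [RHS]mulrACA -!expRD; congr (_ * expR _)%R.
(* The product density depends on [x^2 + y^2] only. *)
have : ((a * x + b * y) ^+ 2 + (a * y - b * x) ^+ 2 = x ^+ 2 + y ^+ 2)%R.
  by transitivity ((a ^+ 2 + b ^+ 2) * (x ^+ 2 + y ^+ 2))%R; [ring|rewrite ab mul1r].
by move=> h /=; rewrite -!opprD -!mulrDl h.
Qed.

Lemma gauss1_normal_prob (s : R) (A : set R) : (0 < s)%R -> measurable A ->
  normal_prob 0 s ((fun x => x / s)%R @^-1` A) = gauss1 A.
Proof.
move=> s0 mA.
have sn0 : s != 0%R by rewrite gt_eqF.
rewrite -[RHS]/(normal_prob 0 1 A) /normal_prob integral_mkcond [RHS]integral_mkcond.
rewrite [RHS](@ge0_integral_affine R s^-1 0)//; last 3 first.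
- by rewrite invr_eq0.
- apply/(measurable_restrictT _ _).1 => //.
  by apply/measurable_funTS/measurable_EFinP; exact: measurable_normal_pdf.
- by move=> x; rewrite patchE; case: ifP => // _; rewrite lee_fin normal_pdf_ge0.
rewrite gtr0_norm ?invr_gt0// -ge0_integralZl//; last 3 first.
- apply: (measurableT_comp (f := (fun x => (normal_pdf 0 1 x)%:E) \_ A)).
    apply/(measurable_restrictT _ _).1 => //.
    by apply/measurable_funTS/measurable_EFinP; exact: measurable_normal_pdf.
  exact: measurable_affine.
- by move=> x _; rewrite patchE; case: ifP => // _; rewrite lee_fin normal_pdf_ge0.
- by rewrite lee_fin invr_ge0 ltW.
apply: eq_integral => x _; rewrite !patchE addr0 [(s^-1 * x)%R]mulrC.
have -> : (x \in (fun x : R => x / s)%R @^-1` A) = (x / s \in A)%R.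
  by apply/idP/idP; rewrite !inE.
case: ifPn => _; last by rewrite mule0.
rewrite -EFinM; congr EFin.
rewrite normal_pdf01E normal_pdfE// /normal_fun subr0 mulrA; congr (_ * expR _)%R.
  rewrite /normal_peak expr1n -mulrnAr sqrtrM ?sqr_ge0// sqrtr_sqr gtr0_norm//.
  by rewrite invfM mul1r.
by field.
Qed.

Lemma gauss1_symmetric (f : R -> \bar R) : measurable_fun [set: R] f ->
  (forall x, 0 <= f x) -> \int[gauss1]_x f (- x)%R = \int[gauss1]_x f x.
Proof.
move=> mf f0; rewrite !ge0_integral_gauss1//; last exact: measurableT_comp.
rewrite [RHS](@ge0_integral_affine R (-1) 0)//; last 2 first.
- apply: emeasurable_funM => //.
  by apply/measurable_EFinP; exact: measurable_normal_pdf.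
- by move=> x; rewrite mule_ge0// lee_fin normal_pdf_ge0.
rewrite normrN1 mul1e; apply: eq_integral => x _.
by rewrite addr0 mulN1r !normal_pdf01E sqrrN.
Qed.

(** The substitution [x = k y] turns the integrand, density included, into [k] times the standard
    density. All moment bounds come from this one integral. *)
Lemma gauss1_expR_sqr (k : R) : (0 < k)%R ->
  \int[gauss1]_x (expR ((1 - k ^- 2) / 2 * x ^+ 2))%:E = k%:E.
Proof.
move=> k0; have kn0 : k != 0%R by rewrite gt_eqF.
have me : measurable_fun [set: R] (fun x => (expR ((1 - k ^- 2) / 2 * x ^+ 2))%:E).
  apply/measurable_EFinP/measurableT_comp => //; exact: measurable_funM.
rewrite ge0_integral_gauss1//.
rewrite (@ge0_integral_affine R k 0)//; last 2 first.
- apply: emeasurable_funM => //.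
  by apply/measurable_EFinP; exact: measurable_normal_pdf.
- by move=> x; rewrite mule_ge0// lee_fin ?expR_ge0 ?normal_pdf_ge0.
rewrite gtr0_norm// -[RHS]mule1 -(@integral_normal_pdf R 0 1); congr (_ * _).
apply: eq_integral => x _; rewrite addr0 -EFinM !normal_pdf01E mulrCA -expRD.
by congr (_ * expR _)%:E; field.
Qed.

(** With [t = (1 - k^-2)/2], integrating [1 + t x^2 <= exp(t x^2)] bounds the second moment by
    [(k - 1)/t = 2 k^2/(k + 1)], which tends to 1 as [k] decreases to 1. *)
Lemma gauss1_sqr_le1 : \int[gauss1]_x (x ^+ 2)%:E <= 1.
Proof.
have V0 : 0 <= \int[gauss1]_x (x ^+ 2)%:E.
  by apply: integral_ge0 => x _; rewrite lee_fin sqr_ge0.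
have H (k : R) : (1 < k)%R -> \int[gauss1]_x (x ^+ 2)%:E <= (2 * k ^+ 2 / (k + 1))%:E.
  move=> k1; have k0 : (0 < k)%R by lra.
  have t0 : (0 < (1 - k ^- 2) / 2)%R.
    by rewrite divr_gt0// subr_gt0 invf_lt1 ?exprn_gt0// exprn_egt1.
  have : \int[gauss1]_x (1 + ((1 - k ^- 2) / 2)%:E * (x ^+ 2)%:E) <= k%:E.
    rewrite -(gauss1_expR_sqr k0); apply: ge0_le_integral => //.
    - by move=> x _; rewrite adde_ge0// mule_ge0// lee_fin ?sqr_ge0 ?ltW.
    - apply: emeasurable_funD => //; apply: emeasurable_funM => //.
      by apply/measurable_EFinP; exact: measurable_funX.
    - apply/measurable_EFinP/measurableT_comp => //; exact: measurable_funM.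
    - by move=> x _; rewrite -EFinM -EFinD lee_fin expR_ge1Dx.
  rewrite ge0_integralD//; last 2 first.
  - by move=> x _; rewrite mule_ge0// lee_fin ?sqr_ge0 ?ltW.
  - apply: emeasurable_funM => //.
    by apply/measurable_EFinP; exact: measurable_funX.
  rewrite ge0_integralZl//; last 3 first.
  - by apply/measurable_EFinP; exact: measurable_funX.
  - by move=> x _; rewrite lee_fin sqr_ge0.
  - by rewrite lee_fin ltW.
  rewrite integral_cst//= probability_setT mule1.
  move: V0; case: (\int[gauss1]_x (x ^+ 2)%:E) => [v| |]//; last first.
    by rewrite gt0_muley// lte_fin.
  move=> _; rewrite -EFinM -EFinD !lee_fin => h.
  rewrite ler_pdivlMr; last by lra.
  have : ((1 - k ^- 2) / 2 * v <= k - 1)%R by lra.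
  rewrite -(ler_pM2r (_ : 0 < 2 * k ^+ 2 / (k - 1))%R); last first.
    by rewrite divr_gt0 ?mulr_gt0 ?exprn_gt0//; lra.
  have -> : ((k - 1) * (2 * k ^+ 2 / (k - 1)) = 2 * k ^+ 2)%R by field; lra.
  suff -> : ((1 - k ^- 2) / 2 * v * (2 * k ^+ 2 / (k - 1)) = v * (k + 1))%R by [].
  by field; apply/andP; split; lra.
apply/lee_addgt0Pr => e e0.
apply: (le_trans (H (1 + e / 2)%R _)); first by lra.
rewrite -EFinD lee_fin ler_pdivrMr; last by lra.
by nra.
Qed.

Lemma gauss1_expn4_lty : \int[gauss1]_x (x ^+ 4)%:E < +oo.
Proof.
have k0 : (0 < 2 :> R)%R by lra.
have me : measurable_fun [set: R] (fun x => (expR ((1 - 2 ^- 2) / 2 * x ^+ 2))%:E).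
  apply/measurable_EFinP/measurableT_comp => //; exact: measurable_funM.
(* At [k = 2] the exponent is [z = 3 x^2 / 8], so [x^4 = 256/9 (z/2)^2], and
   [(z/2)^2 <= exp(z/2)^2 = exp z]. *)
apply: (@le_lt_trans _ _ (\int[gauss1]_x ((256 / 9)%:E * (expR ((1 - 2 ^- 2) / 2 * x ^+ 2))%:E))).
  apply: ge0_le_integral => //.
  - by move=> x _; rewrite lee_fin exprn_even_ge0.
  - by apply/measurable_EFinP; exact: measurable_funX.
  - exact: emeasurable_funM.
  - move=> x _; rewrite -EFinM lee_fin.
    set z := (_ * x ^+ 2)%R.
    have z0 : (0 <= z)%R by rewrite mulr_ge0 ?sqr_ge0//; lra.
    have -> : (x ^+ 4 = 256 / 9 * (z / 2) ^+ 2)%R by rewrite /z; field.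
    rewrite ler_pM2l; last by lra.
    have {2}-> : z = (z / 2 + z / 2)%R by field.
    rewrite expRD -expr2 ler_pXn2r ?nnegrE ?expR_ge0 ?divr_ge0//.
    by apply: le_trans (expR_ge1Dx _); lra.
rewrite ge0_integralZl//.
by rewrite gauss1_expR_sqr// -EFinM ltry.
Qed.

End gauss1.

(** * Products of two probability measures *)

Section prob_prod.
Context d1 d2 (T1 : measurableType d1) (T2 : measurableType d2) {R : realType}.
Variables (P1 : probability T1 R) (P2 : probability T2 R).
Local Open Scope ereal_scope.

Definition prob_prod : probability (T1 * T2)%type R := P1 \x P2.

Lemma prob_prodE A B : measurable A -> measurable B ->
  prob_prod (A `*` B) = P1 A * P2 B.
Proof. exact: product_measure1E. Qed.

Lemma prob_prod_tonelli (f : T1 * T2 -> \bar R) :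
  measurable_fun setT f -> (forall p, 0 <= f p) ->
  \int[prob_prod]_p f p = \int[P1]_x \int[P2]_y f (x, y).
Proof. exact: fubini_tonelli1. Qed.

Lemma prob_prod_tonelli_swap (f : T1 * T2 -> \bar R) :
  measurable_fun setT f -> (forall p, 0 <= f p) ->
  \int[P1]_x \int[P2]_y f (x, y) = \int[P2]_y \int[P1]_x f (x, y).
Proof. exact: fubini_tonelli. Qed.

Lemma measurable_prob_integral (f : T1 * T2 -> \bar R) :
  measurable_fun setT f -> (forall p, 0 <= f p) ->
  measurable_fun setT (fun x => \int[P2]_y f (x, y)).
Proof. exact: measurable_fun_fubini_tonelli_F. Qed.

Lemma prob_prod_fubini (f : T1 * T2 -> \bar R) :
  prob_prod.-integrable setT f ->
  \int[prob_prod]_p f p = \int[P1]_x \int[P2]_y f (x, y).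
Proof. by move=> fi; rewrite -[LHS]integral12_prod_meas1. Qed.

Lemma ge0_integral_prob_prod_fst (h : T1 -> \bar R) : measurable_fun setT h ->
  (forall x, 0 <= h x) -> \int[prob_prod]_p h p.1 = \int[P1]_x h x.
Proof.
move=> mh h0; rewrite (prob_prod_tonelli (f := fun p => h p.1))//; last first.
  exact: (measurableT_comp mh).
apply: eq_integral => x _.
by rewrite -[LHS]/(\int[P2]_y cst (h x) y) integral_cst//= probability_setT mule1.
Qed.

Lemma ge0_integral_prob_prod_snd (h : T2 -> \bar R) : measurable_fun setT h ->
  (forall x, 0 <= h x) -> \int[prob_prod]_p h p.2 = \int[P2]_x h x.
Proof.
move=> mh h0; rewrite (prob_prod_tonelli (f := fun p => h p.2))//; last first.
  exact: (measurableT_comp mh).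
by rewrite -[LHS]/(\int[P1]_y cst (\int[P2]_x h x) y) integral_cst//= probability_setT mule1.
Qed.

End prob_prod.

(** * Standard Gaussian vectors and their rotations *)

Section gauss.
Context {R : realType}.
Local Open Scope ereal_scope.

Lemma measurable_tcons (n : nat) :
  measurable_fun setT (fun p : (R * n.-tuple R)%type => [tuple of p.1 :: p.2]).
Proof. exact: measurable_cons. Qed.

Definition tcons (n : nat) : {mfun (R * n.-tuple R)%type >-> (n.+1.-tuple R)%type} :=
  HB.pack (fun p : (R * n.-tuple R)%type => [tuple of p.1 :: p.2])
    (isMeasurableFun.Build _ _ _ _ _ (@measurable_tcons n)).

Fixpoint gauss (n : nat) : probability (n.-tuple R)%type R :=
  match n with
  | 0 => \d_[tuple]
  | n'.+1 => distribution (prob_prod gauss1 (gauss n')) (tcons n')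
  end.

Lemma ge0_integral_gaussS n (f : n.+1.-tuple R -> \bar R) :
  measurable_fun setT f -> (forall x, 0 <= f x) ->
  \int[gauss n.+1]_x f x = \int[gauss1]_x \int[gauss n]_y f [tuple of x :: y].
Proof.
move=> mf f0; rewrite ge0_integral_distribution// prob_prod_tonelli//.
- by apply: measurableT_comp.
- by move=> x; exact: f0.
Qed.

(** Regroups two vectors into the pair of their heads and the pair of their tails. A rotation of the
    two vectors acts on each pair separately, so rotation invariance follows by induction from the
    planar case. *)
Lemma ge0_integral_gaussS2 n (f : n.+1.-tuple R * n.+1.-tuple R -> \bar R) :
  measurable_fun setT f -> (forall x, 0 <= f x) ->
  \int[prob_prod (gauss n.+1) (gauss n.+1)]_p f p =
  \int[prob_prod gauss1 gauss1]_a \int[prob_prod (gauss n) (gauss n)]_b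
    f ([tuple of a.1 :: b.1], [tuple of a.2 :: b.2]).
Proof.
move=> mf f0.
pose k (q : (R * R) * (n.-tuple R * n.-tuple R)) :=
  f ([tuple of q.1.1 :: q.2.1], [tuple of q.1.2 :: q.2.2]).
have mk : measurable_fun setT k.
  apply: measurableT_comp => //; apply: measurable_fun_pair => //=.
    by apply: measurable_cons; exact: measurableT_comp.
  by apply: measurable_cons; exact: measurableT_comp.
have k0 q : 0 <= k q by exact: f0.
have mFk := measurable_prob_integral (prob_prod (gauss n) (gauss n)) mk k0.
rewrite (prob_prod_tonelli gauss1 gauss1 mFk); last by move=> a; exact: integral_ge0.
rewrite (prob_prod_tonelli (gauss n.+1) (gauss n.+1) mf f0) ge0_integral_gaussS; last 2 first.
- exact: (measurable_prob_integral (gauss n.+1) mf f0).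
- by move=> a; exact: integral_ge0.
apply: eq_integral => x0 _.
pose h (q : (n.-tuple R * R) * n.-tuple R) := k ((x0, q.1.2), (q.1.1, q.2)).
have mh : measurable_fun setT h.
  apply: (measurableT_comp mk); apply: measurable_fun_pair => //=.
    by apply: measurable_fun_pair => //=; exact: measurableT_comp.
  by apply: measurable_fun_pair => //=; exact: measurableT_comp.
have h0 q : 0 <= h q by exact: k0.
have mFh := measurable_prob_integral (gauss n) mh h0.
(* The order of integration is [x0, x', y0, y]; only the two middle variables have to be
   exchanged. *)
transitivity (\int[gauss n]_x' \int[gauss1]_y0 \int[gauss n]_y h ((x', y0), y)).
  apply: eq_integral => x' _; rewrite ge0_integral_gaussS//.
  by apply: (measurableT_comp mf); exact: measurable_fun_pair.
rewrite (prob_prod_tonelli_swap (gauss n) gauss1 mFh); last by move=> a; exact: integral_ge0.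
apply: eq_integral => y0 _.
rewrite (@prob_prod_tonelli _ _ _ _ _ _ _ (fun b => k ((x0, y0), b)))//.
by apply: (measurableT_comp mk); exact: measurable_fun_pair.
Qed.

Definition rot n (a b : R) (p : n.-tuple R * n.-tuple R) : n.-tuple R * n.-tuple R :=
  ([tuple a * tnth p.1 i + b * tnth p.2 i | i < n],
   [tuple a * tnth p.2 i - b * tnth p.1 i | i < n])%R.

Lemma measurable_lin_tuple d (T : measurableType d) n (a b : R) (u v : T -> n.-tuple R) :
  measurable_fun setT u -> measurable_fun setT v ->
  measurable_fun setT (fun t => [tuple a * tnth (u t) i + b * tnth (v t) i | i < n])%R.
Proof.
move=> mu mv; apply/measurable_fun_tnthP => i.
rewrite (_ : _ \o _ = fun t => a * tnth (u t) i + b * tnth (v t) i)%R; last first.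
  by apply/funext => t /=; rewrite tnth_mktuple.
apply: measurable_funD; apply: measurable_funM => //.
  by apply: (measurableT_comp (f := fun x : n.-tuple R => tnth x i)) => //; exact: measurable_tnth.
by apply: (measurableT_comp (f := fun x : n.-tuple R => tnth x i)) => //; exact: measurable_tnth.
Qed.

Lemma measurable_rot n a b : measurable_fun setT (@rot n a b).
Proof.
apply: measurable_fun_pair; first exact: measurable_lin_tuple.
rewrite (_ : (fun _ => _) = fun p : n.-tuple R * n.-tuple R => [tuple a * tnth p.2 i + (- b) * tnth p.1 i | i < n])%R.
  exact: measurable_lin_tuple.
by apply/funext => p; apply: eq_mktuple => i; rewrite mulNr.
Qed.

Lemma ge0_integral_gauss_rot n (a b : R) (f : n.-tuple R * n.-tuple R -> \bar R) :
  (a ^+ 2 + b ^+ 2 = 1)%R -> b != 0%R ->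
  measurable_fun setT f -> (forall p, 0 <= f p) ->
  \int[prob_prod (gauss n) (gauss n)]_p f (rot a b p) = \int[prob_prod (gauss n) (gauss n)]_p f p.
Proof.
move=> ab b0; elim: n f => [|n IH] f mf f0.
  by apply: eq_integral => p _; congr f; case: p => u v; congr (_, _); rewrite [RHS]tuple0 [LHS]tuple0.
rewrite (ge0_integral_gaussS2 mf f0) (ge0_integral_gaussS2 (measurableT_comp mf (@measurable_rot _ a b))); last first.
  by move=> p; exact: f0.
pose k (q : (R * R) * (n.-tuple R * n.-tuple R)) :=
  f ([tuple of q.1.1 :: q.2.1], [tuple of q.1.2 :: q.2.2]).
have mk : measurable_fun setT k.
  apply: measurableT_comp => //; apply: measurable_fun_pair => //=.
    by apply: measurable_cons; exact: measurableT_comp.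
  by apply: measurable_cons; exact: measurableT_comp.
have k0 q : 0 <= k q by exact: f0.
have mFk := measurable_prob_integral (prob_prod (gauss n) (gauss n)) mk k0.
have Fk0 q : 0 <= \int[prob_prod (gauss n) (gauss n)]_y k (q, y) by exact: integral_ge0.
rewrite -[RHS](ge0_integral_gauss1_rotation ab b0 mFk Fk0).
apply: eq_integral => -[x y] _.
have mkx : measurable_fun setT (fun c => k ((a * x + b * y, a * y - b * x)%R, c)).
  by apply: (measurableT_comp mk); exact: measurable_fun_pair.
rewrite -(IH _ mkx) /=; last by move=> c; exact: k0.
apply: eq_integral => -[u v] _; rewrite /k /=; congr (f (_, _));
  apply: eq_from_tnth => i; rewrite !tnth_mktuple;
  by case: (unliftP ord0 i) => [j|] ->; rewrite ?tnth0 ?tnthS ?tnth_mktuple.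
Qed.

Lemma measurable_rectangle n (A : 'I_n -> set R) : (forall i, measurable (A i)) ->
  measurable [set x : n.-tuple R | forall i, A i (tnth x i)].
Proof.
move=> mA.
rewrite (_ : mkset _ = \bigcap_(i in [set: 'I_n]) ((fun x : n.-tuple R => tnth x i) @^-1` A i)); last first.
  by apply/seteqP; split=> x /= h i; [move=> _; exact: h | exact: (h i Logic.I)].
apply: fin_bigcap_measurable => // i _; rewrite -[X in measurable X]setTI.
exact: measurable_tnth.
Qed.

Lemma gauss_rectangle n (A : 'I_n -> set R) : (forall i, measurable (A i)) ->
  gauss n [set x | forall i, A i (tnth x i)] = \prod_(i < n) gauss1 (A i).
Proof.
elim: n A => [|n IH] A mA.
  by rewrite big_ord0 /= /dirac indicE mem_set//= => -[].
rewrite big_ord_recl -(IH (fun i => A (lift ord0 i)))//.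
rewrite -(prob_prodE gauss1 (gauss n) (mA ord0) (measurable_rectangle (fun i => mA (lift ord0 i)))).
rewrite -[LHS]/(prob_prod gauss1 (gauss n)
  (tcons n @^-1` [set x : n.+1.-tuple R | forall i, A i (tnth x i)])).
apply: (congr1 (prob_prod gauss1 (gauss n))).
apply/seteqP; split=> -[x y] /=.
  move=> h; split; first by have := h ord0; rewrite tnth0.
  by move=> i; have := h (lift ord0 i); rewrite tnthS.
by move=> [h1 h2] i; case: (unliftP ord0 i) => [j|] ->; rewrite ?tnth0 ?tnthS.
Qed.

(** Rectangles are stable under intersection and generate the product sigma-algebra, so the product
    rule for independent coordinates determines the joint law. *)
Lemma gauss_unique d (T : measurableType d) (P : probability T R) n
    (X : T -> n.-tuple R) (mX : measurable_fun setT X) :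
  (forall A : 'I_n -> set R, (forall i, measurable (A i)) ->
    P [set t | forall i, A i (tnth (X t) i)] = \prod_(i < n) gauss1 (A i)) ->
  forall B, measurable B -> P (X @^-1` B) = gauss n B.
Proof.
move=> H B mB.
pose G : set (set (n.-tuple R)) := [set B | exists A : 'I_n -> set R,
  (forall i, measurable (A i)) /\ B = [set x | forall i, A i (tnth x i)]].
rewrite -[LHS]/(image_measure P mX B).
apply: (measure_unique G (fun=> setT)) => //.
- apply/seteqP; split.
    apply: smallest_sub; first exact: smallest_sigma_algebra.
    rewrite -bigcup_seq => C /= [i _ [D mD <-]]; apply: sub_sigma_algebra.
    (* A generator constrains one coordinate: it is the rectangle whose other sides are full. *)
    exists (fun j => if j == i then D else setT); split=> [j|].
      by case: ifP.
    rewrite setTI; apply/seteqP; split=> x /=.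
      by move=> Dx j; case: ifP => // /eqP ->.
    by move=> /(_ i); rewrite eqxx.
  apply: smallest_sub; first exact: sigma_algebra_measurable.
  by move=> C [A [mA ->]]; exact: measurable_rectangle.
- move=> C D [A [mA ->]] [A' [mA' ->]]; exists (fun i => A i `&` A' i); split.
    by move=> i; exact: measurableI.
  apply/seteqP; split=> x /=; first by move=> [h1 h2] i.
  by move=> h; split=> i; have [] := h i.
- by move=> _; exists (fun=> setT); split=> //; apply/seteqP; split.
- by rewrite bigcup_const//.
- move=> C [A [mA ->]]; transitivity (\prod_(i < n) gauss1 (A i)); first exact: H.
  by apply/esym; exact: gauss_rectangle.
- by move=> _; rewrite /image_measure /= /pushforward preimage_setT probability_setT ltry.
Qed.

End gauss.

(** * Lipschitz functions of a Gaussian vector *)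

Section euclid.
Context {R : realType} {n : nat}.
Implicit Types (u v w : 'cV[R]_n) (a b : R).

Definition dotv u v : R := \sum_i u i 0 * v i 0.

Definition enorm u : R := Num.sqrt (dotv u u).

Lemma dotvC u v : dotv u v = dotv v u.
Proof. by apply: eq_bigr => i _; rewrite mulrC. Qed.

Lemma dotvDl u v w : dotv (u + v) w = dotv u w + dotv v w.
Proof. by rewrite -big_split; apply: eq_bigr => i _; rewrite mxE mulrDl. Qed.

Lemma dotvZl a u v : dotv (a *: u) v = a * dotv u v.
Proof. by rewrite mulr_sumr; apply: eq_bigr => i _; rewrite mxE mulrA. Qed.

Lemma dotvNl u v : dotv (- u) v = - dotv u v.
Proof. by rewrite -scaleN1r dotvZl mulN1r. Qed.

Lemma dotvDr u v w : dotv w (u + v) = dotv w u + dotv w v.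
Proof. by rewrite dotvC dotvDl !(dotvC w). Qed.

Lemma dotvZr a u v : dotv u (a *: v) = a * dotv u v.
Proof. by rewrite dotvC dotvZl dotvC. Qed.

Lemma dotvNr u v : dotv u (- v) = - dotv u v.
Proof. by rewrite dotvC dotvNl dotvC. Qed.

Definition dotvE := (dotvDl, dotvDr, dotvNl, dotvNr, dotvZl, dotvZr).

Lemma dotvv_ge0 u : 0 <= dotv u u.
Proof. by apply: sumr_ge0 => i _; rewrite -expr2 sqr_ge0. Qed.

Lemma sqr_enorm u : enorm u ^+ 2 = dotv u u.
Proof. by rewrite sqr_sqrtr// dotvv_ge0. Qed.

Lemma enorm_ge0 u : 0 <= enorm u. Proof. exact: sqrtr_ge0. Qed.

Lemma enorm_eq0 u : enorm u = 0 -> u = 0.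
Proof.
move=> u0; have /eqP : dotv u u = 0 by rewrite -sqr_enorm u0 expr0n.
rewrite psumr_eq0 => [/allP h|i _]; last by rewrite -expr2 sqr_ge0.
apply/matrixP => i j; rewrite ord1 mxE; apply/eqP.
by have := h i (mem_index_enum _); rewrite mulf_eq0 orbb.
Qed.

Lemma cauchy_schwarz u v : dotv u v <= enorm u * enorm v.
Proof.
have [u0|u0] := eqVneq (enorm u) 0.
  by rewrite (enorm_eq0 u0) -{1}(scale0r 0) dotvZl mul0r mulr_ge0// enorm_ge0.
have [v0|v0] := eqVneq (enorm v) 0.
  by rewrite (enorm_eq0 v0) -{1}(scale0r 0) dotvZr mul0r mulr_ge0// enorm_ge0.
have up : 0 < enorm u by rewrite lt_neqAle eq_sym u0 enorm_ge0.
have vp : 0 < enorm v by rewrite lt_neqAle eq_sym v0 enorm_ge0.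
(* Expanding this square gives [2 |u| |v| (|u| |v| - u.v) >= 0]. *)
have := dotvv_ge0 (enorm v *: u - enorm u *: v).
rewrite !dotvE (dotvC v u) -!sqr_enorm => h.
have : 0 <= 2 * (enorm u * enorm v) * (enorm u * enorm v - dotv u v) by nra.
by rewrite pmulr_rge0 ?subr_ge0// mulr_gt0// mulr_gt0.
Qed.

Lemma enormZ a u : enorm (a *: u) = `|a| * enorm u.
Proof.
by rewrite /enorm dotvZl dotvZr mulrA -expr2 sqrtrM ?sqr_ge0// sqrtr_sqr.
Qed.

Lemma enormN u : enorm (- u) = enorm u.
Proof. by rewrite -scaleN1r enormZ normrN1 mul1r. Qed.

Lemma enormB u v : enorm (u - v) = enorm (v - u).
Proof. by rewrite -enormN opprB. Qed.

Lemma enormD u v : enorm (u + v) <= enorm u + enorm v.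
Proof.
rewrite -(@ler_pXn2r _ 2) ?nnegrE ?addr_ge0 ?enorm_ge0//.
rewrite sqr_enorm !dotvE (dotvC v u) sqrrD -!sqr_enorm.
by have := cauchy_schwarz u v; lra.
Qed.

Lemma enorm0 : enorm 0 = 0.
Proof. by rewrite -(scale0r 0) enormZ normr0 mul0r. Qed.

Definition lip1 (f : 'cV[R]_n -> R) := forall u v, `|f u - f v| <= enorm (u - v).

Lemma enorm_lip1 : lip1 enorm.
Proof.
move=> u v; rewrite ler_norml; apply/andP; split.
  have := enormD (v - u) u; rewrite subrK enormB; lra.
by have := enormD (u - v) v; rewrite subrK; lra.
Qed.

Section measurability.
Context d (T : measurableType d).
Variables (u : T -> 'cV[R]_n).
Hypothesis mu : forall i, measurable_fun setT (fun t => u t i 0).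

Lemma measurable_dotv (q : 'cV[R]_n) : measurable_fun setT (fun t => dotv q (u t)).
Proof. by apply: measurable_sum => i; exact: measurable_funM. Qed.

Lemma measurable_enorm (q : 'cV[R]_n) : measurable_fun setT (fun t => enorm (u t - q)).
Proof.
have ms : measurable_fun [set: R] (fun x : R => Num.sqrt x).
  by apply: continuous_measurable_fun; exact: sqrt_continuous.
apply: (measurableT_comp ms); apply: measurable_sum => i; under eq_fun do rewrite !mxE.
by apply: measurable_funM; exact: measurable_funB.
Qed.

Lemma rat_dense_enorm (x : 'cV[R]_n) (e : R) : 0 < e ->
  exists q : 'cV[rat]_n, enorm (x - map_mx ratr q) < e.
Proof.
move=> e0.
have n0 : 0 < n.+1%:R :> R by rewrite ltr0n.
(* Coordinatewise precision [dl] gives a squared error of at most [n e^2 / (n + 1)^2 < e^2]; the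
   successor also covers [n = 0]. *)
pose dl := e / n.+1%:R; have d0 : 0 < dl by rewrite divr_gt0.
have h i : exists q : rat, `|x i 0 - ratr q| < dl.
  have /rat_in_itvoo[q] : x i 0 - dl < x i 0 + dl by lra.
  rewrite in_itv/= => /andP[q1 q2]; exists q; rewrite ltr_norml; apply/andP; split; lra.
exists (\col_i xchoose (h i)).
rewrite -(@ltr_pXn2r _ 2) ?nnegrE ?enorm_ge0 ?(ltW e0)// sqr_enorm.
apply: (@le_lt_trans _ _ (\sum_(i < n) dl ^+ 2)).
  apply: ler_sum => i _; rewrite !mxE -expr2 -real_normK ?num_real//.
  by rewrite ler_pXn2r ?nnegrE ?normr_ge0 ?(ltW d0)// ltW// (xchooseP (h i)).
rewrite sumr_const card_ord -mulr_natr /dl exprMn -mulrA.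
rewrite gtr_pMr ?exprn_gt0// exprVn mulrC ltr_pdivrMr ?exprn_gt0// mul1r.
by rewrite -natrX ltr_nat (leq_trans (ltnSn n))// -mulnn leq_pmulr.
Qed.

(** A 1-Lipschitz function is the infimum of the cones [f q + |x - q|] over rational [q]. Each set
    where [f (u t) < a] is thus a countable union of sets that are measurable as soon as the
    coordinates of [u] are. *)
Lemma measurable_lip1 (f : 'cV[R]_n -> R) : lip1 f ->
  measurable_fun setT (fun t => f (u t)).
Proof.
move=> lf; apply: (measurability _ (RGenInftyO.measurableE R)) => //.
move=> _ [_ [a ->] <-]; rewrite setTI.
pose rv (q : 'cV[rat]_n) : 'cV[R]_n := map_mx ratr q.
pose F q := [set t | f (rv q) + enorm (u t - rv q) < a].
have mF q : measurable (F q).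
  rewrite -[F q]setTI (_ : F q = (fun t => f (rv q) + enorm (u t - rv q)) @^-1` `]-oo, a[%classic).
    apply: measurable_funD => //; exact: measurable_enorm.
  by apply/seteqP; split=> t; rewrite /F /= in_itv.
rewrite (_ : _ @^-1` _ = \bigcup_q F q); last first.
  apply/seteqP; split=> t /=; rewrite in_itv/=.
    move=> ft; have e0 : 0 < (a - f (u t)) / 2 by rewrite divr_gt0// subr_gt0.
    have [q hq] := rat_dense_enorm (u t) e0.
    exists q => //; rewrite /F /=.
    have := lf (rv q) (u t); rewrite enormB ler_norml => /andP[_ h].
    by rewrite /rv in h *; lra.
  move=> [q _]; rewrite /F /=.
  have := lf (u t) (rv q); rewrite ler_norml => /andP[_ h].
  by apply: le_lt_trans; lra.
by apply: countable_bigcupT_measurable => //; exact: countableP.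
Qed.

End measurability.

End euclid.

(** * Moments of Gaussian vectors *)

Section moments.
Context {R : realType}.

(** Averaging the integral with its image under [x -> -x] removes the cross term, so only integrals
    of nonnegative functions occur. *)
Lemma gauss1_affine_sqr_le (q w : R) :
  (\int[gauss1]_x ((q * x + w) ^+ 2)%:E <= (q ^+ 2 + w ^+ 2)%:E)%E.
Proof.
have mf (a b : R) : measurable_fun [set: R] (fun x : R => ((a * x + b) ^+ 2)%:E).
  apply/measurable_EFinP; apply: measurable_funX; exact: measurable_funD.
have p0 (a b x : R) : (0 <= ((a * x + b) ^+ 2)%:E)%E by rewrite lee_fin sqr_ge0.
set I := (\int[gauss1]_x _)%E.
have I0 : (0 <= I)%E by apply: integral_ge0 => x _; exact: p0.
have I2 : (I + I <= (2 * w ^+ 2 + 2 * q ^+ 2)%:E)%E.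
  rewrite {2}/I -(gauss1_symmetric (mf q w) (p0 q w)) -ge0_integralD//; last first.
    by apply: (measurableT_comp (mf q w)); exact: oppr_measurable.
  rewrite (eq_integral (fun x : R => (2 * w ^+ 2)%:E + (2 * q ^+ 2)%:E * (x ^+ 2)%:E)%E); last first.
    by move=> x _; rewrite -EFinM -!EFinD; congr EFin; ring.
  have mx : measurable_fun [set: R] (fun x : R => (x ^+ 2)%:E).
    by apply/measurable_EFinP; exact: measurable_funX.
  have x0 (x : R) : (0 <= (x ^+ 2)%:E)%E by rewrite lee_fin sqr_ge0.
  have c0 (c : R) : (0 <= (2 * c ^+ 2)%:E)%E by rewrite lee_fin mulr_ge0 ?sqr_ge0.
  rewrite ge0_integralD//; last 2 first.
  - by move=> x _; rewrite mule_ge0.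
  - exact: emeasurable_funM.
  rewrite integral_cst//= probability_setT mule1 ge0_integralZl//.
  rewrite EFinD leeD2l// -[leRHS]mule1 lee_wpmul2l//; exact: gauss1_sqr_le1.
by move: I0 I2; case: I => [r| |]//; rewrite -EFinD !lee_fin; lra.
Qed.

Local Open Scope ereal_scope.

Lemma measurable_tnth_comp d (T : measurableType d) n (f : T -> n.-tuple R) i :
  measurable_fun setT f -> measurable_fun setT (fun t => tnth (f t) i).
Proof.
by move=> mf; apply: (measurableT_comp (f := fun x : n.-tuple R => tnth x i)) => //; exact: measurable_tnth.
Qed.

(** The second moment of a linear form depends on [|q|] and not on [n]. Inductively, the first
    coordinate is integrated first, with the sum over the other coordinates as the constant of an
    affine function. *)
Lemma gauss_dot_sqr_le n (q : 'I_n -> R) :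
  \int[gauss n]_x ((\sum_i q i * tnth x i) ^+ 2)%:E <= (\sum_i q i ^+ 2)%:E.
Proof.
elim: n q => [|n IH] q.
  under eq_integral do rewrite big_ord0 expr0n/=.
  by rewrite integral0 big_ord0.
pose q' i := q (lift ord0 i); pose S (y : n.-tuple R) := (\sum_i q' i * tnth y i)%R.
have mS : measurable_fun setT S.
  by apply: measurable_sum => i; apply: measurable_funM => //; exact: measurable_tnth.
have S0 y : 0 <= ((S y) ^+ 2)%:E by rewrite lee_fin sqr_ge0.
rewrite ge0_integral_gaussS; last 2 first.
- apply/measurable_EFinP/measurable_funX/measurable_sum => i.
  by apply: measurable_funM => //; exact: measurable_tnth.
- by move=> x; rewrite lee_fin sqr_ge0.
pose F (p : R * n.-tuple R) := ((q ord0 * p.1 + S p.2) ^+ 2)%:E.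
have mF : measurable_fun setT F.
  apply/measurable_EFinP/measurable_funX; apply: measurable_funD.
    exact: measurable_funM.
  exact: measurableT_comp.
have F0 p : 0 <= F p by rewrite lee_fin sqr_ge0.
rewrite (_ : \int[gauss1]_x _ = \int[gauss1]_x \int[gauss n]_y F (x, y)); last first.
  apply: eq_integral => x _; apply: eq_integral => y _.
  rewrite big_ord_recl tnth0 /F /S/=; congr ((_ + _) ^+ 2)%:E.
  by apply: eq_bigr => i _; rewrite tnthS.
rewrite (prob_prod_tonelli_swap gauss1 (gauss n) mF F0).
apply: (@le_trans _ _ (\int[gauss n]_y ((q ord0 ^+ 2)%:E + (S y ^+ 2)%:E))).
  apply: ge0_le_integral => //.
  - by move=> y _; apply: integral_ge0 => x _; exact: F0.
  - exact: (measurable_fun_fubini_tonelli_G (m1 := gauss1) _ mF F0).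
  - apply: emeasurable_funD => //.
    by apply/measurable_EFinP; exact: measurable_funX.
  - by move=> y _; apply: (le_trans (gauss1_affine_sqr_le (q ord0) (S y))); rewrite EFinD.
rewrite ge0_integralD//; last 2 first.
- by move=> y _; rewrite lee_fin sqr_ge0.
- by apply/measurable_EFinP; exact: measurable_funX.
rewrite integral_cst//= probability_setT mule1 big_ord_recl EFinD leeD2l//.
exact: IH.
Qed.

Lemma gauss_sum_sqr_lty n :
  \int[@gauss R n]_x ((\sum_i (tnth x i) ^+ 2) ^+ 2)%:E < +oo.
Proof.
elim: n => [|n IH].
  under eq_integral do rewrite big_ord0 expr0n/=.
  by rewrite integral0.
pose S (y : n.-tuple R) := (\sum_i tnth y i ^+ 2)%R.
have mS : measurable_fun setT S.
  by apply: measurable_sum => i; apply: measurable_funX => //; exact: measurable_tnth.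
have S0 y : 0 <= ((S y) ^+ 2)%:E by rewrite lee_fin sqr_ge0.
rewrite ge0_integral_gaussS; last 2 first.
- apply/measurable_EFinP/measurable_funX/measurable_sum => i.
  by apply: measurable_funX => //; exact: measurable_tnth.
- by move=> x; rewrite lee_fin sqr_ge0.
have mS2 : measurable_fun setT (fun y => ((S y) ^+ 2)%:E).
  by apply/measurable_EFinP; exact: measurable_funX.
have mx : measurable_fun [set: R] (fun x : R => (x ^+ 4)%:E).
  by apply/measurable_EFinP; exact: measurable_funX.
pose V := \int[gauss n]_y (S y ^+ 2)%:E.
have V0 : 0 <= V by exact: integral_ge0.
have x0 (x : R) : 0 <= (x ^+ 4)%:E by rewrite lee_fin exprn_even_ge0.
(* This uses [(x^2 + S)^2 <= 2 x^4 + 2 S^2]. *)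
apply: (@le_lt_trans _ _ (\int[gauss1]_x (2%:E * (x ^+ 4)%:E + 2%:E * V))).
  apply: ge0_le_integral => //.
  - by move=> x _; apply: integral_ge0 => y _; rewrite lee_fin sqr_ge0.
  - apply: (measurable_prob_integral (gauss n)
      (f := fun p : R * n.-tuple R => ((\sum_i (tnth [tuple of p.1 :: p.2] i) ^+ 2) ^+ 2)%:E)).
      apply/measurable_EFinP/measurable_funX/measurable_sum => i.
      by apply: measurable_funX; apply: measurable_tnth_comp; exact: measurable_tcons.
    by move=> p; rewrite lee_fin sqr_ge0.
  - by apply: emeasurable_funD => //; exact: emeasurable_funM.
  - move=> x _; rewrite -ge0_integralZl//.
    have -> : (2%:E * (x ^+ 4)%:E = \int[gauss n]_y (2%:E * (x ^+ 4)%:E) :> \bar R).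
      by rewrite integral_cst//= probability_setT mule1.
    rewrite -ge0_integralD//; last 3 first.
    - by move=> y _; rewrite mule_ge0.
    - by move=> y _; rewrite mule_ge0.
    - exact: emeasurable_funM.
    apply: ge0_le_integral => //.
    - by move=> y _; rewrite lee_fin sqr_ge0.
    - apply/measurable_EFinP/measurable_funX/measurable_sum => i.
      apply: measurable_funX; apply: measurable_tnth_comp.
      exact: measurable_cons.
    - by apply: emeasurable_funD => //; exact: emeasurable_funM.
    - move=> y _; rewrite -!EFinM -EFinD lee_fin big_ord_recl tnth0.
      rewrite (eq_bigr (fun i => tnth y i ^+ 2)%R); last by move=> i _; rewrite tnthS.
      by rewrite -/(S y); have := sqr_ge0 (x ^+ 2 - S y); nra.
rewrite ge0_integralD//; last 3 first.
- by move=> x _; rewrite mule_ge0.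
- exact: emeasurable_funM.
- by move=> x _; rewrite mule_ge0.
rewrite integral_cst//= probability_setT mule1 ge0_integralZl//.
by rewrite lte_add_pinfty// lte_mul_pinfty//; exact: gauss1_expn4_lty.
Qed.

End moments.

(** * Lasry-Lions regularization *)

Section lasry_lions.
Context {R : realType} {n : nat}.
Implicit Types (f g : 'cV[R]_n -> R) (x y v w : 'cV[R]_n).

Definition infconv (c : R) f x : R :=
  inf (range (fun y => f y + c * dotv (x - y) (x - y))).

(** The minimum of [c e^2 - e] is [-1/(4c)]: this is the most by which an inf-convolution with
    penalty [c] can lower a 1-Lipschitz function. *)
Lemma sqr_penalty (c : R) x y : 0 < c ->
  enorm (x - y) <= c * dotv (x - y) (x - y) + (4 * c)^-1.
Proof.
move=> c0; rewrite -sqr_enorm; set e := enorm _.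
have h : 0 <= (2 * c * e - 1) ^+ 2 / (4 * c) by rewrite divr_ge0 ?sqr_ge0//; lra.
have -> : c * e ^+ 2 + (4 * c)^-1 = (2 * c * e - 1) ^+ 2 / (4 * c) + e by field; lra.
lra.
Qed.

Section infconv.
Variables (c : R) (f : 'cV[R]_n -> R).
Hypotheses (c0 : 0 < c) (lf : lip1 f).

Lemma infconv_lb x y : f x - (4 * c)^-1 <= f y + c * dotv (x - y) (x - y).
Proof.
have := sqr_penalty x y c0; have := lf x y; rewrite ler_norml => /andP[_]; lra.
Qed.

Lemma infconv_le x y : infconv c f x <= f y + c * dotv (x - y) (x - y).
Proof.
apply: ge_inf; last by exists y.
by exists (f x - (4 * c)^-1) => _ [z _ <-]; exact: infconv_lb.
Qed.

Lemma le_infconv x (a : R) : (forall y, a <= f y + c * dotv (x - y) (x - y)) ->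
  a <= infconv c f x.
Proof.
move=> h; apply: lb_le_inf; first by exists (f x + c * dotv (x - x) (x - x)); exists x.
by move=> _ [y _ <-]; exact: h.
Qed.

Lemma infconv_le_self x : infconv c f x <= f x.
Proof.
by apply: (le_trans (infconv_le x x)); rewrite subrr -(scale0r 0) dotvZl mul0r mulr0 addr0.
Qed.

Lemma infconv_lip1 : lip1 (infconv c f).
Proof.
have H x x' : infconv c f x - enorm (x - x') <= infconv c f x'.
  apply: le_infconv => y; have := infconv_le x (y + (x - x')).
  have -> : x - (y + (x - x')) = x' - y by apply/matrixP => i j; rewrite !mxE; ring.
  have := lf (y + (x - x')) y; rewrite addrAC subrr add0r ler_norml => /andP[_]; lra.
move=> x x'; rewrite ler_norml; have := H x x'; have := H x' x; rewrite (enormB x' x).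
by move=> h1 h2; apply/andP; split; lra.
Qed.

(** Each competitor [y] contributes a paraboloid whose second difference is exactly [2 c |v|^2];
    using the same [y] at [x + v] and [x - v] passes the bound to the infimum. *)
Lemma infconv_semiconcave x v :
  infconv c f (x + v) + infconv c f (x - v) <= 2 * infconv c f x + 2 * c * dotv v v.
Proof.
suff : (infconv c f (x + v) + infconv c f (x - v) - 2 * c * dotv v v) / 2 <= infconv c f x by lra.
apply: le_infconv => y.
have := infconv_le (x + v) y; have := infconv_le (x - v) y.
have -> : x + v - y = (x - y) + v by rewrite addrAC.
have -> : x - v - y = (x - y) - v by rewrite addrAC.
by rewrite !dotvE (dotvC v); lra.
Qed.

End infconv.

(* A quadratic expansion with slack [e], so that approximate minimizers in the
   inf-convolutions suffice and no gradient has to exist. *)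
Definition approx_c11 (C : R) f := forall x (e : R), 0 < e <= 1 ->
  exists q, dotv q q <= 1 + e /\
    forall v, `|f (x + v) - f x - dotv q v| <= C * dotv v v + e.

(** A move by [s q] changes [f] by at most [s |q|], while the expansion predicts [s |q|^2], hence
    [|q|] is at most about 1. The step [s = e / (6 (C + 1))] makes both the quadratic error and the
    slack small relative to [s]. *)
Lemma lip1_gradient_bound (C e : R) f x q : 0 <= C -> 0 < e <= 1 -> lip1 f ->
  (forall v, `|f (x + v) - f x - dotv q v| <= C * dotv v v + (e / 6) ^+ 2 / (C + 1)) ->
  dotv q q <= 1 + e.
Proof.
move=> C0 /andP[e0 e1] lf h.
pose s := e / 6 / (C + 1); have s0 : 0 < s by rewrite !divr_gt0//; lra.
have := h (s *: q); have := lf (x + s *: q) x.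
rewrite addrAC subrr add0r enormZ (gtr0_norm s0) !dotvZl !dotvZr -sqr_enorm.
set Q := enorm q; rewrite !ler_norml => /andP[_ h1] /andP[h2 _].
have h3 : s * Q ^+ 2 <= s * Q + C * (s * (s * Q ^+ 2)) + s * (e / 6).
  have -> : s * (e / 6) = (e / 6) ^+ 2 / (C + 1) by rewrite /s; field; lra.
  lra.
have h4 : Q ^+ 2 <= Q + (C * s) * Q ^+ 2 + e / 6.
  rewrite -(ler_pM2l s0); lra.
have h5 : C * s <= e / 6.
  rewrite /s mulrCA ler_piMr//; first by rewrite divr_ge0//; lra.
  by rewrite ler_pdivrMr; lra.
have Q2 : 0 <= Q ^+ 2 by exact: sqr_ge0.
have h6 : Q <= (1 + Q ^+ 2) / 2 by have := sqr_ge0 (Q - 1); lra.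
have h7 : (C * s) * Q ^+ 2 <= e / 6 * Q ^+ 2 by exact: ler_wpM2r.
have h8 : (1 - e / 3) * Q ^+ 2 <= 1 + e / 3 by lra.
have : (1 - e / 3) * Q ^+ 2 <= (1 - e / 3) * (1 + e) by apply: (le_trans h8); nra.
by rewrite ler_pM2l//; lra.
Qed.

(* Lasry-Lions: a sup-convolution of an inf-convolution, with twice the
   penalty, is both semiconcave and semiconvex. *)
Lemma lip1_smoothing f (eta : R) : 0 < eta -> lip1 f ->
  exists g C, [/\ lip1 g, 0 <= C, approx_c11 C g & forall x, `|g x - f x| <= eta].
Proof.
move=> eta0 lf.
(* With this [c] the inf-convolution lowers [f] by at most [eta], and the sup-convolution raises the
   result by at most [eta / 2]. *)
pose c := (4 * eta)^-1; have c0 : 0 < c by rewrite invr_gt0; lra.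
pose fl := infconv c f; have lfl : lip1 fl by exact: infconv_lip1.
pose F y := - fl y.
have lF : lip1 F.
  by move=> x y; rewrite /F -opprD normrN; exact: lfl.
have d0 : 0 < 2 * c by lra.
pose g x := - infconv (2 * c) F x.
have lg : lip1 g.
  by move=> x y; rewrite /g -opprD normrN; exact: infconv_lip1.
have gge x y : fl y - 2 * c * dotv (x - y) (x - y) <= g x.
  by have := infconv_le d0 lF x y; rewrite /g /F; lra.
have gle x a : (forall y, fl y - 2 * c * dotv (x - y) (x - y) <= a) -> g x <= a.
  move=> h; suff : - a <= infconv (2 * c) F x by rewrite /g; lra.
  by apply: le_infconv => y; have := h y; rewrite /F; lra.
have gsc x v : g (x + v) + g (x - v) <= 2 * g x + 4 * c * dotv v v.
  rewrite -lerBrDr; apply: (gle _ _) => y1; rewrite lerBrDr addrC -lerBrDr.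
  apply: (gle _ _) => y2.
  (* Points [y1], [y2] competing at [x + v] and [x - v] are compared with their midpoint, competing
     at [x]; the semiconcavity of [fl] along [w] pays for the exchange. *)
  pose y := 2^-1 *: (y1 + y2); pose w := 2^-1 *: (y1 - y2).
  have -> : y1 = y + w by apply/matrixP => i j; rewrite !mxE; field.
  have -> : y2 = y - w by apply/matrixP => i j; rewrite !mxE; field.
  have -> : x + v - (y + w) = (x - y) + (v - w) by apply/matrixP => i j; rewrite !mxE; ring.
  have -> : x - v - (y - w) = (x - y) - (v - w) by apply/matrixP => i j; rewrite !mxE; ring.
  have := infconv_semiconcave c0 lf y w; have := gge x y; rewrite -/fl.
  (* The margin left is [4c|v|^2 + 4c|v - w|^2 - 2c|w|^2 = 2c|w - 2v|^2]; it is a square thanks to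
     the doubled penalty. *)
  have : 0 <= c * dotv (w - 2 *: v) (w - 2 *: v) by rewrite mulr_ge0 ?dotvv_ge0// ltW.
  move: (x - y) => z; have := dotvC v w; have := dotvC v z; have := dotvC w z; rewrite !dotvE; lra.
have gf x : `|g x - f x| <= eta.
  have h1 : (4 * c)^-1 = eta by rewrite /c; field; lra.
  have h2 : (4 * (2 * c))^-1 = eta / 2 by rewrite /c; field; lra.
  have h3 := infconv_le_self c0 lf x.
  have h4 : f x - eta <= fl x.
    by apply: le_infconv => y; rewrite -h1; exact: infconv_lb.
  have h5 := infconv_le_self d0 lF x.
  have h6 : F x - eta / 2 <= infconv (2 * c) F x.
    by apply: le_infconv => y; rewrite -h2; exact: infconv_lb.
  by rewrite ler_norml /g; move: h5 h6 h3; rewrite /F -/fl => h5 h6 h3; apply/andP; split; lra.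
exists g, (6 * c); split => //; first by lra.
move=> x e /andP[e0 e1].
(* The slack that [lip1_gradient_bound] requires for the constant [6 c]. *)
pose e' := (e / 6) ^+ 2 / (6 * c + 1).
have e'0 : 0 < e' by rewrite divr_gt0 ?exprn_gt0//; lra.
have e'e : e' <= e.
  rewrite ler_pdivrMr; last by lra.
  by have := mulr_ge0 (ltW e0) (ltW c0); nra.
have [y hy] : exists y, g x - e' < fl y - 2 * c * dotv (x - y) (x - y).
  apply: contrapT => /forallNP h; have : g x <= g x - e'.
    by apply: (gle _ _) => y; have /negP := h y; rewrite -leNgt.
  by lra.
(* The gradient at [x] of the paraboloid [fl y - 2c|. - y|^2], which lies below [g] and nearly
   touches it at [x]. *)
pose q := (4 * c) *: (y - x).
have lo v : - (6 * c * dotv v v + e') <= g (x + v) - g x - dotv q v.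
  have := gge (x + v) y.
  have -> : x + v - y = (x - y) + v by rewrite addrAC.
  have -> : dotv q v = - (4 * c * dotv (x - y) v) by rewrite /q dotvZl -opprB dotvNl; ring.
  have : 0 <= c * dotv v v by rewrite mulr_ge0 ?dotvv_ge0// ltW.
  by move: hy; move: (x - y) => z hy; rewrite !dotvE (dotvC v z); lra.
have lo' v : g x + dotv q v - 2 * c * dotv v v - e' <= g (x + v).
  have := gge (x + v) y.
  have -> : x + v - y = (x - y) + v by rewrite addrAC.
  have -> : dotv q v = - (4 * c * dotv (x - y) v) by rewrite /q dotvZl -opprB dotvNl; ring.
  by move: hy; move: (x - y) => z hy; rewrite !dotvE (dotvC v z); lra.
(* The lower expansion at [-v] is reflected by semiconcavity: [6 c] is [2 c] from the former plus
   [4 c] from the latter. *)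
have hi v : g (x + v) - g x - dotv q v <= 6 * c * dotv v v + e'.
  have := gsc x v; have := lo' (- v); rewrite dotvNr dotvNl dotvNr opprK; lra.
have est v : `|g (x + v) - g x - dotv q v| <= 6 * c * dotv v v + e'.
  by rewrite ler_norml lo hi.
exists q; split; last by move=> v; apply: (le_trans (est v)); rewrite lerD2l.
by apply: (lip1_gradient_bound _ _ lg est) => //; [lra|rewrite e0].
Qed.

End lasry_lions.

(** * Three independent Gaussian vectors *)

Section triple.
Context {R : realType} {n : nat}.
Local Open Scope ereal_scope.
Notation V := (n.-tuple R).
Notation G := (@gauss R n).

Definition gauss2 : probability (V * V)%type R := prob_prod G G.
(** The components serve as [A], [Z] and [B]: the first two realize the correlation [r] in [Q(r)],
    and the third splits [A] into [al A + be B] and [al A - be B]. *)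
Definition gauss3 : probability (V * V * V)%type R := prob_prod gauss2 G.

Lemma ge0_integral_gauss2_rot (a b : R) (f : V * V -> \bar R) :
  (a ^+ 2 + b ^+ 2 = 1)%R -> b != 0%R -> measurable_fun setT f -> (forall p, 0 <= f p) ->
  \int[gauss2]_p f (rot a b p) = \int[gauss2]_p f p.
Proof. exact: ge0_integral_gauss_rot. Qed.

Section ge0.
Variables (a b : R).
Hypotheses (ab : (a ^+ 2 + b ^+ 2 = 1)%R) (b0 : b != 0%R).

Definition rot12 (p : V * V * V) : V * V * V := (rot a b p.1, p.2).
Definition rot23 (p : V * V * V) : V * V * V :=
  ((p.1.1, (rot a b (p.1.2, p.2)).1), (rot a b (p.1.2, p.2)).2).
Definition rot13 (p : V * V * V) : V * V * V :=
  (((rot a b (p.1.1, p.2)).1, p.1.2), (rot a b (p.1.1, p.2)).2).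

Let m11 : measurable_fun setT (fun p : V * V * V => p.1.1).
Proof. exact: measurableT_comp. Qed.

Let m12 : measurable_fun setT (fun p : V * V * V => p.1.2).
Proof. exact: measurableT_comp. Qed.

Lemma measurable_rot12 : measurable_fun setT rot12.
Proof.
apply: measurable_fun_pair => //=.
by apply: measurableT_comp => //; exact: measurable_rot.
Qed.

Lemma measurable_rot23 : measurable_fun setT rot23.
Proof.
have mr : measurable_fun setT (fun p : V * V * V => rot a b (p.1.2, p.2)).
  apply: (measurableT_comp (@measurable_rot R n a b)).
  exact: measurable_fun_pair.
apply: measurable_fun_pair => /=; last exact: (measurableT_comp measurable_snd mr).
by apply: measurable_fun_pair => //; exact: (measurableT_comp measurable_fst mr).
Qed.

Lemma measurable_rot13 : measurable_fun setT rot13.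
Proof.
have mr : measurable_fun setT (fun p : V * V * V => rot a b (p.1.1, p.2)).
  apply: (measurableT_comp (@measurable_rot R n a b)).
  exact: measurable_fun_pair.
apply: measurable_fun_pair => /=; last exact: (measurableT_comp measurable_snd mr).
by apply: measurable_fun_pair => //; exact: (measurableT_comp measurable_fst mr).
Qed.

Variable f : V * V * V -> \bar R.
Hypotheses (mf : measurable_fun setT f) (f0 : forall p, 0 <= f p).

Lemma ge0_integral_rot12 : \int[gauss3]_p f (rot12 p) = \int[gauss3]_p f p.
Proof.
have E (h : V * V * V -> \bar R) : measurable_fun setT h -> (forall p, 0 <= h p) ->
    \int[gauss3]_p h p = \int[G]_z \int[gauss2]_p h (p, z).
  move=> mh h0; rewrite (prob_prod_tonelli gauss2 G mh h0).
  exact: (prob_prod_tonelli_swap gauss2 G mh h0).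
rewrite (E _ mf f0) (E _ (measurableT_comp mf measurable_rot12)); last by move=> p; exact: f0.
apply: eq_integral => z _.
rewrite -(ge0_integral_gauss2_rot ab b0 (f := fun p => f (p, z)))//.
by apply: (measurableT_comp mf); exact: measurable_fun_pair.
Qed.

Lemma ge0_integral_rot23 : \int[gauss3]_p f (rot23 p) = \int[gauss3]_p f p.
Proof.
have E (h : V * V * V -> \bar R) : measurable_fun setT h -> (forall p, 0 <= h p) ->
    \int[gauss3]_p h p = \int[G]_x \int[gauss2]_p h ((x, p.1), p.2).
  move=> mh h0; rewrite (prob_prod_tonelli gauss2 G mh h0).
  rewrite (prob_prod_tonelli G G (measurable_prob_integral G mh h0)); last first.
    by move=> p; exact: integral_ge0.
  apply: eq_integral => x _.
  rewrite (@prob_prod_tonelli _ _ _ _ _ G G (fun p => h ((x, p.1), p.2)))//.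
  apply: (measurableT_comp mh); apply: measurable_fun_pair => //=.
  exact: measurable_fun_pair.
rewrite (E _ mf f0) (E _ (measurableT_comp mf measurable_rot23)); last by move=> p; exact: f0.
apply: eq_integral => x _.
rewrite -(ge0_integral_gauss2_rot ab b0 (f := fun p => f ((x, p.1), p.2)))//.
apply: (measurableT_comp mf); apply: measurable_fun_pair => //=.
exact: measurable_fun_pair.
Qed.

Lemma ge0_integral_rot13 : \int[gauss3]_p f (rot13 p) = \int[gauss3]_p f p.
Proof.
have E (h : V * V * V -> \bar R) : measurable_fun setT h -> (forall p, 0 <= h p) ->
    \int[gauss3]_p h p = \int[G]_x \int[gauss2]_p h ((p.1, x), p.2).
  move=> mh h0; rewrite (prob_prod_tonelli gauss2 G mh h0).
  have mF := measurable_prob_integral G mh h0.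
  have F0 (p : V * V) : 0 <= \int[G]_y h (p, y) by exact: integral_ge0.
  rewrite (prob_prod_tonelli G G mF F0) (prob_prod_tonelli_swap G G mF F0).
  apply: eq_integral => x _.
  rewrite (@prob_prod_tonelli _ _ _ _ _ G G (fun p => h ((p.1, x), p.2)))//.
  apply: (measurableT_comp mh); apply: measurable_fun_pair => //=.
  exact: measurable_fun_pair.
rewrite (E _ mf f0) (E _ (measurableT_comp mf measurable_rot13)); last by move=> p; exact: f0.
apply: eq_integral => x _.
rewrite -(ge0_integral_gauss2_rot ab b0 (f := fun p => f ((p.1, x), p.2)))//.
apply: (measurableT_comp mf); apply: measurable_fun_pair => //=.
exact: measurable_fun_pair.
Qed.

End ge0.

Lemma integral_invariant d (T : measurableType d) (m : {measure set T -> \bar R})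
    (phi : T -> T) :
  (forall f : T -> \bar R, measurable_fun setT f -> (forall p, 0 <= f p) ->
    \int[m]_p f (phi p) = \int[m]_p f p) ->
  forall f : T -> \bar R, measurable_fun setT f -> \int[m]_p f (phi p) = \int[m]_p f p.
Proof.
move=> H f mf; rewrite integralE [RHS]integralE.
rewrite -(H f^\+)//; last exact: measurable_funepos.
rewrite -(H f^\-)//; last exact: measurable_funeneg.
by congr (_ - _); apply: eq_integral => p _; rewrite ?funeposE ?funenegE.
Qed.

Lemma Rintegral_rot12 a b (f : V * V * V -> R) : (a ^+ 2 + b ^+ 2 = 1)%R -> b != 0%R ->
  measurable_fun setT f ->
  (\int[gauss3]_p f (rot12 a b p) = \int[gauss3]_p f p)%R.
Proof.
move=> ab b0 mf; congr fine; apply: (integral_invariant (phi := rot12 a b) _ (f := EFin \o f)).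
  exact: ge0_integral_rot12.
exact/measurable_EFinP.
Qed.

Lemma Rintegral_rot23 a b (f : V * V * V -> R) : (a ^+ 2 + b ^+ 2 = 1)%R -> b != 0%R ->
  measurable_fun setT f ->
  (\int[gauss3]_p f (rot23 a b p) = \int[gauss3]_p f p)%R.
Proof.
move=> ab b0 mf; congr fine; apply: (integral_invariant (phi := rot23 a b) _ (f := EFin \o f)).
  exact: ge0_integral_rot23.
exact/measurable_EFinP.
Qed.

Lemma Rintegral_rot13 a b (f : V * V * V -> R) : (a ^+ 2 + b ^+ 2 = 1)%R -> b != 0%R ->
  measurable_fun setT f ->
  (\int[gauss3]_p f (rot13 a b p) = \int[gauss3]_p f p)%R.
Proof.
move=> ab b0 mf; congr fine; apply: (integral_invariant (phi := rot13 a b) _ (f := EFin \o f)).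
  exact: ge0_integral_rot13.
exact/measurable_EFinP.
Qed.

Lemma Rintegral_gauss3_1 (f : V -> R) : measurable_fun setT f ->
  (\int[gauss3]_p f p.1.1 = \int[G]_x f x)%R.
Proof.
have H (h : V -> \bar R) : measurable_fun setT h -> (forall x, 0 <= h x) ->
    \int[gauss3]_p h p.1.1 = \int[G]_x h x.
  move=> mh h0; have mh1 : measurable_fun setT (fun p : V * V => h p.1).
    exact: (measurableT_comp mh).
  rewrite (ge0_integral_prob_prod_fst gauss2 G mh1)//.
  exact: (ge0_integral_prob_prod_fst G G mh).
move=> mf; have mEf : measurable_fun setT (EFin \o f) by exact/measurable_EFinP.
congr fine; rewrite integralE [RHS]integralE.
rewrite -(H (EFin \o f)^\+)//; last exact: measurable_funepos.
rewrite -(H (EFin \o f)^\-)//; last exact: measurable_funeneg.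
by congr (_ - _); apply: eq_integral => p _; rewrite ?funeposE ?funenegE.
Qed.

End triple.

(** * Growth bounds and dimension-free variance of increments *)

Section growth.
Context {R : realType} {n : nat}.
Notation V := (n.-tuple R).
Notation G := (@gauss R n).

(** Measures live on tuples, with their product sigma-algebra; linear algebra is done on columns. *)
Definition tvec (x : V) : 'cV[R]_n := \col_i tnth x i.

Definition measurable_vec d (T : measurableType d) (u : T -> 'cV[R]_n) :=
  forall i, measurable_fun setT (fun t => u t i 0).

Lemma measurable_tvec d (T : measurableType d) (u : T -> V) :
  measurable_fun setT u -> measurable_vec (fun t => tvec (u t)).
Proof.
move=> mu i; under eq_fun do rewrite mxE.
exact: measurable_tnth_comp.
Qed.

Lemma measurable_vecD d (T : measurableType d) (u v : T -> 'cV[R]_n) :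
  measurable_vec u -> measurable_vec v -> measurable_vec (fun t => u t + v t).
Proof. by move=> mu mv i; under eq_fun do rewrite mxE; exact: measurable_funD. Qed.

Lemma measurable_vecZ d (T : measurableType d) (a : R) (u : T -> 'cV[R]_n) :
  measurable_vec u -> measurable_vec (fun t => a *: u t).
Proof. by move=> mu i; under eq_fun do rewrite mxE; exact: measurable_funM. Qed.

Lemma measurable_vecB d (T : measurableType d) (u v : T -> 'cV[R]_n) :
  measurable_vec u -> measurable_vec v -> measurable_vec (fun t => u t - v t).
Proof.
move=> mu mv i; under eq_fun do rewrite mxE; apply: measurable_funD => //.
by under eq_fun do rewrite mxE; exact: measurableT_comp.
Qed.

Lemma measurable_vec_cst d (T : measurableType d) (x : 'cV[R]_n) :
  measurable_vec (fun t : T => x).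
Proof. by move=> i. Qed.

Lemma tvec_rot1 (a b : R) (p : V * V) :
  tvec (rot a b p).1 = a *: tvec p.1 + b *: tvec p.2.
Proof. by apply/matrixP => i j; rewrite !mxE tnth_mktuple. Qed.

Lemma tvec_rot2 (a b : R) (p : V * V) :
  tvec (rot a b p).2 = a *: tvec p.2 - b *: tvec p.1.
Proof. by apply/matrixP => i j; rewrite !mxE tnth_mktuple. Qed.

Lemma integral_dotv_sqr_le (q : 'cV[R]_n) :
  (\int[G]_x ((dotv q (tvec x)) ^+ 2)%:E <= (dotv q q)%:E)%E.
Proof.
have -> : dotv q q = \sum_i q i 0 ^+ 2 by apply: eq_bigr => i _; rewrite expr2.
apply: le_trans (gauss_dot_sqr_le (fun i => q i 0)).
rewrite le_eqVlt; apply/orP; left; apply/eqP; apply: eq_integral => x _.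
by congr (_ ^+ 2)%:E; apply: eq_bigr => i _; rewrite mxE.
Qed.

(** Its fourth power serves as the dominating function for integrability: it absorbs the cubic error
    terms of the expansions, and its integral reduces to a fourth moment. *)
Definition N1 (x : V) : R := 1 + enorm (tvec x).

Lemma N1_ge1 x : 1 <= N1 x. Proof. by rewrite lerDl enorm_ge0. Qed.

Lemma measurable_N1 d (T : measurableType d) (u : T -> V) :
  measurable_fun setT u -> measurable_fun setT (fun t => N1 (u t)).
Proof.
move=> mu; apply: measurable_funD => //.
by apply: (@measurable_lip1 R n _ _ (fun t => tvec (u t))); [exact: measurable_tvec|exact: enorm_lip1].
Qed.

Lemma integral_N1_lty : (\int[G]_x ((N1 x) ^+ 4)%:E < +oo)%E.
Proof.
have mN : measurable_fun setT (fun x : V => (N1 x ^+ 4)%:E).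
  by apply/measurable_EFinP; apply: measurable_funX; exact: measurable_N1.
have mS : measurable_fun setT (fun x : V => ((\sum_i (tnth x i) ^+ 2) ^+ 2)%:E).
  apply/measurable_EFinP/measurable_funX/measurable_sum => i.
  by apply: measurable_funX; exact: measurable_tnth.
have S0 (x : V) : (0 <= ((\sum_i (tnth x i) ^+ 2) ^+ 2)%:E)%E by rewrite lee_fin sqr_ge0.
apply: (@le_lt_trans _ _ (\int[G]_x (8%:E + 8%:E * ((\sum_i (tnth x i) ^+ 2) ^+ 2)%:E))%E).
  apply: ge0_le_integral => //.
  - by move=> x _; rewrite lee_fin exprn_even_ge0.
  - by apply: emeasurable_funD => //; exact: emeasurable_funM.
  - move=> x _; rewrite -EFinM -EFinD lee_fin.
    have -> : \sum_i tnth x i ^+ 2 = enorm (tvec x) ^+ 2.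
      by rewrite sqr_enorm; apply: eq_bigr => i _; rewrite mxE expr2.
    rewrite /N1; have := enorm_ge0 (tvec x); set t := enorm _ => t0.
    have := sqr_ge0 (t - 1); have := sqr_ge0 (t ^+ 2 - 1); have := sqr_ge0 (t ^+ 2 - t).
    by nra.
rewrite ge0_integralD//; last 2 first.
- by move=> x _; rewrite mule_ge0.
- exact: emeasurable_funM.
rewrite integral_cst//= probability_setT mule1 ge0_integralZl//.
by rewrite lte_add_pinfty ?ltry// lte_mul_pinfty//; exact: gauss_sum_sqr_lty.
Qed.

Definition M4 : R := fine (\int[G]_x ((N1 x) ^+ 4)%:E)%E.

Lemma integral_N1E : (\int[G]_x ((N1 x) ^+ 4)%:E = M4%:E)%E.
Proof.
rewrite fineK// ge0_fin_numE; first exact: integral_N1_lty.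
by apply: integral_ge0 => x _; rewrite lee_fin exprn_even_ge0.
Qed.

Lemma M4_ge0 : 0 <= M4.
Proof. by apply: fine_ge0; apply: integral_ge0 => x _; rewrite lee_fin exprn_even_ge0. Qed.

Lemma integrable_growth (F : V -> R) (C : R) : measurable_fun setT F ->
  (forall x, `|F x| <= C * N1 x ^+ 4) -> G.-integrable setT (EFin \o F).
Proof.
move=> mF h; have mN : measurable_fun setT (fun x : V => (N1 x ^+ 4)%:E).
  by apply/measurable_EFinP; apply: measurable_funX; exact: measurable_N1.
have C0 : 0 <= C.
  have x : V := [tuple 0 | i < n].
  have : 0 <= C * N1 x ^+ 4 by apply: le_trans (h x).
  by rewrite pmulr_lge0// exprn_gt0// (lt_le_trans _ (N1_ge1 x)).
apply: (@le_integrable _ _ _ _ _ measurableT _ (fun x => C%:E * (N1 x ^+ 4)%:E)%E).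
- exact/measurable_EFinP.
- by move=> x _; rewrite /= lee_fin (le_trans (h x))// ler_norm.
apply: integrableZl => //; apply/integrableP; split => //.
under eq_integral do rewrite gee0_abs ?lee_fin ?exprn_even_ge0//.
exact: integral_N1_lty.
Qed.

Lemma measurable_lip1_tvec (f : 'cV[R]_n -> R) : lip1 f ->
  measurable_fun setT (fun x : n.-tuple R => f (tvec x)).
Proof. by move=> lf; apply: measurable_lip1 => //; exact: measurable_tvec. Qed.

Lemma lip1_growth (f : 'cV[R]_n -> R) x : lip1 f ->
  `|f (tvec x)| <= (`|f 0| + 1) * N1 x ^+ 4.
Proof.
move=> lf; rewrite -[f (tvec x)](subrK (f 0)) addrC.
have N0 : 1 <= N1 x ^+ 4 by rewrite exprn_ege1// N1_ge1.
apply: (le_trans (ler_normD _ _)); rewrite mulrDl mul1r; apply: lerD.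
  by rewrite ler_peMr.
apply: (le_trans (lf _ _)); rewrite subr0; apply: (@le_trans _ _ (N1 x ^+ 1)).
  by rewrite expr1 /N1 lerDr.
by apply: ler_weXn2l => //; exact: N1_ge1.
Qed.

Lemma integrable_lip1 (f : 'cV[R]_n -> R) : lip1 f ->
  G.-integrable setT (EFin \o (fun x => f (tvec x))).
Proof.
move=> lf; apply: (@integrable_growth _ (`|f 0| + 1)).
  exact: measurable_lip1_tvec.
by move=> x; exact: lip1_growth.
Qed.

Definition N3 (p : V * V * V) : R :=
  1 + enorm (tvec p.1.1) + enorm (tvec p.1.2) + enorm (tvec p.2).

Lemma N3_ge1 p : 1 <= N3 p.
Proof. by rewrite /N3 -!addrA lerDl !addr_ge0// enorm_ge0. Qed.

Lemma integrable_growth3 (F : V * V * V -> R) (C : R) : measurable_fun setT F ->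
  (forall x, `|F x| <= C * N3 x ^+ 4) -> gauss3.-integrable setT (EFin \o F).
Proof.
move=> mF h.
have m1 : measurable_fun setT (fun x : V => (N1 x ^+ 4)%:E).
  by apply/measurable_EFinP; apply: measurable_funX; exact: measurable_N1.
have p1 (x : V) : (0 <= (N1 x ^+ 4)%:E)%E by rewrite lee_fin exprn_even_ge0.
have m11 : measurable_fun setT (fun p : V * V => (N1 p.1 ^+ 4)%:E).
  exact: (measurableT_comp m1).
have m12 : measurable_fun setT (fun p : V * V => (N1 p.2 ^+ 4)%:E).
  exact: (measurableT_comp m1).
have i1 : gauss3.-integrable setT (fun p : V * V * V => (N1 p.1.1 ^+ 4)%:E).
  apply/integrableP; split; first exact: (measurableT_comp m11).
  under eq_integral do rewrite gee0_abs//.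
  rewrite (ge0_integral_prob_prod_fst gauss2 G m11)//.
  by rewrite (ge0_integral_prob_prod_fst G G m1)//; exact: integral_N1_lty.
have i2 : gauss3.-integrable setT (fun p : V * V * V => (N1 p.1.2 ^+ 4)%:E).
  apply/integrableP; split; first exact: (measurableT_comp m12).
  under eq_integral do rewrite gee0_abs//.
  rewrite (ge0_integral_prob_prod_fst gauss2 G m12)//.
  by rewrite (ge0_integral_prob_prod_snd G G m1)//; exact: integral_N1_lty.
have i3 : gauss3.-integrable setT (fun p : V * V * V => (N1 p.2 ^+ 4)%:E).
  apply/integrableP; split; first exact: (measurableT_comp m1).
  under eq_integral do rewrite gee0_abs//.
  by rewrite (ge0_integral_prob_prod_snd gauss2 G m1)//; exact: integral_N1_lty.
have C0 : 0 <= C.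
  have x : V := [tuple 0 | i < n].
  have : 0 <= C * N3 (x, x, x) ^+ 4 by apply: le_trans (h _).
  by rewrite pmulr_lge0// exprn_gt0// (lt_le_trans _ (N3_ge1 _)).
(* [N3] is at most the sum of the three [N1], and [(a + b + c)^4 <= 27 (a^4 + b^4 + c^4)] by
   applying [(a + b + c)^2 <= 3 (a^2 + b^2 + c^2)] twice. *)
apply: (@le_integrable _ _ _ _ _ measurableT _
  (fun p => (27 * C)%:E * ((N1 p.1.1 ^+ 4)%:E + (N1 p.1.2 ^+ 4)%:E + (N1 p.2 ^+ 4)%:E))%E).
- exact/measurable_EFinP.
- move=> x _; rewrite /= lee_fin (le_trans (h x))//.
  rewrite ger0_norm; last first.
    by rewrite mulr_ge0 ?mulr_ge0// !addr_ge0 ?exprn_even_ge0.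
  rewrite [27 * C]mulrC -mulrA ler_wpM2l//.
  apply: (@le_trans _ _ ((N1 x.1.1 + N1 x.1.2 + N1 x.2) ^+ 4)).
    have n3 : 0 <= N3 x := le_trans ler01 (N3_ge1 x).
    have n1 (y : V) : 0 <= N1 y := le_trans ler01 (N1_ge1 y).
    by rewrite ler_pXn2r ?nnegrE ?addr_ge0 ?n1 ?enorm_ge0// /N3 /N1; lra.
  have pow2 (a b c : R) : (a + b + c) ^+ 2 <= 3 * (a ^+ 2 + b ^+ 2 + c ^+ 2).
    by have := sqr_ge0 (a - b); have := sqr_ge0 (b - c); have := sqr_ge0 (a - c); nra.
  move: (N1 x.1.1) (N1 x.1.2) (N1 x.2) => a b c.
  rewrite (_ : (a + b + c) ^+ 4 = ((a + b + c) ^+ 2) ^+ 2); last by rewrite -exprM.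
  apply: (@le_trans _ _ ((3 * (a ^+ 2 + b ^+ 2 + c ^+ 2)) ^+ 2)).
    by rewrite ler_pXn2r ?nnegrE ?sqr_ge0// mulr_ge0// !addr_ge0 ?sqr_ge0.
  by have := pow2 (a ^+ 2) (b ^+ 2) (c ^+ 2); rewrite -!exprM; nra.
by apply: integrableZl => //; apply: integrableD => //; exact: integrableD.
Qed.

(** With slack [g^3] in the expansion, the symmetric difference of [f] is [2 g q.v] up to [O(g^2)].
    The difference of the two squares factors into this error times a sum of order [g], which leaves
    [O(g^3)]. *)
Lemma sqr_diff_le (f : 'cV[R]_n -> R) (C g : R) (x : 'cV[R]_n) :
  0 <= C -> lip1 f -> approx_c11 C f -> 0 < g <= 1 ->
  exists q, dotv q q <= 1 + g ^+ 3 /\ forall v,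
    (f (x + g *: v) - f (x - g *: v)) ^+ 2 <=
    4 * g ^+ 2 * dotv q v ^+ 2 + 12 * (C + 1) * g ^+ 3 * (1 + enorm v) ^+ 4.
Proof.
move=> C0 lf cf /andP[g0 g1].
have g30 : 0 < g ^+ 3 <= 1 by rewrite exprn_gt0//= exprn_ile1// ltW.
have [q [q1 hq]] := cf x _ g30; exists q; split => // v.
have := hq (g *: v); have := hq (- (g *: v)).
have := lf (x + g *: v) (x - g *: v).
have -> : x + g *: v - (x - g *: v) = (2 * g) *: v.
  by apply/matrixP => i j; rewrite !mxE; ring.
have g20 : 0 < 2 * g by rewrite mulr_gt0.
rewrite enormZ (gtr0_norm g20).
rewrite dotvNl !dotvNr opprK !dotvZl !dotvZr -sqr_enorm.
set X := f (x + _); set Y := f (x - _); set s := dotv q v; set t := enorm v.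
have t0 : 0 <= t by exact: enorm_ge0.
have hs : `|s| <= 2 * t.
  have q2 : enorm q <= 2.
    rewrite -(@ler_pXn2r _ 2) ?nnegrE ?enorm_ge0// sqr_enorm.
    by case/andP: g30 => _ ?; lra.
  rewrite ler_norml; have h1 := cauchy_schwarz q v; have := cauchy_schwarz (- q) v.
  rewrite dotvNl enormN -/s -/t in h1 *; move=> h2.
  have : enorm q * t <= 2 * t by exact: ler_wpM2r.
  by move=> h3; apply/andP; split; lra.
move: hs; rewrite !ler_norml => /andP[s1 s2] /andP[h1 h2] /andP[h3 h4] /andP[h5 h6].
have A1 : `|(X - Y) - 2 * g * s| <= 2 * (C * (g ^+ 2 * t ^+ 2) + g ^+ 3).
  by rewrite ler_norml; apply/andP; split; lra.
have gs : `|g * s| <= 2 * g * t.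
  by rewrite normrM gtr0_norm// [2 * g]mulrC -mulrA ler_wpM2l// ?(ltW g0)// ler_norml s1 s2.
have A2 : `|(X - Y) + 2 * g * s| <= 6 * g * t.
  by move: gs; rewrite !ler_norml => /andP[? ?]; apply/andP; split; lra.
have : ((X - Y) - 2 * g * s) * ((X - Y) + 2 * g * s) <=
    2 * (C * (g ^+ 2 * t ^+ 2) + g ^+ 3) * (6 * g * t).
  apply: (le_trans (ler_norm _)); rewrite normrM.
  by apply: ler_pM.
have -> : ((X - Y) - 2 * g * s) * ((X - Y) + 2 * g * s) = (X - Y) ^+ 2 - 4 * g ^+ 2 * s ^+ 2.
  by ring.
have -> : 2 * (C * (g ^+ 2 * t ^+ 2) + g ^+ 3) * (6 * g * t) =
   12 * g ^+ 3 * (C * t ^+ 3 + g * t) by ring.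
have t4 : t ^+ 3 <= (1 + t) ^+ 4.
  apply: (@le_trans _ _ ((1 + t) ^+ 3)); first by rewrite ler_pXn2r// ?nnegrE; lra.
  by apply: ler_weXn2l => //; lra.
have t1 : t <= (1 + t) ^+ 4.
  apply: (@le_trans _ _ ((1 + t) ^+ 1)); first by rewrite expr1; lra.
  by apply: ler_weXn2l => //; lra.
have gt1 : g * t <= (1 + t) ^+ 4 by apply: le_trans t1; rewrite ler_piMl.
have : 12 * g ^+ 3 * (C * t ^+ 3 + g * t) <= 12 * g ^+ 3 * ((C + 1) * (1 + t) ^+ 4).
  rewrite ler_wpM2l//; first by rewrite mulr_ge0// ltW//; case/andP: g30.
  by rewrite mulrDl mul1r lerD// ler_wpM2l.
by lra.
Qed.

(** The leading term is the second moment of [2 g q.b], hence [4 g^2] in every dimension. The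
    dimension enters only through [M], the coefficient of the higher-order term, which is uniform in
    [x]. *)
Lemma variance_bound (f : 'cV[R]_n -> R) (C : R) :
  0 <= C -> lip1 f -> approx_c11 C f -> exists M, 0 <= M /\
  forall g x, 0 < g <= 1 ->
  (\int[G]_b ((f (x + g *: tvec b) - f (x - g *: tvec b)) ^+ 2)%:E <=
   (4 * g ^+ 2 + M * g ^+ 3)%:E)%E.
Proof.
move=> C0 lf cf; exists (4 + 12 * (C + 1) * M4); split.
  by rewrite addr_ge0// !mulr_ge0 ?M4_ge0//; lra.
move=> g x g01; have [q [q1 hq]] := sqr_diff_le x C0 lf cf g01.
case/andP: g01 => g0 g1.
have mN : measurable_fun setT (fun x : V => (N1 x ^+ 4)%:E).
  by apply/measurable_EFinP; apply: measurable_funX; exact: measurable_N1.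
have md : measurable_fun setT (fun x : V => (dotv q (tvec x) ^+ 2)%:E).
  apply/measurable_EFinP; apply: measurable_funX; apply: measurable_dotv.
  exact: measurable_tvec.
have c0 : 0 <= 4 * g ^+ 2 by rewrite mulr_ge0 ?sqr_ge0.
have c1 : 0 <= 12 * (C + 1) * g ^+ 3 by rewrite !mulr_ge0 ?exprn_ge0 ?(ltW g0)//; lra.
apply: (@le_trans _ _ (\int[G]_b ((4 * g ^+ 2)%:E * (dotv q (tvec b) ^+ 2)%:E +
    (12 * (C + 1) * g ^+ 3)%:E * (N1 b ^+ 4)%:E))%E).
  apply: ge0_le_integral => //.
  - by move=> b _; rewrite lee_fin sqr_ge0.
  - apply/measurable_EFinP; apply: measurable_funX; apply: measurable_funB.
      apply: (measurable_lip1 _ lf); apply: measurable_vecD; first exact: measurable_vec_cst.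
      by apply: measurable_vecZ; exact: measurable_tvec.
    apply: (measurable_lip1 _ lf); apply: measurable_vecB; first exact: measurable_vec_cst.
    by apply: measurable_vecZ; exact: measurable_tvec.
  - by apply: emeasurable_funD => //; exact: emeasurable_funM.
  - by move=> b _; rewrite -!EFinM -EFinD lee_fin; exact: hq.
rewrite ge0_integralD//; last 4 first.
- by move=> b _; rewrite mule_ge0// lee_fin ?sqr_ge0.
- exact: emeasurable_funM.
- by move=> b _; rewrite mule_ge0// lee_fin ?exprn_even_ge0.
- exact: emeasurable_funM.
rewrite !ge0_integralZl ?lee_fin//; last 2 first.
- by move=> b _; rewrite lee_fin exprn_even_ge0.
- by move=> b _; rewrite lee_fin sqr_ge0.
rewrite integral_N1E.
apply: (@le_trans _ _ ((4 * g ^+ 2)%:E * (1 + g ^+ 3)%:E + (12 * (C + 1) * g ^+ 3)%:E * M4%:E)%E).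
  apply: leeD => //; apply: lee_wpmul2l; first by rewrite lee_fin.
  by apply: (le_trans (integral_dotv_sqr_le q)); rewrite lee_fin.
rewrite -!EFinM -EFinD lee_fin.
have : g ^+ 2 * g ^+ 3 <= g ^+ 3.
  by rewrite ler_piMl ?exprn_ge0 ?(ltW g0)// exprn_ile1// ltW.
by lra.
Qed.

End growth.

Section rotE.
Context {R : realType} {n : nat}.
Variables (a b : R) (p : n.-tuple R * n.-tuple R * n.-tuple R).

Lemma rot12E :
  (tvec (rot12 a b p).1.1 = a *: tvec p.1.1 + b *: tvec p.1.2) *
  (tvec (rot12 a b p).1.2 = a *: tvec p.1.2 - b *: tvec p.1.1) *
  (tvec (rot12 a b p).2 = tvec p.2).
Proof. by rewrite (tvec_rot1 a b p.1) (tvec_rot2 a b p.1). Qed.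

Lemma rot13E :
  (tvec (rot13 a b p).1.1 = a *: tvec p.1.1 + b *: tvec p.2) *
  (tvec (rot13 a b p).1.2 = tvec p.1.2) *
  (tvec (rot13 a b p).2 = a *: tvec p.2 - b *: tvec p.1.1).
Proof. by rewrite (tvec_rot1 a b (p.1.1, p.2)) (tvec_rot2 a b (p.1.1, p.2)). Qed.

Lemma rot23E :
  (tvec (rot23 a b p).1.1 = tvec p.1.1) *
  (tvec (rot23 a b p).1.2 = a *: tvec p.1.2 + b *: tvec p.2) *
  (tvec (rot23 a b p).2 = a *: tvec p.2 - b *: tvec p.1.2).
Proof. by rewrite (tvec_rot1 a b (p.1.2, p.2)) (tvec_rot2 a b (p.1.2, p.2)). Qed.

End rotE.

Lemma N3_fst_trd (R : realType) (n : nat) (p : n.-tuple R * n.-tuple R * n.-tuple R) :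
  enorm (tvec p.1.1) + enorm (tvec p.2) <= N3 p - enorm (tvec p.1.2).
Proof. rewrite /N3; lra. Qed.

(* AM-GM with weights [r] and [1/r], as the increment [D'] carries a factor [r]
   that [D] lacks; the last term absorbs the variation of the slope. *)
Lemma stein_product_bound (R : realType) (r be t k L D D' E : R) :
  0 < r -> r <= 1 -> 0 < be -> be <= 1 -> 0 <= t -> 0 <= k -> 0 <= L ->
  `|D| <= 2 * be * t -> `|D'| <= 2 * (r * be) * t ->
  `|E| <= (k + L * (r * be * t)) * `|D'| ->
  D * E <= k / 2 * (r * D ^+ 2 + r^-1 * D' ^+ 2) + 4 * L * r * be ^+ 3 * (1 + t) ^+ 4 /\
  `|D * E| <= 4 * (k + L) * (1 + t) ^+ 4.
Proof.
move=> r0 r1 be0 be1 t0 k0 L0 hD hD' hE.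
have t4 (j : nat) : (j <= 4)%N -> t ^+ j <= (1 + t) ^+ 4.
  move=> j4; apply: (@le_trans _ _ ((1 + t) ^+ j)).
    by apply: lerXn2r; rewrite ?nnegrE//; lra.
  by apply: ler_weXn2l => //; lra.
have b0 : 0 <= `|D| := normr_ge0 D; have b'0 : 0 <= `|D'| := normr_ge0 D'.
have h1 : `|D * E| <= k * (`|D| * `|D'|) + L * (r * be * t) * (`|D| * `|D'|).
  rewrite normrM; apply: (le_trans (ler_wpM2l b0 hE)).
  by rewrite -mulrDl mulrCA.
have h2 : `|D| * `|D'| <= (2 * be * t) * (2 * (r * be) * t) by exact: ler_pM.
have r0' := ltW r0; have be0' := ltW be0.
have rb1 j : r * be ^+ j <= 1.
  by apply: mulr_ile1 => //; [exact: exprn_ge0|exact: exprn_ile1].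
have rbt : 0 <= r * be * t by rewrite !mulr_ge0.
have h3 : L * (r * be * t) * (`|D| * `|D'|) <= 4 * L * r * be ^+ 3 * (1 + t) ^+ 4.
  apply: (@le_trans _ _ (L * (r * be * t) * ((2 * be * t) * (2 * (r * be) * t)))).
    by rewrite ler_wpM2l ?mulr_ge0.
  have -> : L * (r * be * t) * (2 * be * t * (2 * (r * be) * t)) =
    4 * L * r * be ^+ 3 * (r * t ^+ 3) by ring.
  rewrite ler_wpM2l ?mulr_ge0 ?exprn_ge0//.
  by apply: le_trans (t4 3 isT); rewrite ler_piMl ?exprn_ge0.
split.
  apply: (le_trans (ler_norm _)); apply: (le_trans h1); rewrite lerD//.
  rewrite -mulrA ler_wpM2l//.
  have : 0 <= r^-1 * (r * `|D| - `|D'|) ^+ 2 by rewrite mulr_ge0 ?sqr_ge0 ?invr_ge0.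
  have -> : r^-1 * (r * `|D| - `|D'|) ^+ 2 =
    r * `|D| ^+ 2 + r^-1 * `|D'| ^+ 2 - 2 * (`|D| * `|D'|) by field; rewrite gt_eqF.
  by rewrite !real_normK ?num_real//; lra.
apply: (le_trans h1); rewrite mulrDr mulrDl lerD//.
  have -> : 4 * k * (1 + t) ^+ 4 = k * (4 * (1 + t) ^+ 4) by ring.
  rewrite ler_wpM2l//; apply: (le_trans h2).
  have -> : 2 * be * t * (2 * (r * be) * t) = 4 * ((r * be ^+ 2) * t ^+ 2) by ring.
  rewrite ler_wpM2l//; apply: le_trans (t4 2 isT).
  by rewrite ler_piMl ?exprn_ge0// mulr_ile1 ?exprn_ge0 ?exprn_ile1 ?ltW.
apply: (le_trans h3); rewrite ler_wpM2r ?exprn_ge0 ?addr_ge0//.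
by rewrite -mulrA ler_piMr ?mulr_ge0//; exact: rb1.
Qed.

Lemma N1_le_N3 (R : realType) (n : nat) (p : n.-tuple R * n.-tuple R * n.-tuple R) :
  N1 p.2 ^+ 4 <= N3 p ^+ 4.
Proof.
apply: lerXn2r; rewrite ?nnegrE; [exact: le_trans (N1_ge1 _)|exact: le_trans (N3_ge1 _)|].
rewrite /N1 /N3; have := enorm_ge0 (tvec p.1.1); have := enorm_ge0 (tvec p.1.2); lra.
Qed.

Lemma half_sqr (R : realType) (be : R) : 0 < be -> be <= 1 / 2 ->
  0 < 1 - 2 * be ^+ 2 /\ 0 < 1 - be ^+ 2.
Proof. by move=> be0 be1; split; nra. Qed.

(** * Covariance inequality *)

Section stein.
Context {R : realType} {n : nat}.
Notation V := (n.-tuple R).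
Notation G := (@gauss R n).
Variables (f : 'cV[R]_n -> R) (C : R).
Hypotheses (lf : lip1 f) (C0 : 0 <= C) (cf : approx_c11 C f).
Variables (h K : R -> R) (L M : R).
Hypotheses (mh : measurable_fun setT h) (mK : measurable_fun setT K).
Hypotheses (L0 : 0 <= L) (K0 : forall w, 0 <= K w) (KM : forall w, K w <= M).
(* [K] plays the role of [|h'|]; it need not be a derivative. *)
Hypothesis KL : forall a b, `|K a - K b| <= L * `|a - b|.
Hypothesis hM : forall a b, `|h a - h b| <= M * `|a - b|.
Hypothesis hK : forall w r a b, `|a - w| <= r -> `|b - w| <= r ->
  `|h a - h b| <= (K w + L * r) * `|a - b|.

Let M0 : 0 <= M. Proof. exact: le_trans (K0 0) (KM 0). Qed.

Let g x := h (f x).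

Let gM u v : `|g u - g v| <= M * enorm (u - v).
Proof. by apply: (le_trans (hM _ _)); rewrite ler_wpM2l. Qed.

Let mf d (T : measurableType d) (u : T -> 'cV[R]_n) :
  measurable_vec u -> measurable_fun setT (fun t => f (u t)).
Proof. by move=> mu; exact: measurable_lip1. Qed.

Let mg d (T : measurableType d) (u : T -> 'cV[R]_n) :
  measurable_vec u -> measurable_fun setT (fun t => g (u t)).
Proof. by move=> mu; apply: (measurableT_comp mh); exact: mf. Qed.

Let mKf d (T : measurableType d) (u : T -> 'cV[R]_n) :
  measurable_vec u -> measurable_fun setT (fun t => K (f (u t))).
Proof. by move=> mu; apply: (measurableT_comp mK); exact: mf. Qed.

Let A (p : V * V * V) := tvec p.1.1.
Let Z (p : V * V * V) := tvec p.1.2.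
Let B (p : V * V * V) := tvec p.2.

Let mA : measurable_vec A.
Proof. by apply: measurable_tvec; exact: measurableT_comp. Qed.
Let mZ : measurable_vec Z.
Proof. by apply: measurable_tvec; exact: measurableT_comp. Qed.
Let mB : measurable_vec B.
Proof. exact: measurable_tvec. Qed.

Let Q (r : R) : R :=
  \int[gauss3]_p (f (A p) * g (r *: A p + Num.sqrt (1 - r ^+ 2) *: Z p)).

Let lin_le (a b : R) (u v : 'cV[R]_n) (k : R) : `|a| <= 1 -> `|b| <= 1 ->
  enorm u + enorm v <= k -> enorm (a *: u + b *: v) <= k.
Proof.
move=> a1 b1 h1; apply: (le_trans (enormD _ _)); rewrite !enormZ.
have := enorm_ge0 u; have := enorm_ge0 v => u0 v0.
have : `|a| * enorm u <= enorm u by rewrite ler_piMl.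
have : `|b| * enorm v <= enorm v by rewrite ler_piMl.
by lra.
Qed.

Let integrable_fg (u v : V * V * V -> 'cV[R]_n) :
  measurable_vec u -> measurable_vec v ->
  (forall p, enorm (u p) <= N3 p) -> (forall p, enorm (v p) <= N3 p) ->
  gauss3.-integrable setT (EFin \o (fun p => f (u p) * g (v p))).
Proof.
move=> mu mv hu hv.
apply: (@integrable_growth3 _ _ _ ((`|f 0| + 1) * (`|g 0| + M))).
  by apply: measurable_funM; [exact: mf|exact: mg].
move=> p; have N0 : 0 <= N3 p := le_trans ler01 (N3_ge1 p).
have f1 : `|f (u p)| <= (`|f 0| + 1) * N3 p.
  rewrite mulrDl mul1r -[f (u p)](subrK (f 0)) addrC.
  apply: (le_trans (ler_normD _ _)); apply: lerD.
    by rewrite ler_peMr// N3_ge1.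
  by apply: le_trans (hu p); apply: (le_trans (lf _ _)); rewrite subr0.
have g1 : `|g (v p)| <= (`|g 0| + M) * N3 p.
  rewrite mulrDl -[g (v p)](subrK (g 0)) addrC.
  apply: (le_trans (ler_normD _ _)); apply: lerD.
    by rewrite ler_peMr// N3_ge1.
  by apply: (le_trans (gM _ _)); rewrite subr0 ler_wpM2l.
rewrite normrM; apply: (le_trans (ler_pM (normr_ge0 _) (normr_ge0 _) f1 g1)).
rewrite mulrACA ler_wpM2l ?mulr_ge0 ?addr_ge0//.
by rewrite -expr2; apply: ler_weXn2l => //; exact: N3_ge1.
Qed.

Section step.
Variables (al be r : R).
Hypotheses (albe : al ^+ 2 + be ^+ 2 = 1) (al0 : 0 < al) (be0 : 0 < be).
Hypotheses (r0 : 0 < r) (r1 : r <= 1).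
Let s := Num.sqrt (1 - r ^+ 2).

Let al1 : al <= 1.
Proof. by rewrite -(@ler_pXn2r _ 2)// ?nnegrE ?(ltW al0)// expr1n -albe lerDl sqr_ge0. Qed.
Let be1 : be <= 1.
Proof. by rewrite -(@ler_pXn2r _ 2)// ?nnegrE ?(ltW be0)// expr1n -albe lerDr sqr_ge0. Qed.
Let s0 : 0 <= s. Proof. exact: sqrtr_ge0. Qed.
Let s2 : s ^+ 2 = 1 - r ^+ 2.
Proof. by rewrite sqr_sqrtr// subr_ge0 exprn_ile1// ltW. Qed.
Let s1 : s <= 1.
Proof. by rewrite -(@ler_pXn2r _ 2)// ?nnegrE// s2 expr1n lerBlDr lerDl sqr_ge0. Qed.

(* [al A + be B] and [al A - be B] are standard Gaussian with correlation
   [al^2 - be^2], so the correlation [r] of the second factor of [Q] gets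
   multiplied by it. *)
Let Qdiag (si : R) : si ^+ 2 = be ^+ 2 ->
  \int[gauss3]_p (f (al *: A p + si *: B p) *
    g (r *: (al *: A p + si *: B p) + s *: Z p)) = Q r.
Proof.
move=> si2.
have alsi : al ^+ 2 + si ^+ 2 = 1 by rewrite si2.
have si0 : si != 0 by rewrite -sqrf_eq0 si2 sqrf_eq0 gt_eqF.
pose F1 (p : V * V * V) := f (A p) * g (r *: A p + s *: Z p).
have mF1 : measurable_fun setT F1.
  apply: measurable_funM; first exact: mf.
  by apply: mg; apply: measurable_vecD; exact: measurable_vecZ.
rewrite -[RHS]/(\int[gauss3]_p F1 p) -(Rintegral_rot13 alsi si0 mF1).
by apply: eq_Rintegral => p _; rewrite /F1 /A /B /Z !rot13E.
Qed.

Let Qcross (si : R) : si ^+ 2 = be ^+ 2 ->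
  \int[gauss3]_p (f (al *: A p + si *: B p) *
    g (r *: (al *: A p + - si *: B p) + s *: Z p)) = Q (r * (al ^+ 2 - be ^+ 2)).
Proof.
move=> si2.
have alsi : al ^+ 2 + si ^+ 2 = 1 by rewrite si2.
have si0 : si != 0 by rewrite -sqrf_eq0 si2 sqrf_eq0 gt_eqF.
(* In terms of [A' = al A + si B] and [B' = al B - si A], the argument of [g] is
   [rho A' + (s Z - 2 r al si B')]. The bracket has variance [s^2 + (2 r al be)^2 = 1 - rho^2], and
   [a'], [b'] below are its coefficients normalized to a rotation of [Z] and [B']. *)
set rho := r * _; pose rho' := Num.sqrt (1 - rho ^+ 2).
have rho2 : 1 - rho ^+ 2 = s ^+ 2 + (2 * r * al * be) ^+ 2.
  rewrite s2 /rho.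
  have -> : 1 - r ^+ 2 + (2 * r * al * be) ^+ 2 =
    1 - r ^+ 2 * (1 - 4 * al ^+ 2 * be ^+ 2) by ring.
  have -> : 1 - 4 * al ^+ 2 * be ^+ 2 = (al ^+ 2 + be ^+ 2) ^+ 2 - 4 * al ^+ 2 * be ^+ 2.
    by rewrite albe expr1n.
  by ring.
have rho'0 : 0 < rho'.
  rewrite sqrtr_gt0 rho2 ltr_wpDl ?sqr_ge0// exprn_gt0//.
  by rewrite !mulr_gt0.
have rho'n0 : rho' != 0 by rewrite gt_eqF.
have rho'2 : rho' ^+ 2 = s ^+ 2 + (2 * r * al * be) ^+ 2.
  by rewrite sqr_sqrtr// rho2 addr_ge0// sqr_ge0.
pose a' := s / rho'; pose b' := - (2 * r * al * si) / rho'.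
have ab' : a' ^+ 2 + b' ^+ 2 = 1.
  rewrite /a' /b' !exprMn exprVn -mulrDl sqrrN.
  have -> : (2 * r * al * si) ^+ 2 = (2 * r * al * be) ^+ 2 by rewrite !exprMn si2.
  by rewrite -rho'2 divff// expf_neq0.
have b'0 : b' != 0.
  by rewrite mulf_neq0 ?invr_eq0// oppr_eq0 !mulf_neq0// ?gt_eqF.
pose F2 (p : V * V * V) := f (A p) * g (rho *: A p + rho' *: Z p).
have mF2 : measurable_fun setT F2.
  apply: measurable_funM; first exact: mf.
  by apply: mg; apply: measurable_vecD; exact: measurable_vecZ.
rewrite -[RHS]/(\int[gauss3]_p F2 p) -(Rintegral_rot23 ab' b'0 mF2).
rewrite -(Rintegral_rot13 alsi si0 (f := fun p => F2 (rot23 a' b' p))); last first.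
  exact: (measurableT_comp mF2 (measurable_rot23 a' b')).
apply: eq_Rintegral => p _; rewrite /F2 /A /B /Z !rot23E !rot13E; congr (_ * g _).
have e1 : rho' * a' = s by rewrite /a' mulrC divfK.
have e2 : rho' * b' = - (2 * r * al * si) by rewrite /b' mulrC divfK.
apply/matrixP => i j; rewrite !mxE.
set x := tnth _ _; set y := tnth p.2 _; set z := tnth _ _.
transitivity (rho * (al * x + si * y) + (rho' * a') * z + (rho' * b') * (al * y - si * x)); last by ring.
rewrite e1 e2 /rho -si2.
transitivity (r * (al ^+ 2 + si ^+ 2) * (al * x - si * y) + s * z); last by ring.
by rewrite alsi mulr1 mulNr.
Qed.

Let prod (p : V * V * V) : R :=
  (f (al *: A p + be *: B p) - f (al *: A p + - be *: B p)) *
  (g (r *: (al *: A p + be *: B p) + s *: Z p) -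
   g (r *: (al *: A p + - be *: B p) + s *: Z p)).

Let integrable_t (si si' : R) : `|si| <= 1 -> `|si'| <= 1 ->
  gauss3.-integrable setT (EFin \o (fun p =>
    f (al *: A p + si *: B p) * g (r *: (al *: A p + si' *: B p) + s *: Z p))).
Proof.
move=> si1 si'1.
have mU (c : R) : measurable_vec (fun p => al *: A p + c *: B p).
  by apply: measurable_vecD; exact: measurable_vecZ.
have mW (c : R) : measurable_vec (fun p => r *: (al *: A p + c *: B p) + s *: Z p).
  by apply: measurable_vecD; apply: measurable_vecZ.
have hU (c : R) p : `|c| <= 1 -> enorm (al *: A p + c *: B p) <= N3 p - enorm (Z p).
  move=> c1; apply: (le_trans _ (N3_fst_trd p)).
  by apply: lin_le => //; rewrite gtr0_norm.
have hU3 (p : V * V * V) : enorm (al *: A p + si *: B p) <= N3 p.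
  by apply: (le_trans (hU _ p si1)); rewrite gerBl enorm_ge0.
have hW (p : V * V * V) : enorm (r *: (al *: A p + si' *: B p) + s *: Z p) <= N3 p.
  apply: lin_le; first by rewrite gtr0_norm.
    by rewrite ger0_norm.
  by rewrite -lerBrDr; exact: hU.
exact: (integrable_fg (mU si) (mW si') hU3 hW).
Qed.

(** Polarization: expanding the product gives two terms with equal signs, each of mean [Q r], and
    two with opposite signs, each of mean [Q] at the reduced correlation. *)
Let integral_prod : \int[gauss3]_p prod p = 2 * (Q r - Q (r * (al ^+ 2 - be ^+ 2))).
Proof.
have q1 := @Qdiag be erefl; have q2 := @Qcross be erefl.
have nb2 : (- be) ^+ 2 = be ^+ 2 by rewrite sqrrN.
have q3 := Qdiag nb2; have q4 := Qcross nb2.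
pose t si si' p := f (al *: A p + si *: B p) * g (r *: (al *: A p + si' *: B p) + s *: Z p).
have it si si' : `|si| <= 1 -> `|si'| <= 1 -> gauss3.-integrable setT (EFin \o (t si si')).
  move=> h1 h2; exact: integrable_t.
have ben : `|be| <= 1 by rewrite gtr0_norm.
have nben : `|- be| <= 1 by rewrite normrN gtr0_norm.
have i1 := it _ _ ben ben; have i2 := it _ _ ben nben.
have i3 := it _ _ nben nben.
have nnben : `|- - be| <= 1 by rewrite opprK.
have i4 := it _ _ nben nnben.
transitivity (\int[gauss3]_p (t be be p + t (- be) (- be) p) -
   \int[gauss3]_p (t be (- be) p + t (- be) (- - be) p)).
  rewrite -(RintegralB measurableT (integrableD measurableT i1 i3) (integrableD measurableT i2 i4)).
  apply: eq_Rintegral => p _; rewrite /prod /t opprK.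
  move: (f _) (f _) (g _) (g _) => u1 u2 u3 u4; clear.
  by ring.
rewrite (RintegralD measurableT i1 i3) (RintegralD measurableT i2 i4) q1 q2 q3 q4.
by move: (Q r) (Q _) => x y; clear; ring.
Qed.

Let vE (p : V * V * V) (si : R) :
  r *: (al *: A p + si *: B p) + s *: Z p =
  (r *: (al *: A p) + s *: Z p) + (r * si) *: B p.
Proof. by rewrite scalerDr (scalerA r si) addrAC. Qed.

Variable M5 : R.
Hypothesis M50 : 0 <= M5.
Hypothesis varf : forall c x, 0 < c <= 1 ->
  (\int[G]_b ((f (x + c *: tvec b) - f (x - c *: tvec b)) ^+ 2)%:E <=
   (4 * c ^+ 2 + M5 * c ^+ 3)%:E)%E.

Let x0 (p : V * V * V) := al *: A p.
Let y0 (p : V * V * V) := r *: (al *: A p) + s *: Z p.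
Let D (p : V * V * V) := f (x0 p + be *: B p) - f (x0 p - be *: B p).
Let D' (p : V * V * V) := f (y0 p + (r * be) *: B p) - f (y0 p - (r * be) *: B p).

(** The slope is frozen at [y0], which does not involve [B]; integrating over [B] alone then reduces
    to the variance of [D] and [D']. *)
Let J (p : V * V * V) : R :=
  K (f (y0 p)) / 2 * (r * D p ^+ 2 + r^-1 * D' p ^+ 2) +
  4 * L * r * be ^+ 3 * N1 p.2 ^+ 4.

Let prod_bounds p : prod p <= J p /\ `|prod p| <= 4 * (M + L) * N1 p.2 ^+ 4.
Proof.
have b2 : 0 <= 2 * be by rewrite mulr_ge0 ?ltW.
have g2 : 0 <= 2 * (r * be) by rewrite !mulr_ge0 ?ltW.
have prodE : prod p = D p * (g (y0 p + (r * be) *: B p) - g (y0 p - (r * be) *: B p)).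
  by rewrite /prod !vE mulrN !scaleNr.
have DB : `|D p| <= 2 * be * enorm (B p).
  rewrite -[2 * be]ger0_norm// -enormZ; apply: (le_trans (lf _ _)).
  rewrite le_eqVlt; apply/orP; left; apply/eqP; congr enorm.
  by apply/matrixP => i j; rewrite !mxE; ring.
have D'B : `|D' p| <= 2 * (r * be) * enorm (B p).
  rewrite -[2 * (r * be)]ger0_norm// -enormZ; apply: (le_trans (lf _ _)).
  rewrite le_eqVlt; apply/orP; left; apply/eqP; congr enorm.
  by apply/matrixP => i j; rewrite !mxE; ring.
have rb0 : 0 <= r * be by rewrite mulr_ge0 ?ltW.
have EB : `|g (y0 p + (r * be) *: B p) - g (y0 p - (r * be) *: B p)| <=
    (K (f (y0 p)) + L * (r * be * enorm (B p))) * `|D' p|.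
  apply: hK; apply: (le_trans (lf _ _)).
    by rewrite addrAC subrr add0r enormZ ger0_norm//.
  by rewrite addrAC subrr add0r enormN enormZ ger0_norm//.
rewrite prodE; split.
  exact: (stein_product_bound r0 r1 be0 be1 (enorm_ge0 _) (K0 _) L0 DB D'B EB).1.
apply: (le_trans (stein_product_bound r0 r1 be0 be1 (enorm_ge0 _) (K0 _) L0 DB D'B EB).2).
rewrite ler_wpM2r ?exprn_ge0 ?addr_ge0 ?enorm_ge0//.
by rewrite ler_wpM2l// lerD2r.
Qed.

Let C00 := M * M5 + 4 * L * @M4 R n.

(** The slope is evaluated at a standard Gaussian vector instead of at [y0], whose variance is below
    1, so that its mean is the mean of [K (f (tvec x))]. The term in [L * be] pays for this
    shift. *)
Let R1 (p : V * V * V) : R :=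
  r * (4 * be ^+ 2 * (K (f (r *: (al *: A p + be *: B p) + s *: Z p)) +
                      L * be * N1 p.2 ^+ 4) + be ^+ 3 * C00).

Let mU (c : R) : measurable_vec (fun p => al *: A p + c *: B p).
Proof. by apply: measurable_vecD; exact: measurable_vecZ. Qed.

Let mW (c : R) : measurable_vec (fun p => r *: (al *: A p + c *: B p) + s *: Z p).
Proof. by apply: measurable_vecD; apply: measurable_vecZ. Qed.

Let my0 : measurable_vec y0.
Proof. by apply: measurable_vecD; apply: measurable_vecZ => //; exact: measurable_vecZ. Qed.

Let mN : measurable_fun setT (fun p : V * V * V => N1 p.2 ^+ 4).
Proof. by apply: measurable_funX; exact: measurable_N1. Qed.

Let mprod : measurable_fun setT prod.
Proof.
apply: measurable_funM; apply: measurable_funB.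
- exact: (mf (mU be)).
- exact: (mf (mU (- be))).
- exact: (mg (mW be)).
- exact: (mg (mW (- be))).
Qed.

Let mR1 : measurable_fun setT R1.
Proof.
apply: measurable_funM => //; apply: measurable_funD => //.
apply: measurable_funM => //; apply: measurable_funD; first exact: (mKf (mW be)).
exact: measurable_funM.
Qed.

Let mD : measurable_fun setT D.
Proof.
have mx0 : measurable_vec x0 by exact: measurable_vecZ.
have mb : measurable_vec (fun p => be *: B p) by exact: measurable_vecZ.
apply: measurable_funB; apply: mf; first exact: measurable_vecD.
exact: measurable_vecB.
Qed.

Let mD' : measurable_fun setT D'.
Proof.
have mb : measurable_vec (fun p => (r * be) *: B p) by exact: measurable_vecZ.
apply: measurable_funB; apply: mf; first exact: measurable_vecD.
exact: measurable_vecB.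
Qed.

Let C00_ge0 : 0 <= C00.
Proof. by rewrite addr_ge0 ?mulr_ge0// M4_ge0. Qed.

Let R1_le p : `|R1 p| <= (4 * M + 4 * L + C00) * N1 p.2 ^+ 4.
Proof.
have N0 : 1 <= N1 p.2 ^+ 4 by rewrite exprn_ege1// N1_ge1.
have N00 : 0 <= N1 p.2 ^+ 4 := le_trans ler01 N0.
have be0' := ltW be0; have r0' := ltW r0.
have bj (j : nat) : be ^+ j <= 1 by exact: exprn_ile1.
have b0j (j : nat) : 0 <= be ^+ j by exact: exprn_ge0.
rewrite /R1; set k := K _; have k0 : 0 <= k by exact: K0.
have kM : k <= M by exact: KM.
have LN : 0 <= L * be * N1 p.2 ^+ 4 by rewrite mulr_ge0// mulr_ge0.
have S0 : 0 <= k + L * be * N1 p.2 ^+ 4 by exact: addr_ge0.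
have B0 : 0 <= 4 * be ^+ 2 by rewrite mulr_ge0.
have X0 : 0 <= 4 * be ^+ 2 * (k + L * be * N1 p.2 ^+ 4) by exact: mulr_ge0.
have X1 : 0 <= 4 * be ^+ 2 * (k + L * be * N1 p.2 ^+ 4) + be ^+ 3 * C00.
  by rewrite addr_ge0// mulr_ge0.
rewrite ger0_norm; last by rewrite mulr_ge0.
apply: (@le_trans _ _ (4 * be ^+ 2 * (k + L * be * N1 p.2 ^+ 4) + be ^+ 3 * C00)).
  by rewrite ler_piMl.
rewrite [leRHS]mulrDl; apply: lerD; last first.
  by apply: (@le_trans _ _ C00); [rewrite ler_piMl|rewrite ler_peMr].
apply: (@le_trans _ _ (4 * (k + L * be * N1 p.2 ^+ 4))).
  by rewrite -mulrA ler_wpM2l// ler_piMl.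
rewrite -mulrDr -[leRHS]mulrA ler_wpM2l// [leRHS]mulrDl.
apply: lerD.
  by apply: (le_trans kM); rewrite ler_peMr.
by rewrite -mulrA ler_wpM2l// ler_piMl.
Qed.

Let T0 (p : V * V * V) := r * (4 * be ^+ 2 * K (f (y0 p)) + be ^+ 3 * C00).

Let T0_le_R1 p : T0 p <= R1 p.
Proof.
have be0' := ltW be0; have r0' := ltW r0.
rewrite /T0 /R1 ler_wpM2l// lerD2r ler_wpM2l ?mulr_ge0 ?sqr_ge0//.
have := KL (f (y0 p)) (f (r *: (al *: A p + be *: B p) + s *: Z p)).
rewrite ler_norml => /andP[_].
set k := K _; set k' := K _ => kk.
apply: (@le_trans _ _ (k' + L * `|f (y0 p) - f (r *: (al *: A p + be *: B p) + s *: Z p)|)).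
  by rewrite -lerBlDl.
rewrite lerD2l -mulrA ler_wpM2l//; apply: (le_trans (lf _ _)).
rewrite vE -/(y0 p) opprD addrA subrr add0r enormN enormZ ger0_norm ?mulr_ge0//.
rewrite -mulrA; apply: (@le_trans _ _ (be * enorm (B p))).
  by rewrite ler_piMl// mulr_ge0// enorm_ge0.
rewrite ler_wpM2l//; apply: (@le_trans _ _ (N1 p.2 ^+ 1)).
  by rewrite expr1 /N1 lerDr.
by apply: ler_weXn2l => //; exact: N1_ge1.
Qed.

(** [T0] ignores the third component, so the repeated [a] is a placeholder. The variance bound is
    used at [x0] with step [be] and at [y0] with step [r * be]. *)
Let integral_J_le a z :
  (\int[G]_b (J ((a, z), b))%:E <= (T0 ((a, z), a))%:E)%E.
Proof.
have be0' := ltW be0; have r0' := ltW r0.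
have mpr : measurable_fun setT (fun b : V => ((a, z), b)).
  exact: pair1_measurable.
have mDb : measurable_fun setT (fun b => (D ((a, z), b) ^+ 2)%:E).
  by apply/measurable_EFinP/measurable_funX; exact: (measurableT_comp mD).
have mD'b : measurable_fun setT (fun b => (D' ((a, z), b) ^+ 2)%:E).
  by apply/measurable_EFinP/measurable_funX; exact: (measurableT_comp mD').
have mNb : measurable_fun setT (fun b : V => (N1 b ^+ 4)%:E).
  by apply/measurable_EFinP/measurable_funX; exact: measurable_N1.
pose k := K (f (y0 ((a, z), a))).
have k0 : 0 <= k by exact: K0.
have c1 : 0 <= k / 2 * r by rewrite !mulr_ge0.
have c2 : 0 <= k / 2 * r^-1 by rewrite !mulr_ge0// invr_ge0.
have c3 : 0 <= 4 * L * r * be ^+ 3 by rewrite !mulr_ge0// exprn_ge0.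
have D2 b : (0 <= (D ((a, z), b) ^+ 2)%:E)%E by rewrite lee_fin sqr_ge0.
have D'2 b : (0 <= (D' ((a, z), b) ^+ 2)%:E)%E by rewrite lee_fin sqr_ge0.
have N2 (b : V) : (0 <= (N1 b ^+ 4)%:E)%E by rewrite lee_fin exprn_even_ge0.
rewrite (eq_integral (fun b => ((k / 2 * r)%:E * (D ((a, z), b) ^+ 2)%:E +
  (k / 2 * r^-1)%:E * (D' ((a, z), b) ^+ 2)%:E) +
  (4 * L * r * be ^+ 3)%:E * (N1 b ^+ 4)%:E)%E); last first.
  by move=> b _; rewrite -!EFinM -!EFinD /J -/k; congr EFin; rewrite mulrDr !mulrA.
rewrite ge0_integralD//; last 4 first.
- by move=> b _; rewrite adde_ge0// mule_ge0.
- by apply: emeasurable_funD; exact: emeasurable_funM.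
- by move=> b _; rewrite mule_ge0.
- exact: emeasurable_funM.
rewrite ge0_integralD//; last 4 first.
- by move=> b _; rewrite mule_ge0.
- exact: emeasurable_funM.
- by move=> b _; rewrite mule_ge0.
- exact: emeasurable_funM.
rewrite !ge0_integralZl// integral_N1E.
have b01 : 0 < be <= 1 by rewrite be0.
have g01 : 0 < r * be <= 1 by rewrite mulr_gt0//= mulr_ile1.
have v1 := varf (x0 ((a, z), a)) b01.
have v2 := varf (y0 ((a, z), a)) g01.
apply: (@le_trans _ _ ((k / 2 * r)%:E * (4 * be ^+ 2 + M5 * be ^+ 3)%:E +
  (k / 2 * r^-1)%:E * (4 * (r * be) ^+ 2 + M5 * (r * be) ^+ 3)%:E +
  (4 * L * r * be ^+ 3)%:E * (@M4 R n)%:E)%E).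
  by apply: leeD => //; apply: leeD; apply: lee_wpmul2l.
rewrite -!EFinM -!EFinD lee_fin /T0 -/k /C00.
(* The weights [r] and [1/r] make the two quadratic terms equal, each giving half of
   [4 r be^2 k]. *)
have -> : k / 2 * r * (4 * be ^+ 2 + M5 * be ^+ 3) +
  k / 2 * r^-1 * (4 * (r * be) ^+ 2 + M5 * (r * be) ^+ 3) + 4 * L * r * be ^+ 3 * @M4 R n =
  r * (4 * be ^+ 2 * k + be ^+ 3 * (k * (M5 * ((1 + r) / 2)) + 4 * L * @M4 R n)).
  by field; rewrite gt_eqF.
rewrite ler_wpM2l// lerD2l ler_wpM2l ?exprn_ge0// lerD2r.
apply: ler_pM => //; [by rewrite !mulr_ge0// addr_ge0|exact: KM|].
by rewrite ler_piMr// ler_pdivrMr// mul1r -[leRHS]/(1 + 1) lerD2l.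
Qed.

Let mJ : measurable_fun setT J.
Proof.
apply: measurable_funD; last exact: measurable_funM.
apply: measurable_funM; first by apply: measurable_funM => //; exact: (mKf my0).
apply: measurable_funD; apply: measurable_funM => //.
  exact: (measurable_funX 2 mD).
exact: (measurable_funX 2 mD').
Qed.

(** The comparison holds only after averaging over [B]: pointwise [R1 - prod >= T0 - J], and the
    mean of [J] is at most the constant [T0]. *)
Let inner_ge0 a z :
  (0 <= \int[G]_b (R1 ((a, z), b) - prod ((a, z), b))%:E)%E.
Proof.
have mpr : measurable_fun setT (fun b : V => ((a, z), b)).
  exact: pair1_measurable.
pose F b := R1 ((a, z), b) - prod ((a, z), b).
pose Jb b := J ((a, z), b).
pose T := T0 ((a, z), a).
have be0' := ltW be0; have r0' := ltW r0.
have iF : G.-integrable setT (EFin \o F).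
  apply: (@integrable_growth _ _ _ ((4 * M + 4 * L + C00) + 4 * (M + L))).
    by apply: measurable_funB; [exact: (measurableT_comp mR1)|exact: (measurableT_comp mprod)].
  move=> b; rewrite /F mulrDl; apply: (le_trans (ler_normB _ _)); apply: lerD.
    exact: (R1_le ((a, z), b)).
  exact: (prod_bounds ((a, z), b)).2.
have mJb : measurable_fun setT Jb by exact: (measurableT_comp mJ mpr).
have J0 b : 0 <= Jb b.
  rewrite /Jb /J addr_ge0//.
    by rewrite mulr_ge0 ?divr_ge0// addr_ge0// mulr_ge0 ?invr_ge0// sqr_ge0.
  by rewrite mulr_ge0 ?exprn_even_ge0// mulr_ge0 ?exprn_ge0// !mulr_ge0.
have iJ : G.-integrable setT (EFin \o Jb).
  apply/integrableP; split; first exact/measurable_EFinP.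
  under eq_integral do rewrite /= ger0_norm//.
  by apply: (le_lt_trans (integral_J_le a z)); rewrite ltry.
have iT : G.-integrable setT (EFin \o cst T).
  exact: finite_measure_integrable_cst.
have h1 : \int[G]_b Jb b <= T.
  have hJ := integral_J_le a z.
  rewrite /Rintegral -[leRHS]/(fine T%:E) fine_le//.
  exact: integrable_fin_num.
have h2 : \int[G]_b (cst T b - Jb b) <= \int[G]_b F b.
  apply: le_Rintegral => //; first exact: (integrableB measurableT iT iJ).
  move=> b _; rewrite /F /=; apply: lerB; last exact: (prod_bounds ((a, z), b)).1.
  exact: (T0_le_R1 ((a, z), b)).
rewrite (RintegralB measurableT iT iJ) Rintegral_cst//= probability_setT mulr1 in h2.
have h3 : 0 <= \int[G]_b F b by apply: le_trans h2; rewrite subr_ge0.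
rewrite -[X in (_ <= X)%E]fineK; first by rewrite lee_fin.
exact: (integrable_fin_num measurableT iF).
Qed.

Let integral_K : \int[gauss3]_p K (f (r *: (al *: A p + be *: B p) + s *: Z p)) =
  \int[G]_x K (f (tvec x)).
Proof.
pose k (x : V) := K (f (tvec x)).
have mk : measurable_fun setT k by apply: mKf; exact: measurable_tvec.
have mF1 : measurable_fun setT (fun p : V * V * V => k p.1.1).
  exact: (mKf mA).
rewrite -[RHS]/(\int[G]_x k x) -(Rintegral_gauss3_1 mk).
have ben0 : be != 0 by rewrite gt_eqF.
(* A rotation needs a nonzero second coefficient; if [s = 0] then [r = 1] and [Z] is absent. *)
have [sE|sn0] := eqVneq s 0.
  have rE : r = 1.
    have : r ^+ 2 = 1 by have := s2; rewrite sE expr0n/= => /eqP; rewrite eq_sym subr_eq0 => /eqP ->.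
    by move=> /eqP; rewrite sqrf_eq1 => /orP[/eqP//|/eqP rN]; move: r0; rewrite rN ltr0N1.
  rewrite -(Rintegral_rot13 albe ben0 mF1); apply: eq_Rintegral => p _.
  by rewrite /k !rot13E sE rE scale1r scale0r addr0.
have rs : r ^+ 2 + s ^+ 2 = 1 by rewrite s2 addrC subrK.
rewrite -(Rintegral_rot12 rs sn0 mF1).
have mF2 := measurableT_comp mF1 (measurable_rot12 r s).
rewrite -(Rintegral_rot13 albe ben0 mF2); apply: eq_Rintegral => p _.
by rewrite -[RHS]/(K (f (tvec (rot12 r s (rot13 al be p)).1.1))) rot12E !rot13E.
Qed.

(** Since [r - r (al^2 - be^2) = 2 r be^2], this bounds a difference quotient of [Q] by the mean of
    [K] up to [O(be)]. *)
Lemma covariance_step_le :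
  2 * (Q r - Q (r * (al ^+ 2 - be ^+ 2))) <=
  r * (4 * be ^+ 2 * (\int[G]_x K (f (tvec x)) + L * be * @M4 R n) + be ^+ 3 * C00).
Proof.
have N0 (p : V * V * V) : 0 <= N1 p.2 ^+ 4 by rewrite exprn_even_ge0.
have iP : gauss3.-integrable setT (EFin \o prod).
  apply: (@integrable_growth3 _ _ _ (4 * (M + L)) mprod) => p.
  apply: (le_trans (prod_bounds p).2); rewrite ler_wpM2l ?N1_le_N3//.
  by rewrite mulr_ge0// addr_ge0.
have iR : gauss3.-integrable setT (EFin \o R1).
  apply: (@integrable_growth3 _ _ _ (4 * M + 4 * L + C00) mR1) => p.
  apply: (le_trans (R1_le p)); rewrite ler_wpM2l ?N1_le_N3//.
  by rewrite addr_ge0// addr_ge0// mulr_ge0.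
have h1 : 0 <= \int[gauss3]_p (R1 p - prod p).
  apply: fine_ge0; rewrite (prob_prod_fubini (integrableB measurableT iR iP)).
  by apply: integral_ge0 => -[a z] _; exact: inner_ge0.
rewrite (RintegralB measurableT iR iP) subr_ge0 integral_prod in h1.
apply: (le_trans h1); rewrite le_eqVlt; apply/orP; left; apply/eqP.
pose k p := K (f (r *: (al *: A p + be *: B p) + s *: Z p)).
have ik : gauss3.-integrable setT (EFin \o k).
  apply: (@integrable_growth3 _ _ _ M); first exact: (mKf (mW be)).
  move=> p; rewrite ger0_norm; last exact: K0.
  by apply: (le_trans (KM _)); rewrite ler_peMr// exprn_ege1// N3_ge1.
have iN : gauss3.-integrable setT (EFin \o (fun p : V * V * V => N1 p.2 ^+ 4)).
  apply: (@integrable_growth3 _ _ _ 1 mN) => p.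
  by rewrite mul1r ger0_norm// N1_le_N3.
have iLN : gauss3.-integrable setT (EFin \o (fun p : V * V * V => L * be * N1 p.2 ^+ 4)).
  exact: (integrableZl measurableT (L * be) iN).
have ikN : gauss3.-integrable setT (EFin \o (fun p => k p + L * be * N1 p.2 ^+ 4)).
  exact: (integrableD measurableT ik iLN).
have i4 : gauss3.-integrable setT
    (EFin \o (fun p => 4 * be ^+ 2 * (k p + L * be * N1 p.2 ^+ 4))).
  exact: (integrableZl measurableT (4 * be ^+ 2) ikN).
have iC : gauss3.-integrable setT (EFin \o (fun _ : V * V * V => be ^+ 3 * C00)).
  exact: finite_measure_integrable_cst.
have iS : gauss3.-integrable setT
    (EFin \o (fun p => 4 * be ^+ 2 * (k p + L * be * N1 p.2 ^+ 4) + be ^+ 3 * C00)).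
  exact: (integrableD measurableT i4 iC).
rewrite /R1 (RintegralZl _ measurableT iS) (RintegralD measurableT i4 iC).
rewrite (RintegralZl _ measurableT ikN) (RintegralD measurableT ik iLN) integral_K.
rewrite (RintegralZl _ measurableT iN) Rintegral_cst//= probability_setT mulr1.
congr (_ * (_ * (_ + _ * _) + _)).
have mN1 : measurable_fun setT (fun x : V => (N1 x ^+ 4)%:E).
  by apply/measurable_EFinP; apply: measurable_funX; exact: measurable_N1.
congr fine; apply: (ge0_integral_prob_prod_snd gauss2 G mN1).
by move=> x; rewrite lee_fin exprn_even_ge0.
Qed.

End step.

Let mN3 : measurable_fun setT (@N3 R n).
Proof.
have mE (u : V * V * V -> 'cV[R]_n) : measurable_vec u ->
    measurable_fun setT (fun p => enorm (u p)).
  by move=> mu; apply: measurable_lip1 => //; exact: enorm_lip1.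
by apply: measurable_funD; [apply: measurable_funD; [apply: measurable_funD|]|] => //; exact: mE.
Qed.

Let iN3 : gauss3.-integrable setT (EFin \o (fun p => @N3 R n p ^+ 4)).
Proof.
apply: (@integrable_growth3 _ _ _ 1); first exact: measurable_funX.
by move=> p; rewrite mul1r ger0_norm// exprn_even_ge0.
Qed.

Let Q1 : Q 1 = \int[G]_x (f (tvec x) * g (tvec x)).
Proof.
pose k (x : V) := f (tvec x) * g (tvec x).
have mk : measurable_fun setT k.
  by apply: measurable_funM; [apply: mf|apply: mg]; exact: measurable_tvec.
rewrite -[RHS]/(\int[G]_x k x) -(Rintegral_gauss3_1 mk).
apply: eq_Rintegral => p _.
by rewrite expr1n subrr sqrtr0 scale1r scale0r addr0.
Qed.

Let A_le p : enorm (A p) <= N3 p.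
Proof.
rewrite /A /N3; have := enorm_ge0 (tvec p.1.2); have := enorm_ge0 (tvec p.2); lra.
Qed.

Let Z_le p : enorm (Z p) <= N3 p.
Proof.
rewrite /Z /N3; have := enorm_ge0 (tvec p.1.1); have := enorm_ge0 (tvec p.2); lra.
Qed.

Let AZ_le p : enorm (A p) + enorm (Z p) <= N3 p.
Proof. rewrite /A /Z /N3; have := enorm_ge0 (tvec p.2); lra. Qed.

Let f_le (p : V * V * V) : `|f (A p)| <= (`|f 0| + 1) * N3 p.
Proof.
rewrite mulrDl mul1r -[f (A p)](subrK (f 0)) addrC.
apply: (le_trans (ler_normD _ _)); apply: lerD.
  by rewrite ler_peMr// N3_ge1.
by apply: le_trans (A_le p); apply: (le_trans (lf _ _)); rewrite subr0.
Qed.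

Hypothesis f_mean : \int[G]_x f (tvec x) = 0.

(** This is [Q 0]. A quarter turn moves the argument of [f] to the innermost variable of
    integration, where the mean of [f] appears as a factor. *)
Let integral_indep : \int[gauss3]_p (f (A p) * g (Z p)) = 0.
Proof.
have o1 : (0 : R) ^+ 2 + 1 ^+ 2 = 1 by rewrite expr0n expr1n add0r.
have mF : measurable_fun setT (fun p => f (A p) * g (Z p)).
  by apply: measurable_funM; [exact: mf|exact: mg].
rewrite -(Rintegral_rot13 o1 (oner_neq0 R) mF).
transitivity (\int[gauss3]_p (f (B p) * g (Z p))).
  by apply: eq_Rintegral => p _; rewrite /A /B /Z !rot13E scale0r scale1r add0r.
have B_le (p : V * V * V) : enorm (B p) <= N3 p.
  rewrite /B /N3; have := enorm_ge0 (tvec p.1.1); have := enorm_ge0 (tvec p.1.2); lra.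
have iF := integrable_fg mB mZ B_le Z_le.
rewrite /Rintegral (prob_prod_fubini iF).
rewrite (eq_integral (cst 0%E)); first by rewrite integral0.
move=> -[a z] _ /=.
rewrite -[LHS]/(\int[G]_y ((EFin \o (fun x => f (tvec x))) y * (g (tvec z))%:E))%E.
have if1 := integrable_lip1 lf.
rewrite integralZr// -[X in (X * _)%E]fineK; last exact: integrable_fin_num.
by rewrite -[fine _]/(\int[G]_x f (tvec x)) f_mean mul0e.
Qed.

(** The geometric sequence never reaches 0, so a rate at 0 is needed. It comes from the Lipschitz
    bound on [g] and from [1 - sqrt (1 - r^2) <= r]. *)
Let Q_le : exists C4, 0 <= C4 /\ forall r, 0 <= r -> r <= 1 -> Q r <= C4 * r.
Proof.
pose I := \int[gauss3]_p (@N3 R n p ^+ 4).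
have I0 : 0 <= I by apply: Rintegral_ge0 => p _; rewrite exprn_even_ge0.
exists (M * (`|f 0| + 1) * I); split; first by rewrite !mulr_ge0// addr_ge0.
move=> r r0 r1; pose s := Num.sqrt (1 - r ^+ 2).
have s0 : 0 <= s by exact: sqrtr_ge0.
have s2 : s ^+ 2 = 1 - r ^+ 2 by rewrite sqr_sqrtr// subr_ge0 exprn_ile1.
have s1 : s <= 1 by rewrite -(@ler_pXn2r _ 2)// ?nnegrE// s2 expr1n lerBlDr lerDl sqr_ge0.
have sr : 1 - s <= r.
  have : (1 - r) ^+ 2 <= s ^+ 2.
    rewrite s2 -subr_ge0 (_ : _ - _ = 2 * (r * (1 - r))); last by ring.
    by rewrite !mulr_ge0// subr_ge0.
  by rewrite ler_pXn2r ?nnegrE ?subr_ge0// => ?; rewrite lerBlDr addrC -lerBlDr.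
have W_le p : enorm (r *: A p + s *: Z p) <= N3 p.
  by apply: lin_le (AZ_le p); rewrite ger0_norm.
have mW : measurable_vec (fun p => r *: A p + s *: Z p).
  by apply: measurable_vecD; exact: measurable_vecZ.
have i1 := integrable_fg mA mW A_le W_le.
have i2 := integrable_fg mA mZ A_le Z_le.
have -> : Q r = \int[gauss3]_p (f (A p) * g (r *: A p + s *: Z p) - f (A p) * g (Z p)).
  by rewrite (RintegralB measurableT i1 i2) integral_indep subr0.
have iNr : gauss3.-integrable setT (EFin \o (fun p => (M * (`|f 0| + 1) * r) * @N3 R n p ^+ 4)).
  exact: (integrableZl measurableT _ iN3).
rewrite mulrAC -(RintegralZl _ measurableT iN3).
apply: le_Rintegral => //; first exact: (integrableB measurableT i1 i2).
move=> p _; rewrite -mulrBr; apply: (le_trans (ler_norm _)); rewrite normrM.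
have g1 : `|g (r *: A p + s *: Z p) - g (Z p)| <= M * (r * N3 p).
  apply: (le_trans (gM _ _)); rewrite ler_wpM2l//.
  have -> : r *: A p + s *: Z p - Z p = r *: A p + (s - 1) *: Z p.
    by rewrite scalerBl scale1r addrA.
  apply: (le_trans (enormD _ _)); rewrite !enormZ (ger0_norm r0) ler0_norm ?subr_le0// opprB.
  apply: (@le_trans _ _ (r * (enorm (A p) + enorm (Z p)))); last by rewrite ler_wpM2l.
  by rewrite mulrDr lerD2l ler_wpM2r// enorm_ge0.
apply: (le_trans (ler_pM (normr_ge0 _) (normr_ge0 _) (f_le p) g1)).
have -> : (`|f 0| + 1) * N3 p * (M * (r * N3 p)) = (M * (`|f 0| + 1) * r) * N3 p ^+ 2 by ring.
rewrite ler_wpM2l//; first by rewrite !mulr_ge0// addr_ge0.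
by apply: ler_weXn2l => //; exact: N3_ge1.
Qed.

Lemma stein_inequality :
  \int[G]_x (f (tvec x) * h (f (tvec x))) <= \int[G]_x K (f (tvec x)).
Proof.
have [M5 [M50 varf]] := variance_bound C0 lf cf.
have [C4 [C40 hQ]] := Q_le.
rewrite -[leLHS]/(\int[G]_x (f (tvec x) * g (tvec x))) -Q1.
set EK := Rintegral _ _ _.
have EK0 : 0 <= EK by apply: Rintegral_ge0.
(* The error terms of [covariance_step_le] divided by [4 be^3 r]. *)
pose C3 := L * @M4 R n + (M * M5 + 4 * L * @M4 R n) / 4.
have C30 : 0 <= C3 by rewrite addr_ge0 ?divr_ge0 ?addr_ge0 ?mulr_ge0 ?M4_ge0.
have key be N : 0 < be -> be <= 1 / 2 ->
    Q 1 <= EK + be * C3 + C4 * (1 - 2 * be ^+ 2) ^+ N.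
  move=> be0 be1; set c := 1 - 2 * be ^+ 2.
  have [c0 a0] := half_sqr be0 be1; rewrite -/c in c0.
  have c1 : c <= 1 by rewrite gerBl mulr_ge0// exprn_ge0// ltW.
  pose al := Num.sqrt (1 - be ^+ 2).
  have al2 : al ^+ 2 = 1 - be ^+ 2 by rewrite sqr_sqrtr// ltW.
  have al0 : 0 < al by rewrite sqrtr_gt0.
  have albe : al ^+ 2 + be ^+ 2 = 1 by rewrite al2 subrK.
  have cE : al ^+ 2 - be ^+ 2 = c by rewrite al2 /c; ring.
  (* A Riemann sum along [1, c, c^2, ...]: the step from [c^N] has length [c^N (1 - c)], and the
     lengths telescope. *)
  have : Q 1 - Q (c ^+ N) <= (1 - c ^+ N) * (EK + be * C3).
    elim: N => [|N IH]; first by rewrite expr0 !subrr mul0r.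
    have cN0 : 0 < c ^+ N by exact: exprn_gt0.
    have cN1 : c ^+ N <= 1 by rewrite exprn_ile1// ltW.
    have := covariance_step_le albe al0 be0 cN0 cN1 M50 varf.
    rewrite cE -exprSr -/EK => st.
    have -> : (1 - c ^+ N.+1) * (EK + be * C3) =
        (1 - c ^+ N) * (EK + be * C3) + c ^+ N * (1 - c) * (EK + be * C3).
      by rewrite exprSr; ring.
    have -> : Q 1 - Q (c ^+ N.+1) = (Q 1 - Q (c ^+ N)) + (Q (c ^+ N) - Q (c ^+ N.+1)).
      by rewrite addrA subrK.
    apply: lerD => //; rewrite -(ler_pM2l (_ : 0 < 2))//.
    apply: (le_trans st); rewrite le_eqVlt; apply/orP; left; apply/eqP.
    by rewrite /c /C3; field.
  have cN : 0 <= c ^+ N by rewrite exprn_ge0// ltW.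
  have cN1 : c ^+ N <= 1 by rewrite exprn_ile1// ltW.
  have := hQ _ cN cN1.
  have : (1 - c ^+ N) * (EK + be * C3) <= EK + be * C3.
    by rewrite ler_piMl ?addr_ge0 ?mulr_ge0 ?(ltW be0)// gerBl.
  move: (Q 1) (Q _) (EK + _) (C4 * _) (_ * (_ + _)) => q1 q2 q3 q4 q5; lra.
apply/ler_addgt0Pr => e e0.
(* [be] is fixed first, to make the accumulated error small; [N] is then chosen in terms of [be], to
   bring the sequence close to 0. *)
pose be := Num.min (1 / 2) (e / 2 / (C3 + 1)).
have be0 : 0 < be by rewrite lt_min; apply/andP; split; rewrite ?divr_gt0//; lra.
have be1 : be <= 1 / 2 by rewrite ge_min lexx.
have beC : be * C3 <= e / 2.
  apply: (@le_trans _ _ (be * (C3 + 1))).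
    by rewrite ler_wpM2l ?(ltW be0)// lerDl.
  by rewrite -ler_pdivlMr ?ge_min ?lexx ?orbT//; lra.
have [N hN] : exists N, C4 * (1 - 2 * be ^+ 2) ^+ N <= e / 2.
  have c0 : 0 <= 1 - 2 * be ^+ 2 by rewrite ltW// (half_sqr be0 be1).1.
  have c1 : 1 - 2 * be ^+ 2 < 1 by rewrite gtrBl mulr_gt0// exprn_gt0.
  have cn : `|1 - 2 * be ^+ 2| < 1 by rewrite ger0_norm.
  have d0 : 0 < e / 2 / (C4 + 1) by rewrite !divr_gt0//; lra.
  have := cvg_expr cn => /cvgrPdist_lt/(_ _ d0)[N _ /(_ N (leqnn N))] /=.
  rewrite sub0r normrN ger0_norm ?exprn_ge0// => hN; exists N.
  apply: (@le_trans _ _ ((C4 + 1) * (1 - 2 * be ^+ 2) ^+ N)).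
    by rewrite ler_wpM2r ?exprn_ge0// lerDl.
  by rewrite mulrC -ler_pdivlMr ?ltW//; lra.
apply: (le_trans (key be N be0 be1)).
rewrite -addrA lerD2l (_ : e = e / 2 + e / 2); first exact: lerD.
by move=> {beC hN}; field.
Qed.

End stein.

(** * Concentration *)

Section test_function.
Context {R : realType}.
Implicit Types a b m w : R.

Lemma expR_sub_le a b : expR b - expR a <= expR b * (b - a).
Proof.
have -> : expR a = expR b * expR (a - b) by rewrite -expRD addrC subrK.
rewrite -{1}[expR b]mulr1 -mulrBr ler_wpM2l ?expR_ge0//.
by have := expR_ge1Dx (a - b); lra.
Qed.

(** Division by zero gives the value 0 at 0, which is the continuous extension. By construction
    [1 + w * tilt w] is [exp(w^2/2)], which also bounds the slope. *)
Definition tilt w := (expR (w ^+ 2 / 2) - 1) / w.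

Lemma tilt0 : tilt 0 = 0.
Proof. by rewrite /tilt invr0 mulr0. Qed.

Lemma tiltN w : tilt (- w) = - tilt w.
Proof. by rewrite /tilt sqrrN invrN mulrN. Qed.

Lemma mul_tilt w : w * tilt w = expR (w ^+ 2 / 2) - 1.
Proof.
have [->|w0] := eqVneq w 0; last by rewrite /tilt mulrC divfK.
by rewrite mul0r expr0n mul0r expR0 subrr.
Qed.

Lemma expR_sqr_ge1 w : 1 <= expR (w ^+ 2 / 2).
Proof. by rewrite -[leLHS]expR0 ler_expR divr_ge0// sqr_ge0. Qed.

Lemma tilt_bounds w : 0 <= w -> 0 <= tilt w <= expR (w ^+ 2 / 2) * w / 2.
Proof.
rewrite le_eqVlt => /orP[/eqP <-|w0]; first by rewrite tilt0 mulr0 mul0r lexx.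
apply/andP; split; first by rewrite divr_ge0 ?(ltW w0)// subr_ge0 expR_sqr_ge1.
have := expR_sub_le 0 (w ^+ 2 / 2); rewrite expR0 subr0 => h.
rewrite ler_pdivrMr//; apply: (le_trans h).
by rewrite le_eqVlt; apply/orP; left; apply/eqP; field.
Qed.

(** Numerator and denominator are changed one at a time. Upwards, the increment is at most that of
    [exp(w^2/2)] divided by [b], and [(b^2 - a^2)/(2b) <= b - a]; downwards,
    [tilt b >= tilt a * (a / b)]. *)
Lemma tilt_lipschitz_pos a b m : 0 <= a -> a <= b -> expR (b ^+ 2 / 2) <= m ->
  `|tilt b - tilt a| <= m * (b - a).
Proof.
rewrite le_eqVlt => /orP[/eqP <-|a0] ab bm.
  have /andP[h1 h2] := tilt_bounds ab.
  rewrite tilt0 !subr0 ger0_norm//; apply: (le_trans h2).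
  have : expR (b ^+ 2 / 2) * b <= m * b by rewrite ler_wpM2r.
  have : 0 <= expR (b ^+ 2 / 2) * b by rewrite mulr_ge0// expR_ge0.
  by move: (_ * b) (m * b) => p q; lra.
have b0 : 0 < b by exact: lt_le_trans ab.
have ba0 : 0 <= b - a by rewrite subr_ge0.
have a0' := ltW a0; have b0' := ltW b0.
have eab : expR (a ^+ 2 / 2) <= expR (b ^+ 2 / 2).
  by rewrite ler_expR ler_wpM2r ?invr_ge0// ler_pXn2r ?nnegrE.
have m0 : 0 <= m by apply: le_trans bm; exact: expR_ge0.
have ea1 := expR_sqr_ge1 a.
rewrite ler_norml; apply/andP; split.
  have /andP[_ h] := tilt_bounds (ltW a0).
  have h1 : tilt a * (a / b) <= tilt b.
    rewrite /tilt mulrA divfK ?gt_eqF// ler_wpM2r ?invr_ge0 ?(ltW b0)//.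
    by rewrite lerD2r.
  have h2 : tilt a - tilt a * (a / b) <= m * (b - a).
    have -> : tilt a - tilt a * (a / b) = tilt a / b * (b - a) by field; rewrite gt_eqF.
    rewrite ler_wpM2r// ler_pdivrMr//; apply: (le_trans h).
    rewrite -mulrA; apply: ler_pM => //; [by rewrite divr_ge0|exact: le_trans bm|].
    by rewrite ler_pdivrMr//; lra.
  by move: h1 h2; move: (tilt a * _) (m * _) => t v; lra.
have h1 : (expR (a ^+ 2 / 2) - 1) / b <= tilt a.
  by rewrite ler_wpM2l ?subr_ge0// lef_pV2 ?posrE.
have h2 : tilt b - (expR (a ^+ 2 / 2) - 1) / b <= m * (b - a).
  rewrite /tilt -mulrBl opprB addrA subrK ler_pdivrMr//.
  rewrite -[m * _ * b]mulrA; apply: (le_trans (expR_sub_le _ _)).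
  rewrite -mulrBl subr_sqr; apply: ler_pM => //.
    by rewrite divr_ge0// mulr_ge0// addr_ge0.
  by rewrite ler_pdivrMr// -[leRHS]mulrA ler_wpM2l//; lra.
by move: h1 h2; move: (_ / b) (m * _) => t v; lra.
Qed.

Lemma tilt_lipschitz a b m : expR (a ^+ 2 / 2) <= m -> expR (b ^+ 2 / 2) <= m ->
  `|tilt a - tilt b| <= m * `|a - b|.
Proof.
wlog ab : a b / a <= b.
  move=> H am bm; have [/H|/ltW /H] := leP a b; first exact.
  by move/(_ bm am); rewrite (distrC (tilt b)) (distrC b).
move=> am bm; rewrite distrC [`|a - b|]distrC [`|b - a|]ger0_norm ?subr_ge0//.
have [a0|a0] := leP 0 a; first exact: tilt_lipschitz_pos.
have [b0|b0] := leP b 0.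
  have := @tilt_lipschitz_pos (- b) (- a) m; rewrite oppr_ge0 lerN2 sqrrN !tiltN.
  by rewrite opprK [- tilt a + _]addrC [- a + _]addrC opprK; apply.
have /andP[h1 h2] := tilt_bounds (ltW b0).
have na0 : 0 <= - a by rewrite oppr_ge0 ltW.
(* For points of opposite signs the increment splits at 0, where [tilt] vanishes. *)
have /andP[] := tilt_bounds na0; rewrite tiltN sqrrN => h3 h4.
rewrite ger0_norm ?addr_ge0//.
have h5 : expR (b ^+ 2 / 2) * b <= m * b by rewrite ler_wpM2r// ltW.
have h6 : expR (a ^+ 2 / 2) * - a <= m * - a by rewrite ler_wpM2r.
have h7 : 0 <= m * b by rewrite mulr_ge0 ?(ltW b0)// (le_trans _ bm)// expR_ge0.
have h8 : 0 <= m * - a by rewrite mulr_ge0// (le_trans _ bm)// expR_ge0.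
have -> : m * (b - a) = m * b + m * - a by ring.
move: (expR _ * b) (expR _ * - a) (m * b) (m * - a) h2 h4 h5 h6 h7 h8 => p q r s; lra.
Qed.

Variables (u d : R).
Hypotheses (u0 : 0 < u) (d0 : 0 < d).

Definition clip w := Num.max (- u) (Num.min w u).

Lemma clip_id w : `|w| <= u -> clip w = w.
Proof.
by rewrite ler_norml => /andP[h1 h2]; rewrite /clip min_l// max_r.
Qed.

Lemma clip_bound w : `|clip w| <= u.
Proof.
rewrite ler_norml /clip le_max lexx/= ge_max ge_min lexx orbT andbT.
by rewrite ge0_cp// ltW.
Qed.

Lemma clip_pos w : u <= w -> clip w = u.
Proof. by move=> uw; rewrite /clip min_r// max_r// ge0_cp// ltW. Qed.

Lemma clip_neg w : w <= - u -> clip w = - u.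
Proof.
move=> uw; rewrite /clip max_l// ge_min uw//.
Qed.

Lemma clip_le_abs w : `|clip w| <= `|w|.
Proof.
have [wu|/ltW wu] := leP `|w| u; first by rewrite clip_id.
exact: le_trans (clip_bound w) wu.
Qed.

Lemma clip_lipschitz a b : `|clip a - clip b| <= `|a - b|.
Proof.
wlog ab : a b / a <= b.
  move=> H; have [/H|/ltW /H] := leP a b; first exact.
  by rewrite (distrC (clip b)) (distrC b).
rewrite distrC [`|a - b|]distrC [`|b - a|]ger0_norm ?subr_ge0//.
have u0' := ltW u0.
have [au|au] := leP a (- u); last have [ua|ua] := leP u a.
- rewrite (clip_neg au); have [bu|bu] := leP b (- u); last have [ub|ub] := leP u b.
  + by rewrite (clip_neg bu) subrr normr0 subr_ge0.
  + by rewrite (clip_pos ub) ger0_norm; lra.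
  + rewrite (@clip_id b); last by rewrite ler_norml; apply/andP; split; lra.
    by rewrite ger0_norm; lra.
- by rewrite (clip_pos ua) clip_pos ?(le_trans ua)// subrr normr0 subr_ge0.
- rewrite (@clip_id a); last by rewrite ler_norml; apply/andP; split; lra.
  have [ub|ub] := leP u b; first by rewrite (clip_pos ub) ger0_norm; lra.
  rewrite (@clip_id b); last by rewrite ler_norml; apply/andP; split; lra.
  by rewrite ger0_norm; lra.
Qed.

(** If the clipped values differ, [clip a] lies between [a] and [b], hence in every interval that
    contains both. *)
Lemma clip_mem a b w r : clip a != clip b -> `|a - w| <= r -> `|b - w| <= r ->
  `|clip a - w| <= r.
Proof.
have u0' := ltW u0; move=> ab; rewrite !ler_norml => /andP[a1 a2] /andP[b1 b2].
have [au|au] := leP a (- u); last have [ua|ua] := leP u a.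
- have [bu|bu] := leP b (- u); first by move: ab; rewrite !clip_neg// eqxx.
  by rewrite clip_neg//; apply/andP; split; lra.
- have [bu|bu] := leP u b; first by move: ab; rewrite !clip_pos// eqxx.
  by rewrite clip_pos//; apply/andP; split; lra.
- rewrite clip_id; first by rewrite a1.
  by rewrite ler_norml; apply/andP; split; lra.
Qed.

Let E := expR (u ^+ 2 / 2).

Let E1 : 1 <= E. Proof. exact: expR_sqr_ge1. Qed.

Let E0 : 0 < E. Proof. exact: expR_gt0. Qed.

Let expR_clip_le w : expR (clip w ^+ 2 / 2) <= E.
Proof.
rewrite ler_expR ler_wpM2r ?invr_ge0// -real_normK ?num_real//.
by rewrite ler_pXn2r ?nnegrE ?clip_bound// ltW.
Qed.

Definition stein_fun w := tilt (clip w).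

(* Equals [exp(w^2/2)], an upper bound of the slope of [tilt], on [[-u, u]], and
   decreases to 0 within distance [d], to be Lipschitz. *)
Definition stein_slope w : R :=
  Num.max 0 (expR (clip w ^+ 2 / 2) - E / d * (`|w| - `|clip w|)).

(** [E * u] is a Lipschitz constant of [exp(c^2/2)] on [[-u, u]], and [|w| - |clip w|] is
    2-Lipschitz. *)
Definition stein_slope_lip : R := E * u + E / d * 2.

Lemma stein_slope_ge0 w : 0 <= stein_slope w.
Proof. by rewrite /stein_slope le_max lexx. Qed.

Lemma stein_slope_le w : stein_slope w <= E.
Proof.
rewrite /stein_slope ge_max (ltW E0)/=; apply: le_trans (expR_clip_le w).
by rewrite gerBl mulr_ge0 ?divr_ge0 ?(ltW E0) ?(ltW d0)// subr_ge0 clip_le_abs.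
Qed.

Lemma stein_slope_lip_ge0 : 0 <= stein_slope_lip.
Proof. by rewrite addr_ge0// ?mulr_ge0 ?invr_ge0 ?(ltW E0) ?(ltW u0) ?(ltW d0). Qed.

Lemma stein_slope_lipschitz a b :
  `|stein_slope a - stein_slope b| <= stein_slope_lip * `|a - b|.
Proof.
have maxlip (x y : R) : `|Num.max 0 x - Num.max 0 y| <= `|x - y|.
  have [x0|/ltW x0] := leP 0 x; have [y0|/ltW y0] := leP 0 y.
  - by [].
  - by rewrite !ger0_norm; lra.
  - by rewrite !ler0_norm; lra.
  - by rewrite subrr normr0.
apply: (le_trans (maxlip _ _)).
set p := expR _; set q := expR _.
have -> : p - E / d * (`|a| - `|clip a|) - (q - E / d * (`|b| - `|clip b|)) =
  (p - q) - E / d * ((`|a| - `|b|) - (`|clip a| - `|clip b|)) by ring.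
apply: (le_trans (ler_normB _ _)); rewrite /stein_slope_lip mulrDl; apply: lerD.
  apply: (@le_trans _ _ (E * (u * `|clip a - clip b|))); last first.
    by rewrite -mulrA ler_wpM2l ?(ltW E0)// ler_wpM2l ?(ltW u0)// clip_lipschitz.
  have sq : `|clip a ^+ 2 / 2 - clip b ^+ 2 / 2| <= u * `|clip a - clip b|.
    rewrite -mulrBl subr_sqr !normrM [`|2^-1|]ger0_norm ?invr_ge0// -mulrA mulrC.
    rewrite ler_wpM2r// ler_pdivrMr//; apply: (le_trans (ler_normD _ _)).
    by rewrite mulr_natr mulr2n lerD// clip_bound.
  have h x y : expR x <= E -> expR x - expR y <= E * `|x - y|.
    move=> xE; apply: (le_trans (expR_sub_le _ _)).
    apply: (@le_trans _ _ (expR x * `|x - y|)).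
      by rewrite ler_wpM2l ?expR_ge0// ler_norm.
    by rewrite ler_wpM2r.
  apply: (@le_trans _ _ (E * `|clip a ^+ 2 / 2 - clip b ^+ 2 / 2|)); last first.
    by rewrite ler_wpM2l// ltW.
  rewrite ler_norml; apply/andP; split; last exact: h.
  by rewrite lerNl opprB distrC; exact: h.
rewrite normrM [`|E / d|]ger0_norm ?divr_ge0 ?(ltW E0) ?(ltW d0)// -mulrA.
rewrite ler_wpM2l ?divr_ge0 ?(ltW E0) ?(ltW d0)//.
apply: (le_trans (ler_normB _ _)); rewrite mulrDl mul1r; apply: lerD.
  exact: ler_dist_dist.
by apply: (le_trans (ler_dist_dist _ _)); exact: clip_lipschitz.
Qed.

Lemma stein_fun_lipschitz a b : `|stein_fun a - stein_fun b| <= E * `|a - b|.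
Proof.
apply: (@le_trans _ _ (E * `|clip a - clip b|)); first exact: tilt_lipschitz.
by rewrite ler_wpM2l ?(ltW E0)// clip_lipschitz.
Qed.

Let stein_slope_id w : `|w| <= u -> stein_slope w = expR (w ^+ 2 / 2).
Proof.
by move=> wu; rewrite /stein_slope clip_id// subrr mulr0 subr0 max_r// expR_ge0.
Qed.

(** Only points with different clipped values matter. These values then lie within [r] of [w], where
    [stein_slope] equals the exponential bound on the slope of [tilt] and differs from its value at
    [w] by at most [stein_slope_lip * r]. *)
Lemma stein_fun_slope w r a b : `|a - w| <= r -> `|b - w| <= r ->
  `|stein_fun a - stein_fun b| <= (stein_slope w + stein_slope_lip * r) * `|a - b|.
Proof.
move=> aw bw.
have r0 : 0 <= r by exact: le_trans aw.
have S0 : 0 <= stein_slope w + stein_slope_lip * r.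
  by rewrite addr_ge0 ?stein_slope_ge0// mulr_ge0// stein_slope_lip_ge0.
have [ab|ab] := eqVneq (clip a) (clip b).
  by rewrite /stein_fun ab subrr normr0 mulr_ge0.
have H x y : clip x != clip y -> `|x - w| <= r -> `|y - w| <= r ->
    expR (clip x ^+ 2 / 2) <= stein_slope w + stein_slope_lip * r.
  move=> xy xw yw; have cw := clip_mem xy xw yw.
  rewrite -stein_slope_id ?clip_bound// -lerBlDl.
  apply: (le_trans (ler_norm _)); apply: (le_trans (stein_slope_lipschitz _ _)).
  by rewrite ler_wpM2l// stein_slope_lip_ge0.
apply: (@le_trans _ _ ((stein_slope w + stein_slope_lip * r) * `|clip a - clip b|)).
  by apply: tilt_lipschitz; [exact: (H a b)|apply: (H b a) => //; rewrite eq_sym].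
by rewrite ler_wpM2l// clip_lipschitz.
Qed.

Lemma stein_gap w :
  stein_slope w - w * stein_fun w <= 1 - E * (u + d <= `|w|)%R%:R.
Proof.
have u0' := ltW u0; have d0' := ltW d0.
have [wu|uw] := leP `|w| u.
  rewrite stein_slope_id// /stein_fun clip_id// mul_tilt.
  have -> : (u + d <= `|w|) = false by apply/negbTE; rewrite -ltNge (le_lt_trans wu)// ltrDl.
  by rewrite mulr0; lra.
have tE : E - 1 <= w * stein_fun w.
  have ut : u * tilt u = E - 1 by rewrite mul_tilt.
  have tu0 : 0 <= tilt u by have /andP[] := tilt_bounds u0'.
  have [w0|w0] := leP 0 w.
    rewrite ger0_norm// in uw; rewrite /stein_fun clip_pos ?(ltW uw)// -ut.
    by rewrite ler_wpM2r// ltW.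
  rewrite ltr0_norm// in uw; rewrite /stein_fun clip_neg; last by rewrite lerNr ltW.
  by rewrite tiltN mulrN -mulNr -ut ler_wpM2r// ltW.
have [wd|wd] := leP (u + d) `|w|; last first.
  (* In the transition zone [u < |w| < u + d] the slope may be as large as [E], but
     [w * stein_fun w >= E - 1] still keeps the difference at most 1. *)
  by rewrite mulr0 subr0; have := stein_slope_le w; lra.
rewrite mulr1; suff -> : stein_slope w = 0 by lra.
rewrite /stein_slope max_l// subr_le0.
apply: (le_trans (expR_clip_le w)); rewrite -mulrA ler_peMr ?(ltW E0)//.
rewrite mulrC ler_pdivlMr// mul1r; have := clip_bound w; lra.
Qed.

End test_function.

Section concentration.
Context {R : realType} {n : nat}.
Notation G := (@gauss R n).

Lemma measurable_lipschitz (h : R -> R) (M : R) :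
  (forall a b, `|h a - h b| <= M * `|a - b|) -> measurable_fun setT h.
Proof.
move=> hM; apply: continuous_measurable_fun => x.
apply/cvgrPdist_lt => e e0.
have M0 : 0 <= M.
  have := hM 1 0; rewrite subr0 normr1 mulr1; exact: le_trans.
near=> y; apply: (le_lt_trans (hM _ _)).
apply: (@le_lt_trans _ _ ((M + 1) * `|x - y|)); first by rewrite ler_wpM2r// lerDl.
rewrite mulrC -ltr_pdivlMr; last by lra.
near: y; apply: cvgr_dist_lt => //; rewrite divr_gt0//; lra.
Unshelve. all: by end_near. Qed.

Lemma measurable_ge_norm d (T : measurableType d) (X : T -> R) (a : R) :
  measurable_fun setT X -> measurable [set t | a <= `|X t|].
Proof.
move=> mX; rewrite -[X in measurable X]setTI.
have -> : [set t | a <= `|X t|] = (fun t => `|X t|) @^-1` `[a, +oo[%classic.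
  by apply/seteqP; split=> t /=; rewrite in_itv/= andbT.
by apply: measurableT_comp => //; exact: measurable_itv.
Qed.

Lemma gauss_tail_c11 (f : 'cV[R]_n -> R) (C u d : R) : lip1 f -> 0 <= C ->
  approx_c11 C f -> \int[G]_x f (tvec x) = 0 -> 0 < u -> 0 < d ->
  (G [set x | (u + d <= `|f (tvec x)|)%R] <= (expR (- (u ^+ 2 / 2)))%:E)%E.
Proof.
move=> lf C0 cf f0 u0 d0.
have mK := measurable_lipschitz (@stein_slope_lipschitz R u d u0 d0).
have mh := measurable_lipschitz (@stein_fun_lipschitz R u u0).
have st := stein_inequality lf C0 cf mh mK (stein_slope_lip_ge0 u0 d0)
  (@stein_slope_ge0 R u d) (@stein_slope_le R u d u0 d0)
  (@stein_slope_lipschitz R u d u0 d0) (@stein_fun_lipschitz R u u0)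
  (@stein_fun_slope R u d u0 d0) f0.
set S := [set x | _].
have mf := measurable_lip1_tvec lf.
have mS : measurable S by exact: measurable_ge_norm.
set E := expR (u ^+ 2 / 2) in st.
have E0 : 0 < E by exact: expR_gt0.
have N0 (x : n.-tuple R) : 1 <= N1 x ^+ 4 by rewrite exprn_ege1// N1_ge1.
pose W x := f (tvec x).
have iK : G.-integrable setT (EFin \o (fun x => stein_slope u d (W x))).
  apply: (@integrable_growth _ _ _ E); first exact: (measurableT_comp mK).
  move=> x; rewrite ger0_norm ?stein_slope_ge0//.
  by apply: (le_trans (stein_slope_le u0 d0 _)); rewrite ler_peMr// ltW.
have iH : G.-integrable setT (EFin \o (fun x => W x * stein_fun u (W x))).
  apply: (@integrable_growth _ _ _ ((`|f 0| + 1) * (E * u))).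
    by apply: measurable_funM => //; exact: (measurableT_comp mh).
  move=> x; rewrite normrM mulrAC; apply: ler_pM => //; first exact: lip1_growth.
  have := @tilt_lipschitz R (clip u (W x)) 0 E.
  rewrite tilt0 !subr0 expr0n mul0r expR0 => h.
  apply: (le_trans (h _ _)); last by rewrite ler_wpM2l ?(ltW E0)// clip_bound.
    rewrite ler_expR ler_wpM2r ?invr_ge0// -real_normK ?num_real//.
    by rewrite ler_pXn2r ?nnegrE ?clip_bound// ltW.
  exact: expR_sqr_ge1.
have i0 : G.-integrable setT (EFin \o (\1_S : n.-tuple R -> R)).
  apply: (@integrable_growth _ _ _ 1); first exact: measurable_indic.
  move=> x; rewrite mul1r (le_trans _ (N0 x))// ger0_norm indicE//.
  by case: (_ \in _).
have i1 : G.-integrable setT (EFin \o (fun x => E * \1_S x)).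
  exact: (integrableZl measurableT E i0).
have ic : G.-integrable setT (EFin \o (fun=> 1 : R)).
  exact: finite_measure_integrable_cst.
have gap : \int[G]_x (stein_slope u d (W x) - W x * stein_fun u (W x)) <=
    \int[G]_x (1 - E * \1_S x).
  apply: le_Rintegral => //.
  - exact: (integrableB measurableT iK iH).
  - exact: (integrableB measurableT ic i1).
  - move=> x _; apply: (le_trans (stein_gap u0 d0 (W x))).
    rewrite indicE le_eqVlt; apply/orP; left; apply/eqP; congr (1 - E * (nat_of_bool _)%:R).
    by apply/idP/idP; rewrite inE.
rewrite (RintegralB measurableT iK iH) (RintegralB measurableT ic i1) in gap.
rewrite (RintegralZl _ measurableT i0) Rintegral_cst//= probability_setT mulr1 in gap.
have GS : G S \is a fin_num by exact: fin_num_measure.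
have eS : \int[G]_x \1_S x = fine (G S).
  by rewrite /Rintegral integral_indic// setIT.
rewrite eS in gap.
rewrite -(fineK GS) lee_fin expRN -/E -[leRHS]mul1r ler_pdivlMr// mulrC.
by move: st gap; rewrite /W; move: (E * _) => e; lra.
Qed.

Lemma approx_c11_cst (f : 'cV[R]_n -> R) (C m : R) :
  approx_c11 C f -> approx_c11 C (fun x => f x - m).
Proof.
move=> cf x e e01; have [q [q1 hq]] := cf x e e01; exists q; split => // v.
by have := hq v; rewrite opprB addrA subrK.
Qed.

(** Of the loss [3 * eta], one part comes from replacing [f] by its regularization, one from
    replacing its mean, and one is the width [d] of the transition zone. *)
Lemma gauss_tail (f : 'cV[R]_n -> R) (u eta : R) : lip1 f -> 0 < eta -> 3 * eta < u ->
  (G [set x | (u <= `|f (tvec x) - \int[G]_y f (tvec y)|)%R] <=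
   (expR (- ((u - 3 * eta) ^+ 2 / 2)))%:E)%E.
Proof.
move=> lf eta0 ue; have [k [C [lk C0 ck fk]]] := lip1_smoothing eta0 lf.
pose mf := \int[G]_y f (tvec y); pose mk := \int[G]_y k (tvec y).
have iff := integrable_lip1 lf; have ik := integrable_lip1 lk.
have mm : `|mk - mf| <= eta.
  rewrite /mk /mf -(RintegralB measurableT ik iff).
  have iB := integrableB measurableT ik iff.
  apply: (le_trans (le_normr_Rintegral measurableT iB)).
  have -> : eta = \int[G]_x eta.
    by rewrite Rintegral_cst//= probability_setT mulr1.
  apply: le_Rintegral => //.
  - exact: (integrable_norm iB).
  - exact: finite_measure_integrable_cst.
pose k0 x := k x - mk.
have lk0 : lip1 k0 by move=> x y; rewrite /k0 opprB addrA subrK; exact: lk.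
have m0 : \int[G]_x k0 (tvec x) = 0.
  rewrite /k0 (RintegralB measurableT ik); last exact: finite_measure_integrable_cst.
  by rewrite Rintegral_cst//= probability_setT mulr1 subrr.
have u0 : 0 < u - 3 * eta by rewrite subr_gt0.
apply: (le_trans _ (gauss_tail_c11 lk0 C0 (approx_c11_cst mk ck) m0 u0 eta0)).
apply: le_measure; rewrite ?inE.
- apply: measurable_ge_norm; apply: measurable_funB => //; exact: measurable_lip1_tvec.
- by apply: measurable_ge_norm; exact: measurable_lip1_tvec.
- move=> x /=; rewrite /k0 -/mf => h.
  have := fk (tvec x); move: mm h; move: (f _) (k _) => p q.
  rewrite !ler_norml !ler_normr => /andP[? ?] /orP h /andP[? ?].
  by apply/orP; case: h => h; [left|right]; lra.
Qed.

Lemma gauss_concentration (f : 'cV[R]_n -> R) (u : R) : lip1 f -> 0 < u ->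
  (G [set x | (u <= `|f (tvec x) - \int[G]_y f (tvec y)|)%R] <=
   (expR (- (u ^+ 2 / 2)))%:E)%E.
Proof.
move=> lf u0; set S := [set x | _].
have mS : measurable S.
  by apply: measurable_ge_norm; apply: measurable_funB => //; exact: measurable_lip1_tvec.
have GS : G S \is a fin_num by exact: fin_num_measure.
rewrite -(fineK GS) lee_fin.
have [p0|p0] := leP (fine (G S)) 0; first by apply: (le_trans p0); exact: expR_ge0.
(* On the logarithmic scale the loss is additive, at most [3 u eta], and the choice of [eta] below
   makes it at most [e]. *)
rewrite -[leLHS]lnK ?posrE// ler_expR; apply/ler_addgt0Pr => e e0.
pose eta := Num.min (u / 4) (e / (3 * u)).
have eta0 : 0 < eta by rewrite lt_min !divr_gt0// mulr_gt0.
have eta1 : eta <= u / 4 by rewrite ge_min lexx.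
have eta2 : 3 * u * eta <= e.
  by rewrite mulrC -ler_pdivlMr ?mulr_gt0// ge_min lexx orbT.
have ue : 3 * eta < u by lra.
have := gauss_tail lf eta0 ue; rewrite -/S -(fineK GS) lee_fin.
rewrite -[X in X <= _ -> _]lnK ?posrE// ler_expR => h.
apply: (le_trans h).
have -> : - ((u - 3 * eta) ^+ 2 / 2) = - (u ^+ 2 / 2) + 3 * u * eta - (3 * eta) ^+ 2 / 2 by field.
have : 0 <= (3 * eta) ^+ 2 / 2 by rewrite divr_ge0// sqr_ge0.
by move: (_ / 2) (- _) => p q; lra.
Qed.

End concentration.

(** * Nonexpansiveness of the estimator *)

Section prox.
Context {R : realType} {n : nat}.
Implicit Types (u v x y : 'cV[R]_n).

Lemma norm_nE v : norm_n v = enorm v / Num.sqrt n%:R.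
Proof.
rewrite /norm_n /enorm -sqrtrV// -sqrtrM ?dotvv_ge0//; congr (Num.sqrt (_ / _)).
by rewrite mxE; apply: eq_bigr => i _; rewrite mxE.
Qed.

Lemma sqr_norm_nE v : norm_n v ^+ 2 = dotv v v / n%:R.
Proof. by rewrite norm_nE exprMn exprVn sqr_enorm sqr_sqrtr. Qed.

Variable pen : 'cV[R]_n -> \bar R.
Hypothesis n_gt0 : (0 < n)%N.
Hypothesis pen_convex : convex_ereal pen.

Let obj Y g := ((norm_n (Y - g) ^+ 2)%:E + pen g)%E.

(** If the minimum were infinite, every point would be a minimizer, against uniqueness; [n > 0]
    provides a second point. *)
Lemma argmin_pen_fin Y x : is_argmin (obj Y) x -> pen x \is a fin_num.
Proof.
move=> [xmin xuniq]; rewrite fin_numE pen_convex.1/=; apply/eqP => px.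
have objoo g : obj Y g = +oo%E.
  by apply/eqP; rewrite -leye_eq; apply: le_trans (xmin g); rewrite /obj px addey.
have : x = x + const_mx 1 by apply: xuniq => y; rewrite !objoo.
move=> /matrixP/(_ (Ordinal n_gt0) 0); rewrite !mxE => /eqP.
by rewrite -subr_eq0 opprD addrA subrr add0r oppr_eq0 oner_eq0.
Qed.

(** The minimizer is compared with a point of the segment towards [y], and the inequality is divided
    by [s]. As [s] tends to 0 this becomes the first-order optimality condition, without
    subgradients. *)
Lemma argmin_convex_comb Y x y (s : R) : is_argmin (obj Y) x -> pen y \is a fin_num ->
  0 < s <= 1 ->
  fine (pen x) - fine (pen y) <=
    (s * dotv (y - x) (y - x) - 2 * dotv (Y - x) (y - x)) / n%:R.
Proof.
move=> xarg yfin /andP[s0 s1]; have xfin := argmin_pen_fin xarg.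
have n0 : 0 < n%:R :> R by rewrite ltr0n.
have sb : 0 <= s <= 1 by rewrite (ltW s0).
have := pen_convex.2 y x s sb.
have /(_ (s *: y + (1 - s) *: x)) := xarg.1.
rewrite /obj -(fineK xfin) -(fineK yfin) -!EFinM -EFinD.
set p := pen (_ + _) => h1 h2.
have pfin : p \is a fin_num.
  by rewrite fin_numE pen_convex.1/=; apply/eqP => pE; rewrite pE in h2.
move: h1 h2; rewrite -(fineK pfin) -!EFinD !lee_fin !sqr_norm_nE.
have -> : Y - (s *: y + (1 - s) *: x) = (Y - x) - s *: (y - x).
  by apply/matrixP => i j; rewrite !mxE; ring.
move: (Y - x) (y - x) => z w.
have -> : dotv (z - s *: w) (z - s *: w) = dotv z z - 2 * s * dotv z w + s ^+ 2 * dotv w w.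
  by rewrite !dotvE (dotvC w z); ring.
move=> h1 h2; rewrite ler_pdivlMr// -(ler_pM2l s0).
have : dotv z z / n%:R + fine (pen x) <=
  (dotv z z - 2 * s * dotv z w + s ^+ 2 * dotv w w) / n%:R +
  (s * fine (pen y) + (1 - s) * fine (pen x)).
  by apply: (le_trans h1); rewrite lerD2l.
move=> /(fun h => ler_wpM2r (ltW n0) h); rewrite !(mulrDl _ _ n%:R) !divfK ?gt_eqF//=.
by move: (dotv _ _) (dotv _ _) (dotv _ _) => a b c; rewrite expr2; lra.
Qed.

Lemma argmin_nonexpansive Y Y' x x' : is_argmin (obj Y) x -> is_argmin (obj Y') x' ->
  enorm (x - x') <= enorm (Y - Y').
Proof.
move=> hx hx'.
have n0 : 0 < n%:R :> R by rewrite ltr0n.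
(* In the sum of the optimality inequalities of [x] against [x'] and of [x'] against [x] the
   penalties cancel, which leaves firm nonexpansiveness up to the factor [1 - s]. *)
have H (s : R) : 0 < s <= 1 -> (1 - s) * enorm (x - x') <= enorm (Y - Y').
  move=> s01.
  have h1 := argmin_convex_comb hx (argmin_pen_fin hx') s01.
  have h2 := argmin_convex_comb hx' (argmin_pen_fin hx) s01.
  have h3 : 0 <= ((s * dotv (x' - x) (x' - x) - 2 * dotv (Y - x) (x' - x)) +
      (s * dotv (x - x') (x - x') - 2 * dotv (Y' - x') (x - x'))) / n%:R.
    by rewrite mulrDl; move: h1 h2; move: (_ / n%:R) (_ / n%:R) => a b; lra.
  have h4 : (1 - s) * dotv (x - x') (x - x') <= dotv (Y - Y') (x - x').
    move: h3; rewrite pmulr_lge0 ?invr_gt0//.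
    have -> : x' - x = - (x - x') by rewrite opprB.
    have -> : Y - x = (Y - Y') + (Y' - x') - (x - x').
      by apply/matrixP => i j; rewrite !mxE; ring.
    by move: (Y - Y') (Y' - x') (x - x') => a b c; rewrite !dotvE; lra.
  have [x0|x0] := eqVneq (enorm (x - x')) 0; first by rewrite x0 mulr0 enorm_ge0.
  have xp : 0 < enorm (x - x') by rewrite lt_neqAle eq_sym x0 enorm_ge0.
  rewrite -(ler_pM2r xp) -mulrA -expr2 sqr_enorm; apply: (le_trans h4).
  exact: cauchy_schwarz.
apply/ler_addgt0Pr => e e0.
pose s := Num.min 1 (e / (enorm (x - x') + 1)).
have d0 : 0 < enorm (x - x') + 1 by rewrite ltr_wpDl ?enorm_ge0.
have s01 : 0 < s <= 1 by rewrite lt_min ltr01 divr_gt0//= ge_min lexx.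
have := H s s01.
have : s * enorm (x - x') <= e.
  apply: (@le_trans _ _ (s * (enorm (x - x') + 1))).
    by rewrite ler_wpM2l ?lerDl//; case/andP: s01 => /ltW.
  by rewrite -ler_pdivlMr// ge_min lexx orbT.
by move: (enorm _) => p; lra.
Qed.

End prox.

(** * McShane extension *)

Section mcshane.
Context {R : realType} {n : nat}.
Variables (T : Type) (X : T -> 'cV[R]_n) (phi : T -> R).
Hypothesis phiX : forall w w', `|phi w - phi w'| <= enorm (X w - X w').
Hypothesis phi0 : forall w, 0 <= phi w.
Variable w0 : T.

(* [X] need not be onto, hence an extension from its range. *)
Definition mcshane (x : 'cV[R]_n) : R := inf (range (fun w => phi w + enorm (x - X w))).

Let mcshane_le x w : mcshane x <= phi w + enorm (x - X w).
Proof.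
apply: ge_inf; last by exists w.
by exists 0 => _ [w' _ <-]; rewrite addr_ge0// enorm_ge0.
Qed.

Let le_mcshane x a : (forall w, a <= phi w + enorm (x - X w)) -> a <= mcshane x.
Proof.
move=> h; apply: lb_le_inf; first by exists (phi w0 + enorm (x - X w0)); exists w0.
by move=> _ [w _ <-].
Qed.

Lemma mcshane_ge0 x : 0 <= mcshane x.
Proof. by apply: le_mcshane => w; rewrite addr_ge0// enorm_ge0. Qed.

Lemma mcshaneE w : mcshane (X w) = phi w.
Proof.
apply/eqP; rewrite eq_le; apply/andP; split.
  by apply: (le_trans (mcshane_le _ w)); rewrite subrr enorm0 addr0.
apply: le_mcshane => w'; have := phiX w w'; rewrite ler_norml => /andP[_]; lra.
Qed.

Lemma mcshane_lip1 : lip1 mcshane.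
Proof.
have H x x' : mcshane x - enorm (x - x') <= mcshane x'.
  apply: le_mcshane => w; have := mcshane_le x w; have := enormD (x - x') (x' - X w).
  by rewrite addrA subrK; lra.
move=> x x'; rewrite ler_norml; have := H x x'; have := H x' x; rewrite (enormB x' x).
by move=> h1 h2; apply/andP; split; lra.
Qed.

End mcshane.

Theorem theorem2p1 (R : realType) (n : nat) (n_gt0 : (0 < n)%N)
    (pen : 'cV[R]_n -> \bar R) (pen_convex : convex_ereal pen)
    (g0 : 'cV[R]_n) (sigma : R) (sigma_gt0 : 0 < sigma)
    (d : measure_display) (T : measurableType d) (P : probability T R)
    (eps : 'I_n -> {RV P >-> R})
    (eps_indep : independent_RVs eps)
    (eps_normal : forall i, has_normal_law (eps i) 0 sigma)
    (Y : T -> 'cV[R]_n) (Y_def : forall w, Y w = g0 + \col_i eps i w)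
    (ghat : T -> 'cV[R]_n)
    (ghat_def : forall w,
      is_argmin (fun g => ((norm_n (Y w - g) ^+ 2)%:E + pen g)%E) (ghat w)) :
  let m0 := ('E_P[fun w => norm_n (ghat w - g0)])%E in
  forall t : R, 0 < t ->
    (P [set w | (sigma * Num.sqrt (2 * t / n%:R))%:E <=
                `| (norm_n (ghat w - g0))%:E - m0 |]
      <= (expR (- t))%:E)%E.
Proof.
move=> m0 t t0.
have n0 : 0 < n%:R :> R by rewrite ltr0n.
have sn0 : 0 < Num.sqrt n%:R :> R by rewrite sqrtr_gt0.
(* A space of total mass 1 is inhabited; the infimum in [mcshane] is therefore over a nonempty
   set. *)
have [w0 _] : exists w0 : T, True.
  apply: contrapT => /forallNP h.
  have : P setT = 0%E.
    by rewrite (_ : setT = set0) ?measure0//; apply/seteqP; split => w // _; exact: (h w).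
  by rewrite probability_setT => /eqP; rewrite onee_eq0.
pose X w : n.-tuple R := [tuple eps i w / sigma | i < n].
pose k := sigma / Num.sqrt n%:R.
have k0 : 0 < k by rewrite divr_gt0.
pose phi w := enorm (ghat w - g0) / sigma.
have FE w : norm_n (ghat w - g0) = k * phi w.
  by rewrite norm_nE /k /phi; field; rewrite !gt_eqF.
have tX w : tvec (X w) = sigma^-1 *: (\col_i eps i w).
  by apply/matrixP => i j; rewrite !mxE tnth_mktuple mulrC.
have phi0 w : 0 <= phi w by rewrite divr_ge0 ?enorm_ge0 ?ltW.
(* Two sample points give two instances of the minimization problem, with data [Y w] and [Y w'] that
   differ by the noise only. *)
have phiX w w' : `|phi w - phi w'| <= enorm (tvec (X w) - tvec (X w')).
  have si0 : 0 < sigma^-1 by rewrite invr_gt0.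
  rewrite !tX -scalerBr enormZ /phi -mulrBl normrM (gtr0_norm si0) mulrC ler_pM2l//.
  apply: (le_trans (enorm_lip1 _ _)); rewrite opprB addrA subrK.
  apply: (le_trans (argmin_nonexpansive n_gt0 pen_convex (ghat_def w) (ghat_def w'))).
  by rewrite !Y_def opprD addrACA subrr add0r.
pose f := mcshane (fun w => tvec (X w)) phi.
have lf : lip1 f by exact: mcshane_lip1.
(* The scaled error thus factors through [X], so its measurability and its law are read off from
   those of [X]. *)
have fE w : f (tvec (X w)) = phi w by exact: mcshaneE.
have mX : measurable_fun setT X.
  apply/measurable_fun_tnthP => i.
  rewrite (_ : _ \o _ = fun w => eps i w / sigma); last first.
    by apply/funext => w /=; rewrite tnth_mktuple.
  by apply: measurable_funM => //; exact: measurable_funPT.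
have law B : measurable B -> P (X @^-1` B) = gauss n B.
  apply: gauss_unique mX _ _ => A mA.
  pose A' i := (fun x : R => x / sigma) @^-1` A i.
  have mA' i : measurable (A' i).
    rewrite -[A' i]setTI; have : measurable_fun setT (fun x : R => x / sigma).
      by apply: measurable_funM.
    by apply.
  have := eps_indep [set: 'I_n]%SET A' mA'.
  rewrite (_ : \bigcap_(i in _) _ = [set w | forall i, A i (tnth (X w) i)]); last first.
    apply/seteqP; split => w /= h i.
      by rewrite tnth_mktuple; apply: h; rewrite /= inE.
    by move=> _; have := h i; rewrite tnth_mktuple.
  move=> ->; apply: eq_big => [i|i _]; first by rewrite inE.
  by rewrite -(gauss1_normal_prob sigma_gt0 (mA i)) -(eps_normal i _ (mA' i)).
have mf := measurable_lip1_tvec lf.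
have intf := integrable_lip1 lf.
pose m := \int[gauss n]_x f (tvec x).
(* The nonnegativity of the extension allows the change of variables in the expectation; finiteness
   comes from the integrability of Lipschitz functions under [gauss n]. *)
have m0E : m0 = (k * m)%:E.
  have f0 x : 0 <= f x by exact: mcshane_ge0.
  have mkf : measurable_fun setT (fun x : n.-tuple R => (k * f (tvec x))%:E).
    by apply/measurable_EFinP; apply: measurable_funM.
  rewrite /m0 unlock.
  transitivity (\int[image_measure P mX]_x (k * f (tvec x))%:E)%E.
    rewrite ge0_integral_pushforward//; first last.
    - by move=> x _; rewrite lee_fin mulr_ge0// ltW.
    - by apply: eq_integral => w _; rewrite FE -fE.
  rewrite (eq_measure_integral (gauss n)); last by move=> B mB _; exact: law.
  under eq_integral do rewrite EFinM.
  by rewrite integralZl// (EFinM k) /m /Rintegral fineK// integrable_fin_num.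
rewrite m0E.
pose S := [set x : n.-tuple R | Num.sqrt (2 * t) <= `|f (tvec x) - m|].
have mS : measurable S.
  by apply: measurable_ge_norm; apply: measurable_funB.
(* Both sides carry the factor [k = sigma / sqrt n]; without it the threshold is [u = sqrt (2 t)],
   for which [u^2 / 2 = t]. *)
have SE w : ((sigma * Num.sqrt (2 * t / n%:R))%:E <=
    `|(norm_n (ghat w - g0))%:E - (k * m)%:E|)%E = (Num.sqrt (2 * t) <= `|f (tvec (X w)) - m|).
  rewrite FE fE -EFinB abse_EFin lee_fin -mulrBr normrM (gtr0_norm k0).
  by rewrite sqrtrM ?mulr_ge0 ?(ltW t0)// sqrtrV// mulrCA mulrC -/k ler_pM2l.
rewrite (_ : [set w | _] = X @^-1` S); last first.
  by apply/funext => w; rewrite /S /preimage /= SE.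
rewrite law//.
have u0 : 0 < Num.sqrt (2 * t) by rewrite sqrtr_gt0 mulr_gt0.
have := gauss_concentration lf u0.
by rewrite sqr_sqrtr ?mulr_ge0 ?(ltW t0)// mulrAC divff// mul1r.
Qed.
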